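(* Let $p\ge1$ and let $K\subset\mathbf{R}^N$ be compact. If the $J_p$-property does not hold for $K$, then there is a set of parallel lines, of nonzero $(N-1)$-dimensional Lebesgue measure, such that each line in the set intersects $K$ in uncountably many points.
   Context: For $\Omega$ open, $W^{1,p}(\Omega)$ is the usual Sobolev space: $u\in L^p(\Omega)$ with weak first derivatives and $\sum_{|\alpha|\le1}\|D^\alpha u\|_{L^p(\Omega)}<\infty$. $W^{1,p}(\Omega,\mathbf{R}^N)$ denotes the set of functions $\mathbf{R}^N\to\mathbf{R}$ whose restriction to $\Omega$ is in $W^{1,p}(\Omega)$. Capacity: for compact $F\subset\mathbf{R}^N$, $C_{1,p}(F)=\inf\{\sum_{|\alpha|\le1}\|D^\alpha\varphi\|_{L^p(\mathbf{R}^N)}:\varphi\in C_0^\infty(\mathbf{R}^N),\ \varphi|_F\ge1\}$; for open $\omega$, $C_{1,p}(\omega)=\sup\{C_{1,p}(F):F\subset\omega\text{ compact}\}$. A measurable $u:\mathbf{R}^N\to\mathbf{R}$ is quasicontinuous if for every $\epsilon>0$ there is an open $\omega$ with $C_{1,p}(\omega)<\epsilon$ and $u|_{\mathbf{R}^N\setminus\omega}$ continuous; $Q$ is the set of quasicontinuous functions on $\mathbf{R}^N$. $K$ has the $J_p$-property (quasicontinuous version) if $Q\cap W^{1,p}(K^c,\mathbf{R}^N)=Q\cap W^{1,p}(\mathbf{R}^N)$, where $K^c=\mathbf{R}^N\setminus K$. A set of parallel lines is measured by the $(N-1)$-dimensional Lebesgue measure of its intersection with a hyperplane perpendicular to the lines.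 *)

(* Defs.v *)
From HB Require Import structures.
From mathcomp Require Import all_boot all_order all_algebra.
From mathcomp Require Import all_classical all_reals all_analysis.

Set Implicit Arguments.
Unset Strict Implicit.
Unset Printing Implicit Defensive.

Import Order.TTheory GRing.Theory Num.Theory.
Import numFieldNormedType.Exports.

Local Open Scope classical_set_scope.
Local Open Scope ring_scope.

(* R^n is 'rV[R]_n. Its library topology is that of the sup norm, which is the
   Euclidean one. *)

Section lebesgue.
Variables (R : realType) (n : nat).

Definition box (ab : 'rV[R]_n * 'rV[R]_n) : set 'rV[R]_n :=
  [set x | forall i, ab.1 0 i < x 0 i <= ab.2 0 i].

Definition box_volume (ab : 'rV[R]_n * 'rV[R]_n) : R :=
  \prod_(i < n) Num.max 0 (ab.2 0 i - ab.1 0 i).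

(* For n = 0 the only box is the whole one-point space, of volume 1. This is why
   countable families of boxes, possibly empty, are used rather than sequences
   of boxes: the empty set must have a cover of total volume 0. *)
Definition lebesgue_outer (A : set 'rV[R]_n) : \bar R :=
  ereal_inf [set \esum_(ab in D) (box_volume ab)%:E | D in
    [set D | countable D /\ A `<=` \bigcup_(ab in D) box ab]].

Lemma box_volume_ge0 ab : 0 <= box_volume ab.
Proof. by apply: prodr_ge0 => i _; rewrite le_max lexx. Qed.

Lemma lebesgue_outer_ge0 A : (0 <= lebesgue_outer A)%E.
Proof.
apply: le_ereal_inf_tmp => _ [D _ <-].
by apply: esum_ge0 => ab _; rewrite lee_fin box_volume_ge0.
Qed.

Lemma lebesgue_outer0 : lebesgue_outer set0 = 0%E.
Proof.
apply/eqP; rewrite eq_le lebesgue_outer_ge0 andbT.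
apply: ereal_inf_lbound; exists set0; last by rewrite esum_set0.
by split; [exact: countable0|exact: sub0set].
Qed.

Lemma le_lebesgue_outer : {homo lebesgue_outer : A B / A `<=` B >-> (A <= B)%E}.
Proof.
move=> A B AB; apply: ereal_inf_le_tmp => _ [D [cD BD] <-].
by exists D => //; split => //; exact: subset_trans BD.
Qed.

Lemma esum_bigcup_le (T : choiceType) (D : (set T)^nat) (a : T -> \bar R) :
  (forall x, 0 <= a x)%E ->
  (\esum_(x in \bigcup_k D k) a x <= \sum_(k <oo) \esum_(x in D k) a x)%E.
Proof.
move=> a0; rewrite seqDU_bigcup_eq (@esum_bigcupT R T setT _ _ (@trivIset_seqDU T D))//.
rewrite -nneseries_esumT; last by move=> k; exact: esum_ge0.
apply: lee_nneseries => k _; first by move=> _; exact: esum_ge0.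
rewrite esum_mkcond [leRHS]esum_mkcond; apply: le_esum => x _.
case: ifPn => [xD|_]; last by case: ifP.
by rewrite (mem_set (subset_seqDU (set_mem xD))).
Qed.

Lemma lebesgue_outer_sigma_subadditive : sigma_subadditive lebesgue_outer.
Proof.
move=> A; have [[i ioo]|] := pselect (exists i, lebesgue_outer (A i) = +oo%E).
  rewrite (eseries_pinfty _ _ ioo) ?leey// => k _.
  by rewrite -ltNye (lt_le_trans _ (lebesgue_outer_ge0 _)).
rewrite -forallNE => Aoo; apply/lee_addgt0Pr => e e0.
apply: le_trans (epsilon_trick xpredT _ (ltW e0)); last first.
  by move=> k; exact: lebesgue_outer_ge0.
have /choice[D PD] k : exists D : set ('rV[R]_n * 'rV[R]_n),
    [/\ countable D, A k `<=` \bigcup_(ab in D) box ab &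
    (\esum_(ab in D) (box_volume ab)%:E <=
     lebesgue_outer (A k) + (e / (2 ^ k.+1)%:R)%:E)%E].
  have ek0 : 0 < e / (2 ^ k.+1)%:R by rewrite divr_gt0// ltr0n expn_gt0.
  have Afin : lebesgue_outer (A k) \is a fin_num.
    rewrite ge0_fin_numE ?lebesgue_outer_ge0// ltey.
    by apply/eqP; exact: Aoo.
  have [_ [D [cD AD] <-] /ltW De] := lb_ereal_inf_adherent ek0 Afin.
  by exists D.
apply: (@le_trans _ _ (\esum_(ab in \bigcup_k D k) (box_volume ab)%:E)%E).
  apply: ereal_inf_lbound; exists (\bigcup_k D k) => //; split.
    by apply: bigcup_countable => // k _; case: (PD k).
  move=> x [k _ Akx]; have [_ /(_ _ Akx)[ab Dab abx] _] := PD k.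
  by exists ab => //; exists k.
apply: le_trans; first by apply: esum_bigcup_le => ab; rewrite lee_fin box_volume_ge0.
apply: lee_nneseries => k _; last by case: (PD k).
by move=> _; apply: esum_ge0 => ab _; rewrite lee_fin box_volume_ge0.
Qed.

HB.instance Definition _ := isOuterMeasure.Build R 'rV[R]_n lebesgue_outer
  lebesgue_outer0 lebesgue_outer_ge0 le_lebesgue_outer
  lebesgue_outer_sigma_subadditive.

(* 'rV[R]_n with the (complete) sigma-algebra of Lebesgue measurable sets *)
Definition lebesgue_space := caratheodory_type lebesgue_outer.

HB.instance Definition _ := Measurable.on lebesgue_space.

Definition leb : set lebesgue_space -> \bar R := lebesgue_outer.

HB.instance Definition _ := isMeasure.Build _ lebesgue_space R leb
  (@caratheodory_measure0 R _ lebesgue_outer)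
  (@caratheodory_measure_ge0 R _ lebesgue_outer)
  (@caratheodory_measure_sigma_additive R _ lebesgue_outer).

End lebesgue.

Arguments lebesgue_space R n : clear implicits.
Arguments leb R n : clear implicits.

Section sobolev.
Variables (R : realType) (n : nat).
Local Notation N := n.+1.
Local Notation Rn := 'rV[R]_N.
Local Notation space := (lebesgue_space R N).
Local Notation mu := (leb R N).
Implicit Types (u : Rn -> R) (g : 'I_N -> Rn -> R) (phi : Rn -> R).
Implicit Types (F K Omega omega : set Rn) (p : R).

Definition partial (i : 'I_N) phi : Rn -> R := 'D_(delta_mx 0 i) phi.

Definition smooth phi := forall s : seq 'I_N, let psi := foldr partial phi s in
  continuous psi /\ forall i x, derivable psi x (delta_mx 0 i).

(* phi is in C_0^oo(Omega) *)
Definition test_function Omega phi :=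
  let supp := closure [set x | phi x != 0] in
  [/\ smooth phi, compact supp & supp `<=` Omega].

(* u \_ Omega vanishes outside Omega, so this is the norm of L^p(Omega). *)
Definition Lp_norm p Omega u : \bar R := ('N[mu]_(p%:E) [EFin \o (u \_ Omega)])%E.

Definition sobolev_norm p Omega u g : \bar R :=
  (Lp_norm p Omega u + \sum_(i < N) Lp_norm p Omega (g i))%E.

Definition weak_partial Omega (i : 'I_N) u (v : Rn -> R) :=
  forall phi, test_function Omega phi ->
  (\int[mu]_(x in Omega) (u x * partial i phi x)%:E =
   - \int[mu]_(x in Omega) (v x * phi x)%:E)%E.

(* The set of functions on R^N whose restriction to Omega is in W^{1,p}(Omega).
   For p >= 1, finiteness of the norm makes u and its weak derivatives locally
   integrable on Omega, so that both integrals in weak_partial are finite. *)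
Definition W1p p Omega : set (Rn -> R) := [set u : Rn -> R |
  measurable_fun (Omega : set space) u /\
  exists g, [/\ forall i, measurable_fun (Omega : set space) (g i),
    forall i, weak_partial Omega i u (g i) &
    (sobolev_norm p Omega u g < +oo)%E]].

Definition capacity_compact p F : \bar R :=
  ereal_inf [set sobolev_norm p setT phi (partial ^~ phi) | phi in
    [set phi | test_function setT phi /\ forall x, F x -> 1 <= phi x]].

Definition capacity_open p omega : \bar R :=
  ereal_sup [set capacity_compact p F | F in
    [set F | compact F /\ F `<=` omega]].

Definition quasicontinuous p : set (Rn -> R) := [set u : Rn -> R |
  measurable_fun [set: space] u /\
  forall eps : R, 0 < eps -> exists omega, [/\ open omega,
    (capacity_open p omega < eps%:E)%E & {within ~` omega, continuous u}]].

Definition J_property p K :=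
  quasicontinuous p `&` W1p p (~` K) = quasicontinuous p `&` W1p p setT.

Definition line (a d : Rn) : set Rn := [set a + t *: d | t in [set: R]].

(* d is a unit vector and the rows of B are an orthonormal basis of the
   hyperplane orthogonal to d, so y |-> y *m B is an isometry from R^(N-1) onto
   that hyperplane *)
Definition perpendicular_frame (d : Rn) (B : 'M[R]_(n, N)) :=
  [/\ d *m d^T = 1%:M, B *m B^T = 1%:M & B *m d^T = 0].

Definition parallel_to (d : Rn) (L : set (set Rn)) :=
  forall l, L l -> exists a, l = line a d.

(* The intersection of the union of the lines in L, all parallel to d, with the
   hyperplane orthogonal to d, read in R^(N-1) through B. *)
Definition hyperplane_trace (d : Rn) (B : 'M[R]_(n, N)) (L : set (set Rn)) :
    set (lebesgue_space R n) :=
  [set y | L (line (y *m B) d)].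

End sobolev.

(* Main.v *)
(* If the J_p-property fails, some quasicontinuous u has weak derivatives g_i in
   L^p off K but is not in W^{1,p}(R^N).  When K has positive measure, Fubini's
   theorem already gives the lines.  Otherwise extend the g_i by 0: for some i
   and some test function phi the integral of u d_i(phi) + g_i phi does not
   vanish, so by Fubini its integral over the line through y parallel to the
   i-th axis is nonzero for y in a Borel set of positive measure.  On almost
   every such line u is continuous (a set of small capacity has a small
   projection along the axis) and has weak derivative g_i off K.  There
   w = u - int g_i is continuous, and constant on the intervals not meeting K;
   if the line meets K in a countable set, w takes countably many values, so it
   is constant, u has weak derivative g_i on the whole line, and the integral
   of u d_i(phi) + g_i phi over the line is 0, a contradiction. *)

From HB Require Import structures.
Require Import Defs.
From mathcomp Require Import all_boot all_order all_algebra.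
From mathcomp Require Import all_classical all_reals all_analysis.
From mathcomp Require Import measurable_realfun ring lra.

Set Implicit Arguments.
Unset Strict Implicit.
Unset Printing Implicit Defensive.

Import Order.TTheory GRing.Theory Num.Theory.
Import numFieldNormedType.Exports.

Local Open Scope classical_set_scope.
Local Open Scope ring_scope.

(** The obstacle is that one null set of lines must serve for all tests at once, while each line
    carries uncountably many intervals and test functions. The line argument therefore uses only
    rational intervals and, on each, the sequence [bump k.+1%:R^-1]. As k grows, the derivatives of
    these bumps act as the point mass at the left end minus the one at the right end, so this
    countable supply already controls the increments of w between rational points; continuity does
    the rest.

    A second tension concerns representatives. Fubini's theorem needs Borel functions, so u and g_i
    are replaced by Borel versions off a null set; continuity on lines, however, belongs to u itself
    and is lost by such a change. Both u and its Borel version are carried along, and they are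
    exchanged only under integrals over lines that meet the exceptional set in a null set. The case
    distinction on the measure of K has the same origin: a null K can be absorbed into the
    exceptional set, and extending g_i by 0 then changes no norm. *)

Lemma esum_image_le (R : realType) (T T' : choiceType) (D : set T) (f : T -> T')
    (a : T' -> \bar R) : (forall x, 0 <= a x)%E ->
  (\esum_(j in f @` D) a j <= \esum_(i in D) a (f i))%E.
Proof.
move=> a0.
have [->|/set0P[x0 Dx0]] := eqVneq D set0; first by rewrite image_set0 !esum_set0.
(* A section [g] of [f] over the image turns the left sum into a subsum of the right one; [x0] is a
   dummy value off the image. *)
have /choice[g Pg] j : exists i, (f @` D) j -> D i /\ f i = j.
  have [[i Di fi]|nj] := pselect ((f @` D) j); first by exists i.
  by exists x0.
have -> : \esum_(j in f @` D) a j = \esum_(i in g @` (f @` D)) a (f i).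
  rewrite [RHS]esum_image; last first.
    move=> i j /set_mem iD /set_mem jD e.
    by have [[_ <-] [_ <-]] := (Pg _ iD, Pg _ jD); rewrite e.
  by apply: eq_esum => j jD; have [_ ->] := Pg _ jD.
rewrite esum_mkcond [leRHS]esum_mkcond; apply: le_esum => i _.
case: ifPn => [/set_mem[j jD <-]|_]; first by rewrite mem_set//; case: (Pg _ jD).
by case: ifP.
Qed.

(** * Boxes, Borel sets and Lebesgue measure on R^n *)

Section borel.
Variables (R : realType) (n : nat).
Local Notation space := (lebesgue_space R n).
Local Notation outer := (@lebesgue_outer R n).

(** Outer measure is defined by sets of boxes, whereas cutting the boxes of a cover yields a family
    in which distinct indices may give the same box. Repetitions only increase the sum. *)
Lemma lebesgue_outer_cover (T : choiceType) (D : set T)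
    (f : T -> 'rV[R]_n * 'rV[R]_n) (A : set 'rV[R]_n) :
  countable D -> A `<=` \bigcup_(i in D) box (f i) ->
  (outer A <= \esum_(i in D) (box_volume (f i))%:E)%E.
Proof.
move=> cD AD.
apply: (@le_trans _ _ (\esum_(j in f @` D) (box_volume j)%:E)%E).
  apply: ereal_inf_lbound; exists (f @` D) => //; split.
    exact: card_le_trans (card_image_le _ _) cD.
  by move=> x /AD[i Di xi]; exists (f i) => //; exists i.
apply: (@esum_image_le R _ _ D f (fun j => (box_volume j)%:E)) => x.
by rewrite lee_fin box_volume_ge0.
Qed.

Definition set_coord (a : 'rV[R]_n) (j : 'I_n) (c : R) : 'rV[R]_n :=
  \row_k (if k == j then c else a 0 k).

Lemma box_volumeD1 j (ab : 'rV[R]_n * 'rV[R]_n) :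
  box_volume ab = Num.max 0 (ab.2 0 j - ab.1 0 j) *
    \prod_(i < n | i != j) Num.max 0 (ab.2 0 i - ab.1 0 i).
Proof. by rewrite /box_volume (bigD1 j). Qed.

(** Clipping with [min] and [max] keeps the identity true when the hyperplane misses the box: one
    half is then degenerate and has volume 0. *)
Lemma box_volume_split (a b : 'rV[R]_n) j c :
  box_volume (a, set_coord b j (Num.min (b 0 j) c)) +
  box_volume (set_coord a j (Num.max (a 0 j) c), b) = box_volume (a, b).
Proof.
rewrite !(box_volumeD1 j)/= !mxE eqxx.
rewrite [X in _ * X + _](_ : _ = \prod_(i < n | i != j) Num.max 0 (b 0 i - a 0 i));
  last first.
  by apply: eq_bigr => i /negPf ij; rewrite !mxE ij.
rewrite [X in _ + _ * X](_ : _ = \prod_(i < n | i != j) Num.max 0 (b 0 i - a 0 i));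
  last first.
  by apply: eq_bigr => i /negPf ij; rewrite !mxE ij.
rewrite -mulrDl; congr (_ * _).
rewrite /Num.max /Num.min; repeat case: ifPn; rewrite -?leNgt => *; lra.
Qed.

Lemma box_half (a b : 'rV[R]_n) j c :
  box (a, b) `&` [set x | x 0 j <= c] `<=` box (a, set_coord b j (Num.min (b 0 j) c)).
Proof.
move=> x [abx xc] i; rewrite /= mxE; have /= /andP[-> xb]/= := abx i.
by case: eqP => [ij|//]; subst i; rewrite le_min xb.
Qed.

Lemma box_halfC (a b : 'rV[R]_n) j c :
  box (a, b) `&` ~` [set x | x 0 j <= c] `<=` box (set_coord a j (Num.max (a 0 j) c), b).
Proof.
move=> x [abx /= /negP]; rewrite -ltNge => xc i; rewrite /= mxE.
have /= /andP[xa ->] := abx i; rewrite andbT.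
by case: eqP => [ij|//]; subst i; rewrite gt_max xa.
Qed.

(** Caratheodory's criterion: the hyperplane cuts every box of a cover into two boxes whose volumes
    add up, so each cover splits into covers of the two parts at no cost. *)
Lemma measurable_halfspace j c : measurable ([set x | x 0 j <= c] : set space).
Proof.
apply: le_caratheodory_measurable => X; apply: le_ereal_inf_tmp => _ [D [cD XD] <-].
set A := [set x | _].
rewrite (_ : \esum_(ab in D) (box_volume ab)%:E =
   \esum_(ab in D) (box_volume (ab.1, set_coord ab.2 j (Num.min (ab.2 0 j) c)))%:E +
   \esum_(ab in D) (box_volume (set_coord ab.1 j (Num.max (ab.1 0 j) c), ab.2))%:E)%E;
     last first.
  rewrite -esumD; try by move=> *; rewrite lee_fin box_volume_ge0.
  by apply: eq_esum => -[a b] _; rewrite -EFinD box_volume_split.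
apply: leeD.
  apply: lebesgue_outer_cover => // x [/XD[[a b] Dab abx] Ax].
  by exists (a, b) => //; apply: box_half.
apply: lebesgue_outer_cover => // x [/XD[[a b] Dab abx] Ax].
by exists (a, b) => //; apply: box_halfC.
Qed.

Lemma measurable_coord j : measurable_fun [set: space] (fun x : space => x 0 j).
Proof.
apply: (measurability _ (RGenOInfty.measurableE R)).
move=> _ [_ [c ->] <-]; rewrite setTI.
rewrite (_ : _ @^-1` _ = ~` [set x : space | x 0 j <= c]).
  exact/measurableC/measurable_halfspace.
apply/seteqP; split => x /=; rewrite in_itv/= andbT ltNge => /negP//.
Qed.

Lemma measurable_box ab : measurable (box ab : set space).
Proof.
rewrite (_ : box ab = \bigcap_(j in [set: 'I_n])
   ((fun x : space => x 0 j) @^-1` `]ab.1 0 j, ab.2 0 j])); last first.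
  apply/seteqP; split => x /=.
    by move=> abx j _ /=; rewrite in_itv/=; exact: abx.
  by move=> abx j; have := abx j Logic.I; rewrite /= in_itv.
apply: fin_bigcap_measurable => // j _.
by rewrite -[X in measurable X]setTI; apply: measurable_coord.
Qed.

End borel.

(* The Caratheodory sigma-algebra is not a product: Fubini's theorem is applied
   on the sigma-algebra generated by boxes, to the restriction bleb of leb. *)
Definition bor (R : realType) (n : nat) := g_sigma_algebraType (range (@box R n)).
HB.instance Definition _ (R : realType) (n : nat) := Measurable.on (bor R n).

Section borel2.
Variables (R : realType) (n : nat).
Local Notation space := (lebesgue_space R n).

(** The identity, seen as a map from the Caratheodory to the Borel structure, so that [bleb] is the
    pushforward of [leb]. *)
Definition rV_id : space -> bor R n := id.

Lemma measurable_rV_id : measurable_fun [set: space] rV_id.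
Proof.
apply: (@measurability _ _ _ (bor R n) _ _ (range (@box R n))) => //.
move=> _ [_ [ab _ <-] <-]; rewrite setTI; exact: measurable_box.
Qed.

Definition bleb : set (bor R n) -> \bar R := leb R n.

Let bleb0 : bleb set0 = 0%E. Proof. exact: measure0. Qed.
Let bleb_ge0 A : (0 <= bleb A)%E. Proof. exact: lebesgue_outer_ge0. Qed.
Let bleb_sigma_additive : semi_sigma_additive bleb.
Proof. 
have := @measure_semi_sigma_additive _ _ _
  (measure_function_pushforward__canonical__measure_function_Measure (leb R n)
    measurable_rV_id).
exact.
 Qed.

HB.instance Definition _ := isMeasure.Build _ (bor R n) R bleb bleb0 bleb_ge0
  bleb_sigma_additive.

Definition bbox (k : nat) : set 'rV[R]_n := box (const_mx (- k%:R), const_mx k%:R).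

Lemma bigcup_bbox : \bigcup_k bbox k = setT.
Proof.
apply/seteqP; split => // x _.
pose M := \sum_j `|x 0 j|.
have xM j : `|x 0 j| <= M by rewrite /M (bigD1 j)//= lerDl sumr_ge0.
exists (Num.truncn M).+1 => // j; rewrite /= !mxE.
have MM : M < (Num.truncn M).+1%:R by exact: truncnS_gt.
have := xM j; rewrite ler_norml => /andP[h1 h2]; apply/andP; split; lra.
Qed.

(** Only the easy half of the volume formula; equality is [bleb_box], which needs product
    measures. *)
Lemma leb_box_le ab : (leb R n (box ab) <= (box_volume ab)%:E)%E.
Proof.
rewrite -(@esum_set1 _ _ ab (fun ab => (box_volume ab)%:E)) ?lee_fin ?box_volume_ge0//.
by apply: lebesgue_outer_cover => // x abx; exists ab.
Qed.

Lemma bleb_sigma_finite : sigma_finite setT bleb.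
Proof.
exists bbox; first by rewrite bigcup_bbox.
move=> k; split; first by apply: sub_sigma_algebra;
  exists (const_mx (- k%:R), const_mx k%:R).
by apply: (le_lt_trans (leb_box_le _)); rewrite ltry.
Qed.

HB.instance Definition _ := @Measure_isSigmaFinite.Build _ (bor R n) R bleb
  bleb_sigma_finite.

Lemma box_setI a b a' b' : box (a, b) `&` box (a', b') =
  box (\row_j Num.max (a 0 j) (a' 0 j), \row_j Num.min (b 0 j) (b' 0 j)) :> set 'rV[R]_n.
Proof.
apply/seteqP; split => [x [/= h h'] j|x /= h]; rewrite ?mxE.
  by rewrite gt_max le_min; have /= /andP[-> ->] := h j; have /= /andP[-> ->] := h' j.
by split => j; have := h j;
  rewrite !mxE gt_max le_min /= => /andP[/andP[h1 h2] /andP[h3 h4]]; apply/andP.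
Qed.

Lemma setI_closed_box : setI_closed (range (@box R n)).
Proof. by move=> _ _ [[a b] _ <-] [[a' b'] _ <-]; rewrite box_setI; eexists. Qed.

End borel2.

Arguments bleb R n : clear implicits.

(** * Fubini's theorem along a coordinate axis *)

Section slice.
Variables (R : realType) (n : nat).
Implicit Types (i : 'I_n.+1) (y : 'rV[R]_n) (t : R).

Definition slice i y t : 'rV[R]_n.+1 :=
  \row_k (if unlift i k is Some j then y 0 j else t).

Definition coord_frame i : 'M[R]_(n, n.+1) := \matrix_(j, k) (k == lift i j)%:R.

Lemma slice_eq i y t : slice i y t 0 i = t.
Proof. by rewrite mxE unlift_none. Qed.

Lemma slice_lift i y t j : slice i y t 0 (lift i j) = y 0 j.
Proof. by rewrite mxE liftK. Qed.

Lemma eq_rV_lift i (x x' : 'rV[R]_n.+1) : x 0 i = x' 0 i ->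
  (forall j, x 0 (lift i j) = x' 0 (lift i j)) -> x = x'.
Proof.
move=> xi xj; apply/rowP => k; case: (unliftP i k) => [j ->|->//]; exact: xj.
Qed.

Lemma sliceE i y t : slice i y t = y *m coord_frame i + t *: delta_mx 0 i.
Proof.
apply: (@eq_rV_lift i) => [|j]; rewrite ?slice_eq ?slice_lift !mxE.
  rewrite big1 => [|k _]; first by rewrite !eqxx mulr1 add0r.
  by rewrite mxE (negPf (neq_lift _ _)) mulr0.
rewrite (bigD1 j)//= big1 => [|k kj]; last first.
  by rewrite mxE (inj_eq lift_inj) eq_sym (negPf kj) mulr0.
by rewrite mxE !eqxx /= eq_sym (negPf (neq_lift _ _)) mulr0 mulr1 !addr0.
Qed.

Lemma slice_surj i x : x = slice i (col' i x) (x 0 i).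
Proof.
by apply: (@eq_rV_lift i) => [|j]; rewrite ?slice_eq ?slice_lift// mxE.
Qed.

Lemma coord_frame_perp i : perpendicular_frame (delta_mx 0 i) (coord_frame i).
Proof.
have eB k l : coord_frame i k l = (l == lift i k)%:R by rewrite mxE.
split.
- by rewrite trmx_delta mul_delta_mx; apply/rowP => k; rewrite !ord1 !mxE eqxx.
- apply/matrixP => j k; rewrite !mxE (bigD1 (lift i j))//= !mxE eqxx mul1r big1 ?addr0.
    by rewrite (inj_eq lift_inj).
  by move=> l lj; rewrite !mxE (negPf lj) mul0r.
- apply/matrixP => j k; rewrite !mxE big1// => l _; rewrite !mxE (ord1 k) eqxx /=.
  by case: eqP => [->|_]; rewrite ?mul0r// eq_sym (negPf (neq_lift _ _)) ?mulr0.
Qed.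

Lemma line_coord i y : line (y *m coord_frame i) (delta_mx 0 i) =
  [set slice i y t | t in setT].
Proof. by rewrite /line; apply: eq_imagel => t _; rewrite sliceE. Qed.

Lemma line_coord_inj i : injective (fun y => line (y *m coord_frame i) (delta_mx 0 i)).
Proof.
move=> y y'; rewrite !line_coord => yy'.
have : [set slice i y t | t in setT] (slice i y 0) by exists 0.
rewrite yy' => -[t _ tE]; apply/rowP => j.
by rewrite -(slice_lift i y 0) -tE slice_lift.
Qed.

Lemma slice_box i a b y t : box (a, b) (slice i y t) <->
  (a 0 i < t <= b 0 i) /\ box (col' i a, col' i b) y.
Proof.
split => [h|[h1 h2] k /=].
  split; first by have := h i; rewrite /= slice_eq.
  by move=> j; have := h (lift i j); rewrite /= slice_lift !mxE.
by case: (unliftP i k) => [j ->|->]; rewrite ?slice_eq ?slice_lift//; have := h2 j;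
  rewrite !mxE.
Qed.

Lemma box_volume_lift i (a b : 'rV[R]_n.+1) : box_volume (a, b) =
  Num.max 0 (b 0 i - a 0 i) * box_volume (col' i a, col' i b).
Proof.
rewrite /box_volume/= (bigD1_ord i)//=; congr (_ * _).
by apply: eq_bigr => j _; rewrite !mxE.
Qed.

(** Uncurried, so that product measures can be pushed forward; [slice_measure] shows that it
    preserves measure. *)
Definition slicef i (z : bor R n * measurableTypeR R) : bor R n.+1 := slice i z.1 z.2.

Lemma preimage_slicef_box i a b : slicef i @^-1` box (a, b) =
  (box (col' i a, col' i b) : set (bor R n)) `*` (`]a 0 i, b 0 i] : set (measurableTypeR
    R)).
Proof.
apply/seteqP; split => -[y t] /=.
  by move=> /slice_box[h1 h2]; split => //=; rewrite in_itv.
by rewrite in_itv => -[h1 h2]; apply/slice_box.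
Qed.

Lemma measurable_bor_box m ab : measurable (box ab : set (bor R m)).
Proof. by apply: sub_sigma_algebra; exists ab. Qed.

Lemma measurable_slicef i : measurable_fun setT (slicef i).
Proof.
apply: (@measurability _ _ _ (bor R n.+1) _ _ (range (@box R n.+1))) => //.
move=> _ [_ [[a b] _ <-] <-]; rewrite setTI preimage_slicef_box.
apply: measurableX; [exact: measurable_bor_box|exact: measurable_itv].
Qed.

End slice.

(** Covers are countable sets of boxes, not sequences, so sigma-subadditivity is transported along
    an injection into the naturals; indices outside its range receive the empty set. *)
Lemma measure_countable_subadditive d (T : measurableType d) (R : realType)
    (mu : {measure set T -> \bar R}) (I : choiceType) (D : set I)
    (F : I -> set T) (A : set T) :
  countable D -> (forall i, D i -> measurable (F i)) -> measurable A ->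
  A `<=` \bigcup_(i in D) F i -> (mu A <= \esum_(i in D) mu (F i))%E.
Proof.
move=> /pcard_injP[f injf] mF mA AF.
pose G k := \bigcup_(i in D `&` [set i | f i = k]) F i.
have GE i : D i -> G (f i) = F i.
  move=> Di; apply/seteqP; split => [x [j [Dj /= fji] Fx]|x Fx]; last by exists i.
  by rewrite -(_ : j = i)//; apply: injf; rewrite ?inE.
have G0 k : ~ (f @` D) k -> G k = set0.
  by move=> nk; rewrite -subset0 => x [j [Dj /= fji] Fx]; apply: nk; exists j.
have mG k : measurable (G k).
  have [[i Di <-]|/G0 ->//] := pselect ((f @` D) k); rewrite GE//; exact: mF.
apply: (@le_trans _ _ (\sum_(k <oo) mu (G k))%E).
  apply: measure_sigma_subadditive => // x /AF[i Di Fx].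
  by exists (f i) => //; rewrite GE.
rewrite nneseries_esumT//.
rewrite (_ : \esum_(k in setT) mu (G k) = \esum_(k in f @` D) mu (G k)); last first.
  rewrite [RHS]esum_mkcond; apply: eq_esum => k _; case: ifPn => // kD.
  by rewrite G0 ?measure0// => /mem_set; rewrite (negPf kD).
rewrite esum_image; last exact: injf.
by apply: le_esum => i Di; rewrite GE.
Qed.

Section measure.
Variables (R : realType).
Local Notation lam := (@lebesgue_measure R).

Definition slice_pushforward n i : {measure set (bor R n.+1) -> \bar R} :=
  measure_function_pushforward__canonical__measure_function_Measure (bleb R n \x lam)%E
    (@measurable_slicef R n i).

Lemma slice_measure_box n i ab : (forall ab, bleb R n (box ab) = (box_volume ab)%:E) ->
  (bleb R n \x lam)%E (slicef i @^-1` (box ab : set (bor R n.+1))) = (box_volume ab)%:E.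
Proof.
move: ab => [a b] IH; rewrite preimage_slicef_box product_measure1E//=;
  last exact: measurable_bor_box.
rewrite IH lebesgue_measure_itv/= (box_volume_lift i) lte_fin.
rewrite [RHS]EFinM muleC; congr (_ * _)%E; case: ifPn => [ab|]; last rewrite -leNgt => ba.
  by rewrite -EFinB max_r// subr_ge0 ltW.
by rewrite max_l// subr_le0.
Qed.

(** A measure that agrees with the volume on boxes is bounded by the total volume of any cover,
    hence by the outer measure. *)
Lemma slice_measure_le n i (A : set (bor R n.+1)) :
  (forall ab, bleb R n (box ab) = (box_volume ab)%:E) -> measurable A ->
  ((bleb R n \x lam)%E (slicef i @^-1` A) <= bleb R n.+1 A)%E.
Proof.
move=> IH mA; apply: le_ereal_inf_tmp => _ [D [cD AD] <-].
pose nu := pushforward (bleb R n \x lam)%E (@slicef R n i).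
have -> : \esum_(ab in D) (box_volume ab)%:E = \esum_(ab in D) nu (box ab).
  by apply: eq_esum => ab _; rewrite /nu /pushforward slice_measure_box.
apply: (@measure_countable_subadditive _ _ _ (slice_pushforward i)) => // ab _.
exact: measurable_bor_box.
Qed.

(** Induction on the dimension replaces the usual compactness argument: the product of [bleb R n]
    with Lebesgue measure on the line gives a box its volume and, by [slice_measure_le], lies below
    [bleb R n.+1]. *)
Lemma bleb_box n ab : bleb R n (box ab) = (box_volume ab)%:E.
Proof.
elim: n ab => [|n IH] ab; last first.
  apply/eqP; rewrite eq_le leb_box_le/=.
  rewrite -(slice_measure_box 0 ab IH); apply: slice_measure_le => //;
    exact: measurable_bor_box.
apply/eqP; rewrite eq_le leb_box_le/=.
rewrite /box_volume big_ord0; apply: le_ereal_inf_tmp => _ [D [cD AD] <-].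
(* In dimension 0 every box has volume 1, an empty product, and a cover of the only point contains
   at least one box. *)
have [|ab' Dab' _] := AD 0; first by move=> -[].
apply: (@le_trans _ _ (\esum_(ab in [set ab']) (box_volume ab)%:E)%E).
  by rewrite esum_set1 ?lee_fin ?box_volume_ge0// /box_volume big_ord0.
rewrite esum_mkcond [leRHS]esum_mkcond; apply: le_esum => i _.
case: ifPn => [/set_mem ->|_]; first by rewrite mem_set.
by case: ifP => // _; rewrite lee_fin box_volume_ge0.
Qed.

(** The two measures agree on the pi-system of boxes, and the cubes [bbox k] exhaust the space with
    finite measure, so uniqueness of measures applies. *)
Lemma slice_measure n i (A : set (bor R n.+1)) : measurable A ->
  (bleb R n \x lam)%E (slicef i @^-1` A) = bleb R n.+1 A.
Proof.
move=> mA.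
pose nu : {measure set (bor R n.+1) -> \bar R} :=
  slice_pushforward i.
change (nu A = bleb R n.+1 A).
apply: (@measure_unique _ _ (bor R n.+1) (range (@box R n.+1)) (@bbox R n.+1) _ _ _ _ nu
  (bleb R n.+1)) => //.
- exact: setI_closed_box.
- exact: bigcup_bbox.
- move=> _ [ab _ <-]; rewrite [RHS]bleb_box; apply: slice_measure_box => //;
  exact: bleb_box.
- move=> k; rewrite [ltLHS](_ : _ = (box_volume (const_mx (- k%:R) : 'rV[R]_n.+1, const_mx
  k%:R))%:E) ?ltry//.
  by apply: slice_measure_box => ab; exact: bleb_box.
Qed.

Lemma ge0_slice_integral n i (f : bor R n.+1 -> \bar R) : measurable_fun [set: bor R n.+1]
  f ->
  (forall x, 0 <= f x)%E ->
  (\int[bleb R n.+1]_x f x = \int[bleb R n]_y \int[lam]_t f (slice i y t))%E.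
Proof.
move=> mf f0.
have mfs : measurable_fun setT (f \o slicef i).
  by apply: measurableT_comp => //; exact: measurable_slicef.
rewrite -(@fubini_tonelli1 _ _ _ _ _ (bleb R n) lam (f \o slicef i))//; last by move=> x /=.
rewrite -[in RHS](preimage_setT (slicef i)) -(ge0_integral_pushforward (measurable_slicef
  i))//.
apply: (eq_measure_integral (slice_pushforward i)) => A mA _; exact/esym/slice_measure.
Qed.

Lemma slice_integrable n i (f : bor R n.+1 -> \bar R) :
  (bleb R n.+1).-integrable setT f -> (bleb R n \x lam)%E.-integrable setT (f \o slicef i).
Proof.
move=> /integrableP[mf fi]; apply/integrableP; split.
  by apply: measurableT_comp => //; exact: measurable_slicef.
move: fi; rewrite (@ge0_slice_integral _ i) //; last exact: measurableT_comp.
rewrite -(@fubini_tonelli1 _ _ _ _ _ (bleb R n) lam (fun z => `|f (slicef i z)|)%E)//.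
apply: measurableT_comp => //; apply: measurableT_comp => //; exact: measurable_slicef.
Qed.

Lemma slice_integral n i (f : bor R n.+1 -> \bar R) : (bleb R n.+1).-integrable setT f ->
  (\int[bleb R n.+1]_x f x = \int[bleb R n]_y \int[lam]_t f (slice i y t))%E.
Proof.
move=> fi; rewrite (fubini1 (slice_integrable i fi)).
rewrite -[in RHS](preimage_setT (slicef i)) -(integral_pushforward (measurable_slicef i))//.
- apply: (eq_measure_integral (slice_pushforward i)) => A mA _; exact/esym/slice_measure.
- by case/integrableP : fi.
- exact: slice_integrable.
Qed.

End measure.

(** * Countable unions and almost everywhere statements *)

Lemma countable_bigcupE (T : Type) (I : choiceType) (D : set I) (F : I -> set T) :
  countable D -> exists G : nat -> set T, \bigcup_(i in D) F i = \bigcup_k G k /\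
    forall k, G k = set0 \/ exists2 i, D i & G k = F i.
Proof.
move=> /pcard_injP[f injf].
exists (fun k => \bigcup_(i in D `&` [set i | f i = k]) F i); split.
  apply/seteqP; split => [x [i Di Fx]|x [k _ [i [Di _] Fx]]]; last by exists i.
  by exists (f i) => //; exists i.
move=> k; have [[i Di <-]|nk] := pselect ((f @` D) k); [right; exists i => //|left].
  apply/seteqP; split => [x [j [Dj /= fji] Fx]|x Fx]; last by exists i.
  by rewrite -(_ : j = i)//; apply: injf; rewrite ?inE.
by rewrite -subset0 => x [j [Dj /= fji] Fx]; apply: nk; exists j.
Qed.

Lemma countable_bigcup_measurable d (T : measurableType d) (I : choiceType)
    (D : set I) (F : I -> set T) : countable D ->
  (forall i, D i -> measurable (F i)) -> measurable (\bigcup_(i in D) F i).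
Proof.
move=> /(@countable_bigcupE _ _ _ F)[G [-> PG]] mF; apply: bigcupT_measurable => k.
by have [->//|[i Di ->]] := PG k; exact: mF.
Qed.

Lemma countable_negligible_bigcup d (T : measurableType d) (R : realType)
    (mu : {measure set T -> \bar R}) (I : choiceType) (D : set I) (F : I -> set T) :
  countable D -> (forall i, D i -> mu.-negligible (F i)) ->
  mu.-negligible (\bigcup_(i in D) F i).
Proof.
move=> /(@countable_bigcupE _ _ _ F)[G [-> PG]] mF; apply: negligible_bigcup => k.
have [->|[i Di ->]] := PG k; last exact: mF.
exact: negligible_set0.
Qed.

Lemma ae_forall_countable d (T : measurableType d) (R : realType)
    (mu : {measure set T -> \bar R}) (I : choiceType) (D : set I) (P : I -> T -> Prop) :
  countable D -> (forall i, D i -> \forall x \ae mu, P i x) ->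
  \forall x \ae mu, forall i, D i -> P i x.
Proof.
move=> cD DP; change (mu.-negligible (~` [set x | forall i, D i -> P i x])).
rewrite (_ : ~` _ = \bigcup_(i in D) ~` [set x | P i x]); last first.
  apply/seteqP; split => x /=.
    by move=> /existsNP[i /not_implyP[Di nP]]; exists i.
  by move=> [i Di nP] h; apply: nP; exact: h.
exact: countable_negligible_bigcup.
Qed.

(** * Borel versions of Lebesgue measurable sets and functions *)

Section hull.
Variables (R : realType) (n : nat).
Local Notation space := (lebesgue_space R n).
Local Notation outer := (@lebesgue_outer R n).

Lemma measurable_bor_leb (A : set (bor R n)) : measurable A -> measurable (A : set space).
Proof.
by move=> mA; rewrite -[A]setTI; exact: (@measurable_rV_id R n).
Qed.

(** The hull is the intersection of box covers whose total volumes exceed the outer measure by at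
    most 1/(k+1). *)
Lemma borel_hull (A : set 'rV[R]_n) : (outer A < +oo)%E -> exists H : set (bor R n),
  [/\ measurable H, A `<=` H & (bleb R n H <= outer A)%E].
Proof.
move=> Aoo; have Afin : outer A \is a fin_num by rewrite ge0_fin_numE// lebesgue_outer_ge0.
have /choice[D PD] (k : nat) : exists D : set ('rV[R]_n * 'rV[R]_n),
    [/\ countable D, A `<=` \bigcup_(ab in D) box ab &
    (\esum_(ab in D) (box_volume ab)%:E <= outer A + (k.+1%:R^-1)%:E)%E].
  have k0 : 0 < k.+1%:R^-1 :> R by rewrite invr_gt0.
  have [_ [D [cD AD] <-] /ltW De] := lb_ereal_inf_adherent k0 Afin.
  by exists D.
exists (\bigcap_k \bigcup_(ab in D k) box ab); split.
- apply: bigcapT_measurable => k; apply: countable_bigcup_measurable.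
    by case: (PD k).
  by move=> ab _; exact: measurable_bor_box.
- by move=> x Ax k _; have [_ + _] := PD k; exact.
- apply/lee_addgt0Pr => e e0.
  have [k ke] : exists k : nat, k.+1%:R^-1 < e.
    exists (Num.truncn e^-1); rewrite invf_plt ?posrE//; exact: truncnS_gt.
  apply: (@le_trans _ _ (\esum_(ab in D k) (box_volume ab)%:E)%E).
    have [cD _ _] := PD k; apply: lebesgue_outer_cover => // x Hx; exact: Hx.
  have [_ _ Dk] := PD k; apply: (le_trans Dk).
  by rewrite leeD2l// lee_fin ltW.
Qed.

Lemma null_hull (A : set 'rV[R]_n) : outer A = 0%E -> exists Z : set (bor R n),
  [/\ measurable Z, A `<=` Z & bleb R n Z = 0%E].
Proof.
move=> A0; have [|Z [mZ AZ Zle]] := @borel_hull A; first by rewrite A0.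
by exists Z; split => //; apply/eqP; rewrite -measure_le0 -A0.
Qed.

(** Inside each bounded box the set is replaced by its Borel hull; the null sets needed on all these
    pieces are then collected in one [Z]. *)
Lemma borel_approx (A : set space) : measurable A -> exists B Z : set (bor R n),
  [/\ measurable B, measurable Z, bleb R n Z = 0%E & A `\` Z = B `\` Z].
Proof.
move=> mA.
have /choice[HN PHN] (k : nat) : exists HN : set (bor R n) * set (bor R n),
    [/\ measurable HN.1, measurable HN.2, bleb R n HN.2 = 0%E &
    (A `&` bbox k) `\` HN.2 = HN.1 `\` HN.2 ].
  have mAk : measurable (A `&` bbox k : set space).
    by apply: measurableI => //; exact: measurable_box.
  have Akoo : (leb R n (A `&` bbox k) < +oo)%E.
    apply: (@le_lt_trans _ _ (leb R n (bbox k))); first exact: le_lebesgue_outer.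
    by apply: (le_lt_trans (leb_box_le _)); rewrite ltry.
  have [H [mH AH Hle]] := borel_hull Akoo.
  (* The excess of the hull is null by additivity, the set being measurable of finite measure; it is
     not known to be Borel, so a Borel null set is put around it. *)
  have [|Z [mZ HZ Z0]] := @null_hull (H `\` (A `&` bbox k)).
    have Hoo : (leb R n H < +oo)%E by exact: le_lt_trans Akoo.
    have HD := @measureD _ space _ (leb R n) H (A `&` bbox k) (measurable_bor_leb mH) mAk
      Hoo.
    apply/eqP; rewrite eq_le lebesgue_outer_ge0 andbT; 
    rewrite [leLHS]HD setIidr// leeBlDr ?add0e//.
    rewrite ge0_fin_numE//; exact: lebesgue_outer_ge0.
  exists (H, Z); split => //=; apply/seteqP; split => x [Ax Zx]; split => //.
    exact: AH.
  by apply: contrapT => nA; apply: Zx; apply: HZ.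
exists (\bigcup_k (HN k).1), (\bigcup_k (HN k).2); split.
- by apply: bigcupT_measurable => k; case: (PHN k).
- by apply: bigcupT_measurable => k; case: (PHN k).
- apply/negligibleP; first by apply: bigcupT_measurable => k; case: (PHN k).
  by apply: negligible_bigcup => k; apply/negligibleP; case: (PHN k).
- apply/seteqP; split => x [Ax Zx]; split => //.
    have [k _ xk] : (\bigcup_k (@bbox R n) k) x by rewrite bigcup_bbox.
    exists k => //; have [_ _ _ h] := PHN k.
    have : ((A `&` bbox k) `\` (HN k).2) x by split => // ?; apply: Zx; exists k.
    by rewrite h => -[].
  move: Ax => [k _ xk]; have [_ _ _ h] := PHN k.
  have : ((HN k).1 `\` (HN k).2) x by split => // ?; apply: Zx; exists k.
  by rewrite -h => -[[]].
Qed.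

(** Countably many superlevel sets, at rational heights, determine the function; each becomes Borel
    off a null set, and [Z] is the union of these null sets. *)
Lemma borel_fun_approx (f : space -> R) : measurable_fun [set: space] f ->
  exists Z : set (bor R n), [/\ measurable Z, bleb R n Z = 0%E &
    measurable_fun [set: bor R n] (f \_ (~` Z) : bor R n -> R)].
Proof.
move=> mf.
have /choice[BZ PBZ] (q : rat) : exists BZ : set (bor R n) * set (bor R n),
    [/\ measurable BZ.1, measurable BZ.2, bleb R n BZ.2 = 0%E &
    [set x | ratr q < f x] `\` BZ.2 = BZ.1 `\` BZ.2 ].
  have [|B [Z [mB mZ Z0 h]]] := @borel_approx [set x | ratr q < f x].
    rewrite (_ : [set x | _] = setT `&` f @^-1` `]ratr q, +oo[); first exact: mf.
    by rewrite setTI; apply/seteqP; split => x /=; rewrite in_itv/= andbT.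
  by exists (B, Z).
pose Z := \bigcup_q (BZ q).2.
have mZ : measurable Z by apply: bigcupT_measurable_rat => q; case: (PBZ q).
exists Z; split => //.
  apply/negligibleP => //.
  apply: countable_negligible_bigcup => [|q _]; first exact: countableP.
  case: (PBZ q) => ? ? ? _.
  exact/negligibleP.
apply: (measurability _ (RGenOInfty.measurableE R)) => _ [_ [c ->] <-]; rewrite setTI.
have mZc c' : measurable ([set x | c' < f x] `\` Z : set (bor R n)).
  rewrite (_ : _ `\` Z = \bigcup_(q in [set q : rat | c' < ratr q]) ((BZ q).1 `\` Z)).
    apply: countable_bigcup_measurable => [|q _]; first exact: countableP.
    apply: measurableD => //.
    by case: (PBZ q).
  apply/seteqP; split => x.
    move=> [/= cf Zx]; have [q /andP[cq qf]] := rat_in_itvoo cf; exists q => //.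
    split => //; have [_ _ _ h] := PBZ q.
    have : ([set x | ratr q < f x] `\` (BZ q).2) x by split => // ?; apply: Zx; exists q.
    by rewrite h => -[].
  move=> [q /= cq [Bx Zx]]; split => //=; apply: (lt_trans cq).
  have [_ _ _ h] := PBZ q.
  have : ((BZ q).1 `\` (BZ q).2) x by split => // ?; apply: Zx; exists q.
  by rewrite -h => -[].
(* The modified function takes the default value 0 on [Z], so [Z] belongs to the superlevel set
   exactly when c is negative. *)
have [c0|c0] := ltP c 0.
  rewrite (_ : _ @^-1` _ = ([set x | c < f x] `\` Z) `|` Z); first exact: measurableU.
  apply/seteqP; split => x /=; rewrite in_itv/= andbT patchE.
    by have [Zx|Zx] := pselect (Z x); [right|rewrite mem_set// => cf; left].
  by have [Zx|Zx] := pselect (Z x); [rewrite memNset//|rewrite mem_set//]; case=> // -[].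
rewrite (_ : _ @^-1` _ = [set x | c < f x] `\` Z); first exact: mZc.
apply/seteqP; split => x /=; rewrite in_itv/= andbT patchE.
  have [Zx|Zx] := pselect (Z x); [rewrite memNset//|rewrite mem_set//].
  by rewrite ltNge c0.
by move=> [cf Zx]; rewrite mem_set.
Qed.

Lemma ge0_leb_integral (f : bor R n -> \bar R) : measurable_fun [set: bor R n] f ->
  (forall x, 0 <= f x)%E -> (\int[leb R n]_x f x = \int[bleb R n]_x f x)%E.
Proof.
move=> mf f0.
transitivity (\int[measure_function_pushforward__canonical__measure_function_Measure (leb R
  n) (@measurable_rV_id R n)]_x f x)%E.
  by rewrite (ge0_integral_pushforward (@measurable_rV_id R n)) ?preimage_setT.
apply: (eq_measure_integral (bleb R n)) => A mA _; done.
Qed.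

Lemma leb_integral (f : bor R n -> \bar R) : measurable_fun [set: bor R n] f ->
  (leb R n).-integrable setT f ->
  (\int[leb R n]_x f x = \int[bleb R n]_x f x)%E.
Proof.
move=> mf fi.
transitivity (\int[measure_function_pushforward__canonical__measure_function_Measure (leb R
  n) (@measurable_rV_id R n)]_x f x)%E.
  by rewrite (integral_pushforward (@measurable_rV_id R n)) ?preimage_setT.
apply: (eq_measure_integral (bleb R n)) => A mA _; done.
Qed.

End hull.

(** * Rational boxes and the Borel sets of the topology *)

Section topology.
Variables (R : realType) (n : nat).

Definition cbox (ab : 'rV[R]_n * 'rV[R]_n) : set 'rV[R]_n :=
  [set x | forall i, ab.1 0 i <= x 0 i <= ab.2 0 i].

Lemma compact_cbox ab : compact (cbox ab).
Proof.
rewrite (_ : cbox ab = [set v : 'rV[R]_n | forall i, `[ab.1 0 i, ab.2 0 i]%classic (v ord0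
  i)]).
  by apply: (@rV_compact R n (fun i => `[ab.1 0 i, ab.2 0 i]%classic)) => i;
    exact: segment_compact.
by apply/seteqP; split => x h i; have := h i; rewrite /= in_itv.
Qed.

Lemma closed_cbox ab : closed (cbox ab).
Proof. by apply: compact_closed; [exact: norm_hausdorff|exact: compact_cbox]. Qed.

Definition rat_box (ab : 'rV[rat]_n * 'rV[rat]_n) : 'rV[R]_n * 'rV[R]_n :=
  (map_mx ratr ab.1, map_mx ratr ab.2).

(** Since the point is strictly inside, both the half-open and the closed rational box contain it.
    Rational boxes form a countable family, which makes open sets Borel, exhausts them by compact
    sets and keeps the number of exceptional null sets countable. *)
Lemma open_rat_box (A : set 'rV[R]_n) x : open A -> A x ->
  exists ab, [/\ cbox (rat_box ab) `<=` A & forall j, (rat_box ab).1 0 j < x 0 j < (rat_box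
    ab).2 0 j].
Proof.
move=> oA Ax; have /nbhs_ballP[e /= e0 eA] : nbhs x A by exact: open_nbhs_nbhs.
have /choice[q qP] (j : 'I_n) : exists q : rat * rat,
    x 0 j - e < ratr q.1 < x 0 j /\ x 0 j < ratr q.2 < x 0 j + e.
  have [q1 h1] : exists q, ratr q \in `]x 0 j - e, x 0 j[%R.
    by apply: rat_in_itvoo; rewrite ltrBlDr ltrDl.
  have [q2 h2] : exists q, ratr q \in `]x 0 j, x 0 j + e[%R.
    by apply: rat_in_itvoo; rewrite ltrDl.
  by exists (q1, q2); move: h1 h2; rewrite !in_itv.
exists (\row_j (q j).1, \row_j (q j).2); split => [y xy|j]; last first.
  by rewrite !mxE /=; have [/andP[_ ->] /andP[->]] := qP j.
apply: eA; split => // i j; rewrite (ord1 i) /ball/= ltr_distlC.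
have := xy j; rewrite !mxE /=; have [/andP[h1 h2] /andP[h3 h4]] := qP j.
move=> /andP[h5 h6]; apply/andP; split; lra.
Qed.

Lemma measurable_open_bor (A : set 'rV[R]_n) : open A -> measurable (A : set (bor R n)).
Proof.
move=> oA.
have -> : A = \bigcup_(ab in [set ab | cbox (rat_box ab) `<=` A]) box (rat_box ab).
  apply/seteqP; split => x.
    move=> /(open_rat_box oA)[ab [abA xab]]; exists ab => // j.
    by have /andP[-> /ltW ->] := xab j.
  move=> [ab abA xab]; apply: abA => j.
  by have /andP[/ltW -> ->] := xab j.
apply: countable_bigcup_measurable => [|ab _]; first exact: countableP.
exact: measurable_bor_box.
Qed.

Lemma measurable_closed_bor (A : set 'rV[R]_n) : closed A -> measurable (A : set (bor R n)).
Proof.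
move=> cA; have oA : open (~` A) by exact: closed_openC.
by rewrite -[A]setCK; apply: measurableC; exact: (measurable_open_bor oA).
Qed.

Lemma compact_closed_rV (A : set 'rV[R]_n) : compact A -> closed A.
Proof. by apply: compact_closed; exact: norm_hausdorff. Qed.

Lemma continuous_bor (f : 'rV[R]_n -> R) : continuous f ->
  measurable_fun [set: bor R n] (f : bor R n -> R).
Proof.
move=> cf; apply: (measurability _ (RGenOInfty.measurableE R)) => _ [_ [c ->] <-].
rewrite setTI; apply: measurable_open_bor.
by apply: open_comp => [x _|]; [exact: cf|exact: interval_open].
Qed.

Lemma measurable_bor_coord j : measurable_fun [set: bor R n] (fun x : bor R n => x 0 j).
Proof. by apply: continuous_bor; exact: coord_continuous. Qed.

End topology.

(** * Null sets and their sections along an axis *)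

Section sections.
Variables (R : realType) (n : nat) (i : 'I_n.+1).
Local Notation lam := (@lebesgue_measure R).

Lemma measurable_slice (y : bor R n) :
  measurable_fun [set: measurableTypeR R] (slice i y : measurableTypeR R -> bor R n.+1).
Proof.
apply: (@measurableT_comp _ _ _ _ _ _ (@slicef R n i) _ (fun t : measurableTypeR R => (y,
  t))).
  exact: measurable_slicef.
exact: measurable_pair1.
Qed.

(** Fubini's theorem for the indicator of [Z]. A modification of a function on a null set of the
    space is thereby harmless on almost every line. *)
Lemma ae_section (Z : set (bor R n.+1)) : measurable Z -> bleb R n.+1 Z = 0%E ->
  \forall y \ae (bleb R n), lam (slice i y @^-1` Z) = 0%E.
Proof.
move=> mZ Z0.
have mf : measurable_fun [set: bor R n.+1] (EFin \o \1_Z : bor R n.+1 -> \bar R) by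
  exact/measurable_EFinP/measurable_indic.
have := @ge0_slice_integral R n i (EFin \o \1_Z) mf (fun x => _).
have -> : (\int[bleb R n.+1]_x (EFin \o \1_Z) x = 0)%E by rewrite /= integral_indic// setIT.
move=> /(_ _)/esym h.
have {}h : (\int[bleb R n]_y \int[lam]_t ((EFin \o \1_Z) (slice i y t)) = 0)%E.
  by apply: h => x; rewrite lee_fin.
have mF : measurable_fun [set: bor R n] (fun y => \int[lam]_t ((EFin \o \1_Z) (slice i y
  t)))%E.
  apply: (@measurable_fun_fubini_tonelli_F _ _ _ _ _ lam ((EFin \o \1_Z) \o @slicef R n i))
    => //.
    by apply: measurableT_comp => //; exact: measurable_slicef.
  by move=> x; rewrite lee_fin.
have /ae_eq_integral_abs : (\int[bleb R n]_(y in setT) `|\int[lam]_t ((EFin \o \1_Z) (slice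
  i y t))| = 0)%E.
  rewrite -[RHS]h; apply: eq_integral => y _; rewrite gee0_abs//.
  by apply: integral_ge0 => t _; rewrite lee_fin.
move=> /(_ measurableT mF); apply: filterS => y /(_ Logic.I)/= <-.
have mZy : measurable (slice i y @^-1` Z).
  by rewrite -[X in measurable X]setTI; exact: measurable_slice.
rewrite -[in LHS](setIT (slice i y @^-1` Z)) -integral_indic//; exact: eq_integral.
Qed.

Lemma slice_continuous (y : 'rV[R]_n) : continuous (slice i y).
Proof.
move=> t; apply/cvgrPdist_le => /= e e0; near=> s.
rewrite [leLHS]/Num.norm/= mx_normrE; apply: bigmax_le => [|[k l] _]; first exact: ltW.
rewrite !mxE/=; case: unliftP => [j _|_]; first by rewrite subrr normr0 ltW.
by near: s; apply: cvgr_dist_le.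
Unshelve. all: by end_near. Qed.

(** Needed because products of bumps converge to indicators of open boxes, while the generating
    boxes are half-open. *)
Lemma hyperplane_null c : bleb R n.+1 [set x | x 0 i = c] = 0%E.
Proof.
have mA : measurable ([set x | x 0 i = c] : set (bor R n.+1)).
  have := @measurable_bor_coord R n.+1 i measurableT [set c] (measurable_set1 c).
  by rewrite setTI.
rewrite -(slice_measure i)//.
rewrite (_ : _ @^-1` _ = (setT : set (bor R n)) `*` ([set c] : set (measurableTypeR R)));
  last first.
  by apply/seteqP; split => -[y t] /=; rewrite /slicef slice_eq// => -[].
by rewrite product_measure1E//= lebesgue_measure_set1 mule0.
Qed.

End sections.

(** * Bump functions on the line *)

Section bump.
Variable R : realType.
Implicit Types (c a b x : R) (k : nat).

(** The factor [x^-1 ^+ k] makes the family stable under derivation, up to linear combinations. With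
    k = 0 the values at positive points tend to 1 as c tends to 0. *)
Definition flat c k x : R := if 0 < x then x^-1 ^+ k * expR (- (c * x^-1)) else 0.

Lemma flat_ge0 c k x : 0 <= flat c k x.
Proof.
rewrite /flat; case: ifP => // x0.
by rewrite mulr_ge0 ?expR_ge0// exprn_ge0// invr_ge0 ltW.
Qed.

(** One term of the exponential series, of degree k+2, compensates the pole of order k and leaves a
    factor [x ^+ 2]: enough for a vanishing derivative at 0. *)
Lemma flat_le c k x : 0 < c -> 0 <= x ->
  flat c k x <= (k.+2)`!%:R / c ^+ k.+2 * x ^+ 2.
Proof.
move=> c0; rewrite le_eqVlt => /predU1P[<-|x0].
  by rewrite /flat ltxx expr0n/= mulr0.
rewrite /flat x0 expRN.
have x0' : 0 < x^-1 by rewrite invr_gt0.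
have h : (c * x^-1) ^+ k.+2 / (k.+2)`!%:R <= expR (c * x^-1).
  apply: le_trans (expR_ge1Dxn k.+1 _); first by rewrite lerDr.
  by rewrite mulr_ge0 ?ltW.
have h0 : 0 < (c * x^-1) ^+ k.+2 / (k.+2)`!%:R.
  by rewrite divr_gt0 ?ltr0n ?fact_gt0// exprn_gt0// mulr_gt0.
apply: (@le_trans _ _ (x^-1 ^+ k * ((c * x^-1) ^+ k.+2 / (k.+2)`!%:R)^-1)).
  apply: ler_wpM2l; first by rewrite exprn_ge0// invr_ge0 ltW.
  by rewrite lef_pV2// ?posrE ?expR_gt0.
rewrite invf_div exprMn !exprVn.
have -> : x ^+ k.+2 = x ^+ k * x ^+ 2 by rewrite -exprD addn2.
have cn : c ^+ (k.+2) != 0 by rewrite expf_neq0// gt_eqF.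
have xk : x ^+ k != 0 by rewrite expf_neq0// gt_eqF.
have x2 : x != 0 by rewrite gt_eqF.
rewrite le_eqVlt; apply/orP; left; apply/eqP.
move: cn xk; move: (c ^+ k.+2) (x ^+ k) ((k.+2)`!%:R : R) => C X F C0 X0; field.
by rewrite C0 X0 x2.
Qed.

Lemma is_derive_subr a x : is_derive x 1 (fun x : R => x - a) 1.
Proof. exact: is_derive_shift. Qed.

Lemma is_derive_rsub b x : is_derive x 1 (fun x : R => b - x) (-1).
Proof. by have := is_deriveB (is_derive_cst b x 1) (is_derive_id x 1); rewrite sub0r. Qed.

Lemma is_derive_flat c k x : 0 < c ->
  is_derive x 1 (flat c k) (c * flat c k.+2 x - k%:R * flat c k.+1 x).
Proof.
move=> c0; have [x0|x0|<-] := ltgtP 0 x.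
- have xn0 : x != 0 by rewrite gt_eqF.
  apply: (@near_eq_is_derive _ _ _ ((GRing.inv ^+ k) * (expR \o (fun x => - (c * x^-1))))).
    near=> y; rewrite /flat ifT ?fctE//=.
    by near: y; exact: lt_nbhsr.
  have dI : is_derive x 1 (GRing.inv : R -> R) (- x ^- 2).
    by have := @is_deriveV R id x 1 1 xn0 (is_derive_id x 1); rewrite /GRing.scale/= mulr1.
  have dV : is_derive x 1 (fun x : R => - (c * x^-1)) (c * x ^- 2).
    by have := is_deriveN (is_deriveZ c dI); rewrite /GRing.scale/= mulrN opprK.
  apply: (is_derive_eq (is_deriveM (is_deriveX k dI) (is_derive1_comp (is_derive_expR _)
    dV))).
  rewrite /flat x0 /GRing.scale/= exprfctE.
  move: (expR _) => E; case: k => [|k]; first by rewrite !mul0r mulr0; rewrite -exprVn;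
    ring.
  by rewrite -exprVn /= !exprS; ring.
- rewrite /flat !ltNge (ltW x0)/= !mulr0 subr0.
  have d0 : is_derive x (1 : R) (cst (0 : R)) 0 by exact: is_derive_cst.
  apply: near_eq_is_derive d0.
  near=> y; rewrite ltNge ifF//; apply/negbTE/negPn.
  by apply: ltW; near: y; exact: lt_nbhsl.
(* At 0 the quadratic bound makes the difference quotient at most C * h for positive h, and it is 0
   for negative h. *)
- rewrite {2 3}/flat ltxx !mulr0 subr0.
  have C0 : 0 < (k.+2)`!%:R / c ^+ k.+2 by rewrite divr_gt0 ?ltr0n ?fact_gt0// exprn_gt0.
  set C := _ / _ in C0.
  have cv : (fun h => h^-1 *: (flat c k (h *: (1:R) + 0) - flat c k 0)) h @[h --> 0^'] -->
    (0 : R).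
    apply/cvgr0Pnorm_le => /= e e0; near=> h.
    rewrite addr0 [X in _ - X](_ : _ = 0) ?subr0; last by rewrite /flat ltxx.
    have hn0 : h != 0 by near: h; exact: nbhs_dnbhs_neq.
    rewrite /GRing.scale/= mulr1 normrM (ger0_norm (flat_ge0 _ _ _)).
    have [h0|h0] := leP h 0; first by rewrite /flat ltNge h0/= mulr0 ltW.
    apply: (@le_trans _ _ (`|h^-1| * (C * h ^+ 2))).
      by rewrite ler_wpM2l//; apply: flat_le => //; exact: ltW.
    rewrite gtr0_norm ?invr_gt0// (_ : h^-1 * (C * h ^+ 2) = C * h); last by field.
    rewrite mulrC -ler_pdivlMr// (le_trans (ler_norm _))//.
    near: h; apply: dnbhs0_le; exact: divr_gt0.
  apply: DeriveDef; first by apply/cvg_ex; exists 0.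
  exact/cvg_lim.
Unshelve. all: by end_near.
Qed.

(* A class of functions containing the bumps and closed under derivation, which
   avoids computing iterated derivatives. *)
Inductive bumpy : (R -> R) -> Prop :=
| bumpy_flat c a k : 0 < c -> bumpy (fun x => flat c k (x - a))
| bumpy_flatN c b k : 0 < c -> bumpy (fun x => flat c k (b - x))
| bumpyD f g : bumpy f -> bumpy g -> bumpy (fun x => f x + g x)
| bumpyM f g : bumpy f -> bumpy g -> bumpy (fun x => f x * g x)
| bumpyZ r f : bumpy f -> bumpy (fun x => r * f x).

Lemma bumpy_derive f : bumpy f -> exists2 f', bumpy f' & forall x, is_derive x 1 f (f' x).
Proof.
elim=> {f} [c a k c0|c b k c0|f g _ [f' bf' df] _ [g' bg' dg]|f g bf [f' bf' df] bg [g' bg'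
  dg]|r f _ [f' bf' df]].
- exists (fun x => c * flat c k.+2 (x - a) + (- k%:R) * flat c k.+1 (x - a)).
    by apply: bumpyD; apply: bumpyZ; exact: bumpy_flat.
  move=> x; have := @is_derive1_comp _ (flat c k) (fun x => x - a) x _ 1 (is_derive_flat k
    (x - a) c0) _.
  rewrite mulr1 mulNr; apply; exact: is_derive_subr.
- exists (fun x => (- c) * flat c k.+2 (b - x) + (k%:R) * flat c k.+1 (b - x)).
    by apply: bumpyD; apply: bumpyZ; exact: bumpy_flatN.
  move=> x; have := @is_derive1_comp _ (flat c k) (fun x => b - x) x _ (-1) (is_derive_flat
    k (b - x) c0) _.
  rewrite mulrN1 opprB mulNr addrC; apply.
  exact: is_derive_rsub.
- exists (fun x => f' x + g' x); first exact: bumpyD.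
  by move=> x; exact: is_deriveD.
- exists (fun x => f x * g' x + g x * f' x); first by apply: bumpyD; exact: bumpyM.
  by move=> x; exact: is_deriveM.
- exists (fun x => r * f' x); first exact: bumpyZ.
  by move=> x; exact: is_deriveZ.
Qed.

Definition bump c a b x : R := flat c 0 (x - a) * flat c 0 (b - x).

(** Written as [bump] times its logarithmic derivative, which exhibits the sign: nonnegative up to
    the midpoint of the interval. Outside the open interval the factor [bump] vanishes, so the
    values of the inverses there are immaterial. *)
Definition dbump c a b x : R :=
  bump c a b x * (c * ((x - a)^-1 ^+ 2 - (b - x)^-1 ^+ 2)).

Lemma bumpy_bump c a b : 0 < c -> bumpy (bump c a b).
Proof. by move=> c0; apply: bumpyM; [exact: bumpy_flat|exact: bumpy_flatN]. Qed.

Lemma is_derive_bump c a b x : 0 < c -> is_derive x 1 (bump c a b) (dbump c a b x).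
Proof.
move=> c0.
have d1 : is_derive x 1 (fun x => flat c 0 (x - a)) (c * flat c 2 (x - a)).
  have := @is_derive1_comp _ (flat c 0) (fun x => x - a) x _ 1 (is_derive_flat 0 (x - a)
    c0) _.
  rewrite mulr1 mul0r subr0; apply.
  exact: is_derive_subr.
have d2 : is_derive x 1 (fun x => flat c 0 (b - x)) (- (c * flat c 2 (b - x))).
  have := @is_derive1_comp _ (flat c 0) (fun x => b - x) x _ (-1) (is_derive_flat 0 (b - x)
    c0) _.
  rewrite mulrN1 mul0r subr0; apply.
  exact: is_derive_rsub.
apply: (is_derive_eq (is_deriveM d1 d2)).
rewrite /dbump /bump /flat /GRing.scale/=.
by case: ifPn => _; case: ifPn => _; rewrite ?(mulr0, mul0r, addr0, expr0, mul1r, oppr0)//;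
  ring.
Qed.

Lemma continuous_bumpy f : bumpy f -> continuous f.
Proof.
move=> /bumpy_derive[f' _ df] x.
by apply/differentiable_continuous/derivable1_diffP; have [] := df x.
Qed.

Lemma continuous_dbump c a b : 0 < c -> continuous (dbump c a b).
Proof.
move=> c0; have [f' bf' df] := bumpy_derive (bumpy_bump a b c0).
suff -> : dbump c a b = f' by exact: continuous_bumpy.
apply/funext => x; have [_ <-] := df x.
by have [_ <-] := is_derive_bump a b x c0.
Qed.

Lemma bump_ge0 c a b x : 0 <= bump c a b x.
Proof. by rewrite mulr_ge0 ?flat_ge0. Qed.

Lemma flat_le1 c x : 0 < c -> flat c 0 x <= 1.
Proof.
move=> c0; rewrite /flat; case: ifPn => // x0.
by rewrite expr0 mul1r -expR0 ler_expR lerNl oppr0 mulr_ge0 ?invr_ge0// ltW.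
Qed.

Lemma bump_le1 c a b x : 0 < c -> bump c a b x <= 1.
Proof. by move=> c0; rewrite mulr_ile1 ?flat_ge0 ?flat_le1. Qed.

Lemma bump_out c a b x : ~~ (a < x < b) -> bump c a b x = 0.
Proof.
rewrite /bump /flat !subr_gt0 negb_and => /orP[/negbTE ->|/negbTE ->];
  by rewrite ?mul0r ?mulr0.
Qed.

Lemma dbump_out c a b x : ~~ (a < x < b) -> dbump c a b x = 0.
Proof. by move=> h; rewrite /dbump bump_out// mul0r. Qed.

Lemma dbump_ge0 c a b x : 0 < c -> x <= (a + b) / 2 -> 0 <= dbump c a b x.
Proof.
move=> c0 xm; have [/andP[ax xb]|/dbump_out ->//] := boolP (a < x < b).
apply: mulr_ge0; first exact: bump_ge0.
apply: mulr_ge0; first exact: ltW.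
by rewrite subr_ge0 lerXn2r ?nnegrE ?invr_ge0 ?subr_ge0 ?(ltW ax) ?(ltW xb)// lef_pV2
  ?posrE ?subr_gt0//; lra.
Qed.

Lemma bump_cvg a b x : bump k.+1%:R^-1 a b x @[k --> \oo] --> (\1_`]a, b[%classic x : R).
Proof.
have [axb|axb] := boolP (x \in `]a, b[); last first.
  rewrite indicE memNset; last exact/negP.
  under eq_fun do rewrite bump_out//.
  exact: cvg_cst.
rewrite indicE mem_set//=; move: axb; rewrite in_itv/= => /andP[ax xb].
have f1 r : 0 < r -> flat k.+1%:R^-1 0 r @[k --> \oo] --> (1 : R).
  move=> r0; rewrite /flat r0; under eq_fun do rewrite expr0 mul1r.
  suff : expR (- (k.+1%:R^-1 * r^-1)) @[k --> \oo] --> expR (- (0 * r^-1)).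
    by rewrite mul0r oppr0 expR0.
  apply: continuous_cvg; first exact: continuous_expR.
  by apply: cvgN; apply: cvgMl; exact: cvg_harmonic.
have := cvgM (f1 (x - a) _) (f1 (b - x) _); rewrite !subr_gt0 mulr1; exact.
Qed.

End bump.

(** * Weak derivatives on the line *)

Section line_calculus.
Variable R : realType.
Local Notation lam := (@lebesgue_measure R).
Implicit Types (F f g w rho : R -> R) (a b c : R).

Lemma continuous_itv_integrable f a b : {within `[a, b], continuous f} ->
  lam.-integrable `[a, b] (EFin \o f).
Proof. by move=> cf; apply: continuous_compact_integrable => //;
  exact: segment_compact. Qed.

Lemma integrable_itvZl f c a b : lam.-integrable `[a, b] (EFin \o f) ->
  lam.-integrable `[a, b] (EFin \o (fun x => c * f x)).
Proof. by move=> fi; apply: (@integrableZl _ _ _ lam _ _ c _ fi). Qed.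

Lemma integrable_itvB f g a b : lam.-integrable `[a, b] (EFin \o f) ->
  lam.-integrable `[a, b] (EFin \o g) ->
  lam.-integrable `[a, b] (EFin \o (fun x => f x - g x)).
Proof. by move=> fi gi; apply: (@integrableB _ _ _ lam _ _ _ _ fi gi). Qed.

Lemma Rintegral_split f a c b : lam.-integrable `[a, b] (EFin \o f) ->
  a <= c -> c <= b ->
  \int[lam]_(x in `[a, b]) f x = \int[lam]_(x in `[a, c]) f x + \int[lam]_(x in `[c, b]) f
    x.
Proof.
move=> fi ac cb.
have := @Rintegral_itvB R f (BLeft a) (BRight b) c fi.
rewrite !bnd_simp => /(_ ac cb) h.
rewrite -(@Rintegral_itv_obnd_cbnd _ c) -?h; first by ring.
apply: integrableS fi => //; apply: subset_itvr; by rewrite bnd_simp.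
Qed.

Lemma is_derive_continuous F f : (forall x : R, is_derive x 1 F (f x)) -> continuous F.
Proof.
by move=> df x; apply/differentiable_continuous/derivable1_diffP; have [] := df x.
Qed.

Lemma Rintegral_derive F f a b : a <= b -> (forall x : R, is_derive x 1 F (f x)) ->
  continuous f -> \int[lam]_(x in `[a, b]) f x = F b - F a.
Proof.
rewrite le_eqVlt => /predU1P[->|ab] df cf.
  by rewrite set_itv1 Rintegral_set1 subrr.
have cF := is_derive_continuous df.
rewrite /Rintegral (@continuous_FTC2 _ f F)//.
- exact: continuous_subspaceT.
- split.
  + by move=> x _; have [] := df x.
  + by apply: cvg_at_right_filter; exact: cF.
  + by apply: cvg_at_left_filter; exact: cF.
- by move=> x _; rewrite derive1E; have [_ ->] := df x.
Qed.

Lemma normr_Rintegral_le f rho (B : R) a b :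
  lam.-integrable `[a, b] (EFin \o (fun x => f x * rho x)) ->
  lam.-integrable `[a, b] (EFin \o rho) ->
  (forall x, a <= x <= b -> `|f x| <= B) -> (forall x, a <= x <= b -> 0 <= rho x) ->
  `|\int[lam]_(x in `[a, b]) (f x * rho x)| <= B * \int[lam]_(x in `[a, b]) rho x.
Proof.
move=> fi ri fB r0; apply: le_trans (le_normr_Rintegral _ fi) _ => //.
rewrite -RintegralZl//; apply: le_Rintegral => //.
- have := integrable_norm fi; rewrite /comp/=; exact.
- exact: integrable_itvZl.
- move=> x; rewrite /= in_itv/= => xab; rewrite normrM (ger0_norm (r0 _ xab)).
  by rewrite ler_wpM2r ?fB// r0.
Qed.

Lemma within_bounded w a b : {within `[a, b], continuous w} ->
  exists2 M : R, 0 <= M & forall x, a <= x <= b -> `|w x| <= M.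
Proof.
move=> cw.
have [ab|ba] := leP a b; last first.
  exists 0 => // x /andP[ax xb]; move: (le_trans ax xb); by rewrite leNgt ba.
have cw' : {within `[a, b], continuous (fun x => `|w x|)}.
  move=> x; apply: cvg_norm; exact: cw.
have [c _ cM] := EVT_max ab cw'.
by exists `|w c| => // x xab; apply: cM; rewrite in_itv.
Qed.

Lemma within_cont_le w a b (x e : R) : {within `[a, b], continuous w} -> a <= x <= b -> 0 <
  e ->
  exists2 d : R, 0 < d & forall y, a <= y <= b -> `|x - y| < d -> `|w x - w y| <= e.
Proof.
move=> /subspace_continuousP cw xab e0.
have xab' : [set` `[a, b]] x by rewrite /= in_itv.
have /cvgrPdist_le/(_ _ e0) := cw _ xab'.
rewrite near_withinE => /nbhs_ballP[d /= d0 H]; exists d => // y yab xyd.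
by apply: H => //=; rewrite in_itv.
Qed.

(** On the left half [dbump] is an approximate point mass at [a]: it is nonnegative, its mass on
    [a, m] is the value of the bump at m, which tends to 1, and its mass on [r, m] tends to 0 for
    every fixed r > a. *)
Lemma bump_left_limit w a b (m : R) : a < m -> m <= (a + b) / 2 ->
  {within `[a, m], continuous w} ->
  \int[lam]_(x in `[a, m]) (w x * dbump k.+1%:R^-1 a b x) @[k --> \oo] --> w a.
Proof.
move=> am mab cw.
have [M M0 wM] := within_bounded cw.
have mb : m < b by lra.
have c0 k : 0 < k.+1%:R^-1 :> R by rewrite invr_gt0.
apply/cvgrPdist_le => /= e e0.
have e40 : 0 < e / 4 by rewrite divr_gt0.
have aam : a <= a <= m by rewrite lexx ltW.
have [d d0 wd] := within_cont_le cw aam e40.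
(* On [a, r] the values of [w] stay within e / 4 of [w a]; d / 2 instead of d provides the strict
   inequality required by [wd]. *)
pose r := Num.min (a + d / 2) m.
have ar : a < r by rewrite lt_min am andbT ltrDl divr_gt0.
have rm : r <= m by rewrite ge_min lexx orbT.
have rb : r < b by exact: le_lt_trans mb.
have bm x : a < x < b -> bump k.+1%:R^-1 a b x @[k --> \oo] --> (1 : R).
  by move=> xab; have := @bump_cvg R a b x; rewrite indicE mem_set//= in_itv.
have /cvgrPdist_le cvm := bm m (introT andP (conj am mb)).
have /cvgrPdist_le cvr := bm r (introT andP (conj ar rb)).
(* Three errors of at most e / 4 arise: near a, on [r, m], and from the missing mass 1 - X m. The
   last two carry the factors 2 * M and [|w a|], both at most 2 * M + 1, which is positive even for
   M = 0. *)
have e1 : 0 < e / 4 / (2 * M + 1) by rewrite divr_gt0//; lra.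
near=> k.
have Xm : `|1 - bump k.+1%:R^-1 a b m| <= e / 4 / (2 * M + 1) by near: k; exact: cvm.
have Xr : `|1 - bump k.+1%:R^-1 a b r| <= e / 4 / (2 * M + 1) by near: k; exact: cvr.
move: Xm Xr; set X := bump k.+1%:R^-1 a b; set rho := dbump k.+1%:R^-1 a b.
have dX (x : R) : is_derive x 1 X (rho x) by exact: is_derive_bump.
have crho : continuous rho by exact: continuous_dbump.
have Xa : X a = 0 by rewrite /X bump_out// ltxx.
have Xm1 : X m <= 1 by exact: bump_le1.
have Xr1 : X r <= 1 by exact: bump_le1.
rewrite ger0_norm ?subr_ge0// => Xm; rewrite ger0_norm ?subr_ge0// => Xr.
have ir s t : lam.-integrable `[s, t] (EFin \o rho).
  by apply: continuous_itv_integrable; exact: continuous_subspaceT.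
have iwr : lam.-integrable `[a, m] (EFin \o (fun x => w x * rho x)).
  apply: continuous_itv_integrable; move=> x; apply: cvgM; first exact: cw.
  by apply: continuous_subspaceT; exact: crho.
pose h x := w x - w a.
have ih : lam.-integrable `[a, m] (EFin \o (fun x => h x * rho x)).
  rewrite (_ : (fun x => _) = (fun x => w x * rho x - w a * rho x)).
    exact/integrable_itvB/integrable_itvZl/ir.
  by apply/funext => x; rewrite /h mulrBl.
have -> : \int[lam]_(x in `[a, m]) (w x * rho x) =
    w a * X m + \int[lam]_(x in `[a, m]) (h x * rho x).
  have <- : \int[lam]_(x in `[a, m]) (w a * rho x) = w a * X m.
    by rewrite RintegralZl// (Rintegral_derive (ltW am) dX crho) Xa subr0.
  rewrite -RintegralD//; last first.
    exact/integrable_itvZl/ir.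
  by apply: eq_Rintegral => x _; rewrite /h; ring.
rewrite (Rintegral_split ih (ltW ar) rm).
have r0 x : a <= x <= m -> 0 <= rho x.
  by move=> /andP[_ xm]; apply: dbump_ge0 => //; exact: le_trans mab.
have iha : lam.-integrable `[a, r] (EFin \o (fun x => h x * rho x)).
  by apply: integrableS ih => //; apply: subset_itvl; rewrite bnd_simp.
have ihm : lam.-integrable `[r, m] (EFin \o (fun x => h x * rho x)).
  by apply: integrableS ih => //; apply: subset_itvr; rewrite bnd_simp ltW.
have h1 := @normr_Rintegral_le h rho (e / 4) a r iha (ir _ _).
have {}h1 : `|\int[lam]_(x in `[a, r]) (h x * rho x)| <= e / 4.
  apply: (le_trans (h1 _ _)).
  - move=> x /andP[ax xr]; rewrite /h distrC; apply: wd.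
      by rewrite ax (le_trans xr rm).
    rewrite ler0_norm; last by lra.
    have : x <= a + d / 2 by apply: (le_trans xr); rewrite ge_min lexx.
    lra.
  - by move=> x /andP[ax xr]; apply: r0; rewrite ax (le_trans xr rm).
  rewrite (Rintegral_derive (ltW ar) dX crho) Xa subr0.
  by rewrite -[leRHS]mulr1 ler_wpM2l// ltW.
have h2 := @normr_Rintegral_le h rho (2 * M) r m ihm (ir _ _).
have {}h2 : `|\int[lam]_(x in `[r, m]) (h x * rho x)| <= 2 * M * (1 - X r).
  apply: (le_trans (h2 _ _)).
  - move=> x /andP[rx xm]; rewrite /h (le_trans (ler_normB _ _))//.
    have := wM a; have := wM x;
      rewrite xm (le_trans (ltW ar) rx) lexx (ltW am) => /(_ isT) ? /(_ isT) ?.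
    lra.
  - by move=> x /andP[rx xm]; apply: r0; rewrite xm (le_trans (ltW ar) rx).
  rewrite (Rintegral_derive rm dX crho) ler_wpM2l// ?mulr_ge0//; lra.
have wa : `|w a| <= M by apply: wM; rewrite lexx ltW.
have e2 : (2 * M + 1) * (e / 4 / (2 * M + 1)) = e / 4 by field; lra.
have Mr : 2 * M * (1 - X r) <= e / 4.
  rewrite -e2; apply: ler_pM; rewrite ?subr_ge0//; lra.
have Mm : `|w a| * (1 - X m) <= e / 4.
  rewrite -e2; apply: ler_pM; rewrite ?subr_ge0//; lra.
have : `|w a - w a * X m| <= e / 4.
  by rewrite -{1}[w a]mulr1 -mulrBr normrM [X in _ * X]ger0_norm// subr_ge0.
move: h1 h2; rewrite !ler_norml; lra.
Unshelve. all: by end_near. Qed.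

Lemma dbumpN c a b x : dbump c (- b) (- a) x = - dbump c a b (- x).
Proof.
rewrite /dbump /bump.
have -> : x - - b = b - - x by ring.
have -> : - a - x = - x - a by ring.
by ring.
Qed.

(** The left half yields [w a]. The reflection x -> - x carries the right half to a left half and
    changes the sign of [dbump], whence - w b. *)
Lemma bump_limit w a b : a < b -> {within `[a, b], continuous w} ->
  \int[lam]_(x in `[a, b]) (w x * dbump k.+1%:R^-1 a b x) @[k --> \oo] --> w a - w b.
Proof.
move=> ab cw; pose m := (a + b) / 2.
have am : a < m by rewrite /m; lra.
have mb : m < b by rewrite /m; lra.
have c0 k : 0 < k.+1%:R^-1 :> R by rewrite invr_gt0.
have cwa : {within `[a, m], continuous w}.
  by apply: continuous_subspaceW cw; apply: subset_itvl; rewrite bnd_simp ltW.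
have cwb : {within `[m, b], continuous w}.
  by apply: continuous_subspaceW cw; apply: subset_itvr; rewrite bnd_simp ltW.
have cwN : {within `[- b, - m], continuous (w \o -%R)}.
  apply/subspace_continuousP => x; rewrite /= in_itv/= => xbm.
  have xmb : [set` `[m, b]] (- x) by rewrite /= in_itv/=; lra.
  move/subspace_continuousP : cwb => /(_ _ xmb)/cvgrPdist_le cwx.
  apply/cvgrPdist_le => e e0; have := cwx _ e0.
  rewrite !near_withinE => /nbhs_ballP[d /= d0 H]; apply/nbhs_ballP;
    exists d => //= y xyd ybm.
  apply: H => /=; last by move: ybm; rewrite !in_itv/=; lra.
  by move: xyd; rewrite /ball/= (_ : - x - - y = - (x - y)) ?normrN//; ring.
have L := bump_left_limit am (lexx _) cwa.
have Rr := @bump_left_limit (w \o -%R) (- b) (- a) (- m) _ _ cwN.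
have bm : - b < - m by rewrite ltrN2.
have mab : - m <= (- b + - a) / 2 by rewrite /m; lra.
have {}Rr := Rr bm mab; rewrite [X in _ --> X]/= opprK in Rr.
set I := fun k => _; rewrite (_ : I = (fun k => \int[lam]_(x in `[a, m]) (w x * dbump
  k.+1%:R^-1 a b x)) -
    (fun k => \int[lam]_(x in `[- b, - m]) ((w \o -%R) x * dbump k.+1%:R^-1 (- b) (- a)
      x))).
  exact: cvgB.
apply/funext => k; rewrite /I /GRing.add/= /GRing.opp/=.
rewrite (@Rintegral_split _ a m b);
  [|apply: continuous_itv_integrable|exact: ltW|exact: ltW]; last first.
  by move=> x; apply: cvgM; [exact: cw|apply: continuous_subspaceT;
    exact: continuous_dbump].
congr (_ + _); rewrite /Rintegral.
rewrite integration_by_substitution_oppr ?(ltW mb)//; last first.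
  by move=> x; apply: cvgM; [exact: cwN|apply: continuous_subspaceT;
    exact: continuous_dbump].
change (\int[lam]_(x in `[m, b]) (w x * dbump k.+1%:R^-1 a b x) =
  - (\int[lam]_(x in `[m, b]) (w (- - x) * dbump k.+1%:R^-1 (- b) (- a) (- x)))).
have -> : \int[lam]_(x in `[m, b]) (w (- - x) * dbump k.+1%:R^-1 (- b) (- a) (- x)) =
    \int[lam]_(x in `[m, b]) (-1 * (w x * dbump k.+1%:R^-1 a b x)).
  by apply: eq_Rintegral => x _; rewrite dbumpN !opprK; ring.
rewrite RintegralZl//; first by rewrite mulN1r opprK.
apply: continuous_itv_integrable => x; apply: cvgM; first exact: cwb.
by apply: continuous_subspaceT; exact: continuous_dbump.
Qed.

End line_calculus.

Lemma countableU T (A B : set T) : countable A -> countable B -> countable (A `|` B).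
Proof.
move=> cA cB; rewrite -bigcup2E; apply: bigcup_countable => //.
by move=> [|[|k]] _ //=; exact: countable0.
Qed.

Section line_identity.
Variable R : realType.
Local Notation lam := (@lebesgue_measure R).
Local Notation mR := (measurableTypeR R).
Implicit Types (F f g w u : R -> R) (a b c : R).

Lemma EFin_Rintegral (D : set mR) (f : mR -> R) : measurable D -> lam.-integrable D (EFin
  \o f) ->
  (\int[lam]_(x in D) (f x)%:E)%E = (\int[lam]_(x in D) f x)%:E.
Proof. by move=> mD fi; rewrite /Rintegral fineK//; exact: integrable_fin_num. Qed.

Lemma measurable_triangle : measurable [set z : mR * mR | z.1 <= z.2].
Proof.
have mB : measurable_fun [set: mR * mR] (fun z : mR * mR => z.2 - z.1 : R).
  by apply: measurable_funB; [exact: measurable_snd|exact: measurable_fst].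
have := mB measurableT `[0, +oo[%classic (measurable_itv _).
rewrite setTI; congr measurable.
by apply/seteqP; split => z /=; rewrite in_itv/= andbT subr_ge0.
Qed.

(** The primitive of a merely integrable [g] need not be differentiable everywhere; instead the
    order of integration is exchanged over the triangle s <= t, and the inner integral of [f] over
    [s, b] is F b - F s. *)
Lemma Rintegral_by_parts g F f a b : a < b -> lam.-integrable `[a, b] (EFin \o g) ->
  (forall x : R, is_derive x 1 F (f x)) -> continuous f ->
  \int[lam]_(t in `[a, b]) ((\int[lam]_(s in `[a, t]) g s) * f t) =
  \int[lam]_(s in `[a, b]) (g s * (F b - F s)).
Proof.
move=> ab gi dF cf.
pose T := [set z : mR * mR | z.1 <= z.2].
pose g1 : mR -> R := g \_ `[a, b]; pose f1 : mR -> R := f \_ `[a, b].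
pose h (z : mR * mR) : \bar R := (g1 z.1 * f1 z.2 * \1_T z)%:E.
have mI : measurable (`[a, b] : set mR) by exact: measurable_itv.
have fi : lam.-integrable `[a, b] (EFin \o f).
  by apply: continuous_itv_integrable; exact: continuous_subspaceT.
have g1i : lam.-integrable setT (EFin \o g1).
  by have := gi; rewrite (integrable_mkcond _ mI) restrict_EFin.
have f1i : lam.-integrable setT (EFin \o f1).
  by have := fi; rewrite (integrable_mkcond _ mI) restrict_EFin.
have mg1 : measurable_fun [set: mR] g1 by apply/measurable_EFinP; exact: measurable_int g1i.
have mf1 : measurable_fun [set: mR] f1 by apply/measurable_EFinP; exact: measurable_int f1i.
have mh : measurable_fun [set: mR * mR] h.
  apply/measurable_EFinP; apply: measurable_funM.
    apply: measurable_funM.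
      by apply: measurableT_comp => //; exact: measurable_fst.
    by apply: measurableT_comp => //; exact: measurable_snd.
  by apply: measurable_indic; exact: measurable_triangle.
have hi : (lam \x lam)%E.-integrable setT h.
  apply/(integrable12ltyP _ _ mh).
  have nf1 : lam.-integrable setT (EFin \o (fun t : mR => `|f1 t|)) by exact:
    (integrable_norm f1i).
  have ng1 : lam.-integrable setT (EFin \o (fun t : mR => `|g1 t|)) by exact:
    (integrable_norm g1i).
  have mnf1 : measurable_fun [set: mR] (fun t : mR => `|f1 t|) by exact: measurableT_comp.
  have mng1 : measurable_fun [set: mR] (fun t : mR => `|g1 t|) by exact: measurableT_comp.
  (* The modulus of [h] is at most that of [g1 s * f1 t], so its integral in t is bounded by C times
     the modulus of [g1 s]. *)
  pose C := \int[lam]_t `|f1 t|.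
  have C0 : 0 <= C by apply: Rintegral_ge0.
  have iC : lam.-integrable setT (EFin \o (fun s : mR => C * `|g1 s|)).
    exact: (@integrableZl _ _ _ lam _ _ C _ ng1).
  have /integrableP[_] := iC.
  apply: le_lt_trans; apply: ge0_le_integral => //.
  - by move=> s _; apply: integral_ge0.
  - apply: (@measurable_fun_fubini_tonelli_F _ _ _ _ _ lam (abse \o h)) => //.
      exact: measurableT_comp.
    by move=> z; exact: abse_ge0.
  - exact: measurable_int (integrable_abse iC).
  - move=> s _; rewrite /= ger0_norm ?mulr_ge0// mulrC EFinM /C -EFin_Rintegral//.
    rewrite -ge0_integralZl_EFin//; last exact/measurable_EFinP.
    apply: ge0_le_integral => //.
    + have mhs : measurable_fun [set: mR] (fun t : mR => h (s, t)) by exact: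
      measurable_fun_pair2.
      exact: (@measurableT_comp _ _ _ _ _ _ (@abse R) _ (fun t : mR => h (s, t))).
    + by apply/measurable_EFinP; exact: measurable_funM.
    + move=> t _; rewrite /h -EFinM lee_fin !normrM ler_piMr ?mulr_ge0//.
      by rewrite indicE; case: (_ \in _); rewrite ?normr0 ?normr1.
have gti t : t <= b -> lam.-integrable `[a, t] (EFin \o g).
  by move=> tb; apply: integrableS gi => //; apply: subset_itvl; rewrite bnd_simp.
have /(congr1 fine) := Fubini hi.
have -> : (\int[lam]_s \int[lam]_t h (s, t) = \int[lam]_(s in `[a, b]) (g s * (F b - F
  s))%:E)%E.
  rewrite [RHS]integral_mkcond; apply: eq_integral => s _; rewrite patchE.
  case: ifPn => [|sab]; last first.
    rewrite integral0_eq// => t _.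
    by rewrite /h /g1 /= patchE (negbTE sab) !mul0r.
  rewrite inE /= in_itv/= => /andP[as_ sb].
  have si : lam.-integrable `[s, b] (EFin \o f).
    by apply: continuous_itv_integrable; exact: continuous_subspaceT.
  rewrite -(Rintegral_derive sb dF cf) -RintegralZl// -EFin_Rintegral//;
    last exact: integrable_itvZl.
  rewrite [RHS]integral_mkcond; apply: eq_integral => t _; rewrite /h /g1 /f1 /= !patchE.
  rewrite (_ : s \in _); last by rewrite inE/= in_itv/= as_.
  rewrite indicE /T; have [st|ts] := leP s t; last first.
    rewrite (_ : ((s, t) \in _) = false) ?mulr0; last by apply/memNset; rewrite /= leNgt ts.
    by rewrite memNset//= in_itv/= leNgt ts.
  rewrite (_ : ((s, t) \in _) = true) ?mulr1; last by rewrite mem_set.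
  have [tb|bt] := leP t b.
    by rewrite !mem_set//= in_itv/= ?st// (le_trans as_ st).
  by rewrite !memNset ?mulr0//= in_itv/= [t <= b]leNgt bt andbF.
have -> : (\int[lam]_t \int[lam]_s h (s, t) = \int[lam]_(t in `[a, b]) ((\int[lam]_(s in
  `[a, t]) g s) * f t)%:E)%E.
  rewrite [RHS]integral_mkcond; apply: eq_integral => t _; rewrite patchE.
  case: ifPn => [|tab]; last first.
    rewrite integral0_eq// => s _.
    by rewrite /h /f1 /= patchE (negbTE tab) mulr0 mul0r.
  rewrite inE /= in_itv/= => /andP[at_ tb].
  rewrite mulrC -RintegralZl//; last exact: gti.
  rewrite -EFin_Rintegral//; last by apply: integrable_itvZl; exact: gti.
  rewrite [RHS]integral_mkcond; apply: eq_integral => s _; rewrite /h /g1 /f1 /= !patchE.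
  rewrite (_ : t \in _); last by rewrite inE/= in_itv/= at_.
  rewrite indicE /T mulrC; have [st|ts] := leP s t; last first.
    rewrite (_ : ((s, t) \in _) = false) ?mul0r; last by apply/memNset; rewrite /= leNgt ts.
    by rewrite memNset//= in_itv/= [s <= t]leNgt ts andbF.
  rewrite (_ : ((s, t) \in _) = true) ?mul1r; last by rewrite mem_set.
  have [as_|sa] := leP a s.
    by rewrite !mem_set//= ?in_itv/= ?st ?as_ ?(le_trans st tb)//= mulrC.
  by rewrite !memNset ?mul0r//= in_itv/= leNgt sa.
by [].
Qed.

(** Two distinct values would, by the intermediate value theorem, put a nondegenerate interval into
    the image; such an interval has positive measure, so it is uncountable. *)
Lemma countable_image_constant w a b : a < b -> {within `[a, b], continuous w} ->
  countable (w @` `[a, b]) -> forall x y, a <= x <= b -> a <= y <= b -> w x = w y.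
Proof.
move=> ab cw ctb.
suff H x y : a <= x -> x <= y -> y <= b -> w x = w y.
  move=> x y /andP[ax xb] /andP[ay yb]; have [xy|/ltW yx] := leP x y; first exact: H.
  exact/esym/H.
move=> ax xy yb; apply/eqP; apply: contrapT => /negP wxy.
pose m := Num.min (w x) (w y); pose M := Num.max (w x) (w y).
have mM : m < M.
  by move: wxy; rewrite neq_lt gt_min !lt_max !ltxx => /orP[->|->]; rewrite ?orbT.
have sub : `[m, M]%classic `<=` w @` `[a, b].
  move=> v; rewrite /= in_itv/= => vmM.
  have cwxy : {within `[x, y], continuous w}.
    by apply: continuous_subspaceW cw; apply: subset_itv; rewrite bnd_simp.
  have [c] := IVT xy cwxy vmM; rewrite in_itv/= => /andP[xc cy] <-.
  by exists c => //; rewrite /= in_itv/= (le_trans ax xc) (le_trans cy yb).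
have := countable_lebesgue_measure0 (sub_countable (subset_card_le sub) ctb).
rewrite lebesgue_measure_itv/= lte_fin mM => /eqP.
by rewrite -EFinB eqe subr_eq0 gt_eqF.
Qed.

Lemma integrable_itvMl g (h : R -> R) a b : lam.-integrable `[a, b] (EFin \o g) ->
  continuous h -> lam.-integrable `[a, b] (EFin \o (fun x => g x * h x)).
Proof.
move=> gi ch; have [B B0 hB] := within_bounded (continuous_subspaceT ch : {within `[a, b],
  continuous h}).
apply: (@integrableMl _ _ _ lam `[a, b]%classic _ (EFin \o g) h gi) => //.
- by apply: measurable_funS (continuous_measurable_fun ch).
- exists B; split; first exact: num_real.
  move=> x Bx y; rewrite /= in_itv/= => yab; apply: le_trans (ltW Bx); exact: hB.
Qed.

(** The tests say that w = u - G, with [G] a primitive of [g], is orthogonal to all the [dbump] of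
    the interval; by [bump_limit] the limit of these pairings is w a - w b. *)
Lemma weak_derivative_increment u g (a b : R) : a < b -> continuous u ->
  lam.-integrable `[a, b] (EFin \o g) ->
  (forall k, \int[lam]_(x in `[a, b])
    (u x * dbump k.+1%:R^-1 a b x + g x * bump k.+1%:R^-1 a b x) = 0) ->
  u b - u a = \int[lam]_(x in `[a, b]) g x.
Proof.
move=> ab cu gi H.
pose G t := \int[lam]_(x in `[a, t]) g x.
have cG : {within `[a, b], continuous G}.
  exact: (parameterized_integral_continuous (ltW ab) gi).
have Ga : G a = 0 by rewrite /G set_itv1 Rintegral_set1.
pose w x := u x - G x.
have cw : {within `[a, b], continuous w}.
  by move=> x; apply: cvgB; [exact: continuous_subspaceT|exact: cG].
have c0 k : 0 < k.+1%:R^-1 :> R by rewrite invr_gt0.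
have H0 k : \int[lam]_(x in `[a, b]) (w x * dbump k.+1%:R^-1 a b x) = 0.
  have dbi (v : R -> R) : {within `[a, b], continuous v} ->
      lam.-integrable `[a, b] (EFin \o (fun x => v x * dbump k.+1%:R^-1 a b x)).
    move=> cv; apply: continuous_itv_integrable => x; apply: cvgM; first exact: cv.
    by apply: continuous_subspaceT; exact: continuous_dbump.
  have gbi : lam.-integrable `[a, b] (EFin \o (fun x => g x * bump k.+1%:R^-1 a b x)).
    apply: integrable_itvMl => //; apply: continuous_bumpy; exact: bumpy_bump.
  have cu' : {within `[a, b], continuous u} by exact: continuous_subspaceT.
  rewrite /w; under eq_Rintegral do rewrite mulrBl.
  rewrite RintegralB//; [|exact: dbi..].
  (* The bump vanishes at [b], so [G] against [dbump] becomes minus [g] against [bump]. *)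
  rewrite /G (Rintegral_by_parts ab gi (fun x => is_derive_bump a b x (c0 k)))//;
    last exact: continuous_dbump.
  rewrite -[RHS](H k) RintegralD//; last exact: dbi.
  congr (_ + _); rewrite -mulN1r -RintegralZl//; last first.
    apply: integrable_itvMl => //; move=> x; apply: cvgB; first exact: cvg_cst.
    by apply: continuous_bumpy; exact: bumpy_bump.
  by apply: eq_Rintegral => x _; rewrite [X in X - _]bump_out ?ltxx ?andbF//; ring.
have := bump_limit ab cw; under eq_fun do rewrite H0.
move=> /(cvg_unique _ (cvg_cst 0)) h.
have {}h := h (@norm_hausdorff _ _).
by move: h; rewrite /w Ga subr0 /G; lra.
Qed.

(** The hypothesis on tests involves only rational end points and one sequence of bumps: a countable
    set of conditions, which can hold simultaneously on almost every line. *)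
Lemma line_weak_identity u g (phi dphi : R -> R) (K : set R) (M : R) :
  0 < M -> closed K -> countable K -> continuous u ->
  lam.-integrable `[- M, M] (EFin \o g) ->
  (forall x : R, is_derive x 1 phi (dphi x)) -> continuous dphi ->
  phi (- M) = 0 -> phi M = 0 ->
  (forall q r : rat, - M < ratr q -> ratr q < ratr r :> R -> ratr r < M ->
    (forall t, ratr q <= t <= ratr r -> ~ K t) -> forall k,
    \int[lam]_(x in `[ratr q, ratr r]) (u x * dbump k.+1%:R^-1 (ratr q) (ratr r) x +
      g x * bump k.+1%:R^-1 (ratr q) (ratr r) x) = 0) ->
  \int[lam]_(x in `[- M, M]) (u x * dphi x + g x * phi x) = 0.
Proof.
move=> M0 cK ctK cu gi dphiE cdphi phiM phiM' H.
have MM : - M < M by lra.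
pose G t := \int[lam]_(x in `[- M, t]) g x.
have cG : {within `[- M, M], continuous G}.
  exact: (parameterized_integral_continuous (ltW MM) gi).
pose w x := u x - G x.
have cw : {within `[- M, M], continuous w}.
  by move=> x; apply: cvgB; [exact: continuous_subspaceT|exact: cG].
have wrat (q r : rat) : - M < ratr q -> ratr q < ratr r :> R -> ratr r < M ->
    (forall t : R, ratr q <= t <= ratr r -> ~ K t) -> w (ratr q) = w (ratr r).
  move=> Mq qr rM qrK.
  have girq : lam.-integrable `[- M, ratr r] (EFin \o g).
    by apply: integrableS gi => //; apply: subset_itvl; rewrite bnd_simp ltW.
  have giqr : lam.-integrable `[ratr q, ratr r] (EFin \o g).
    by apply: integrableS girq => //; apply: subset_itvr; rewrite bnd_simp ltW.
  have := weak_derivative_increment qr cu giqr (H q r Mq qr rM qrK).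
  have := Rintegral_split girq (ltW Mq) (ltW qr).
  rewrite /w /G; lra.
have wK (t : R) : - M < t < M -> ~ K t -> exists q : rat, w t = w (ratr q).
  move=> /andP[Mt tM] nKt.
  have /nbhs_ballP[d0 /= d00 dK] : nbhs t (~` K) by apply: open_nbhs_nbhs; split => //;
    exact: closed_openC.
  (* The interval of radius d around t avoids [K] and stays inside ]-M, M[, so [w] has one common
     value at all its rational points. *)
  pose d := Num.min d0 (Num.min (t + M) (M - t)).
  have d_gt0 : 0 < d by rewrite !lt_min d00; lra.
  have dd0 : d <= d0 by rewrite ge_min lexx.
  have dtM : d <= t + M by rewrite !ge_min lexx orbT.
  have dMt : d <= M - t by rewrite !ge_min lexx !orbT.
  have [q0] : exists q, ratr q \in `]t - d, t + d[%R by apply: rat_in_itvoo; lra.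
  rewrite in_itv/= => /andP[q01 q02]; exists q0.
  have wq (q : rat) : t - d < ratr q < t + d -> w (ratr q0) = w (ratr q).
    move=> /andP[q1 q2].
    have K0 (x y s : R) : t - d < x -> y < t + d -> x <= s <= y -> ~ K s.
      move=> tx ty /andP[xs sy]; apply: dK; rewrite /ball/= ltr_distlC; apply/andP; split;
        lra.
    have [qq|qq|->//] := ltgtP (ratr q0 : R) (ratr q).
      by apply: wrat => //; [lra|lra|move=> s; exact: K0].
    by apply/esym; apply: wrat => //; [lra|lra|move=> s; exact: K0].
  (* Otherwise continuity at t would give a rational point where [w] is within half of the supposed
     gap, although its value there is that at [q0]. *)
  apply/eqP; rewrite -subr_eq0 -normr_eq0; apply: contrapT => /negP w0.
  have e0 : 0 < `|w t - w (ratr q0)| / 2 by rewrite divr_gt0// lt_neqAle eq_sym w0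
    normr_ge0.
  have tMM : - M <= t <= M by lra.
  have [e e00 wt] := within_cont_le cw tMM e0.
  have [q] : exists q, ratr q \in `](Num.max (t - d) (t - e)), t[%R.
    by apply: rat_in_itvoo; rewrite gt_max; lra.
  rewrite in_itv/= gt_max => /andP[/andP[tq1 tq2] tq3].
  have := wt (ratr q); rewrite -(wq q); last by lra.
  rewrite gtr0_norm ?subr_gt0//.
  have -> : - M <= (ratr q : R) <= M by lra.
  move=> /(_ isT); have -> : t - ratr q < e by lra.
  move=> /(_ isT); lra.
(* Off K, w takes the values it has at rational points. *)
have ctw : countable (w @` `[- M, M]).
  apply: (@sub_countable _ _ _ (w @` K `|` (range (w \o ratr)) `|` [set w (- M)] `|` [set w
    M])).
    apply: subset_card_le => _ [t /= + <-]; rewrite in_itv/= => /andP[Mt tM].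
    have [->|tM'] := eqVneq t M; first by right.
    have [->|tM''] := eqVneq t (- M); first by left; right.
    left; left; have [Kt|/wK] := pselect (K t); first by left; exists t.
    case => [|q ->]; last by right; exists q.
    by rewrite !lt_neqAle Mt tM tM' eq_sym tM''.
  rewrite !countableU//; do ?exact: countable1.
  - exact: card_le_trans (card_image_le _ _) ctK.
  - by apply: card_le_trans (card_image_le _ _) _; exact: countableP.
have wc := countable_image_constant MM cw ctw.
(* Thus [u] is c plus the primitive [G]. The constant pairs with [dphi] to c * (phi M - phi (- M)) =
   0, and integrating [G * dphi] by parts cancels [g * phi]. *)
pose c := w M.
have ucG x : [set` `[- M, M]] x -> u x = c + G x.
  rewrite /= in_itv/= => xM; rewrite /c (wc M x)//; first by rewrite /w; ring.
  by rewrite lexx ltW.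
have gpi : lam.-integrable `[- M, M] (EFin \o (fun x => g x * phi x)).
  by apply: integrable_itvMl => //; exact: is_derive_continuous dphiE.
have cdi (v : R -> R) : {within `[- M, M], continuous v} ->
    lam.-integrable `[- M, M] (EFin \o (fun x => v x * dphi x)).
  move=> cv; apply: continuous_itv_integrable => x; apply: cvgM; first exact: cv.
  exact: continuous_subspaceT.
have -> : \int[lam]_(x in `[- M, M]) (u x * dphi x + g x * phi x) =
    \int[lam]_(x in `[- M, M]) (c * dphi x + (G x * dphi x + g x * phi x)).
  by apply: eq_Rintegral => x /set_mem xM; rewrite ucG//; ring.
rewrite RintegralD//; last 2 first.
- apply: integrable_itvZl; apply: continuous_itv_integrable; exact: continuous_subspaceT.
- exact: (integrableD _ (cdi _ cG) gpi).
rewrite RintegralD//; last exact: cdi.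
rewrite RintegralZl//; last by apply: continuous_itv_integrable;
  exact: continuous_subspaceT.
rewrite (Rintegral_derive (ltW MM) dphiE cdphi) phiM phiM' subr0 mulr0 add0r.
rewrite /G (Rintegral_by_parts MM gi dphiE cdphi) -RintegralD//; last first.
  apply: integrable_itvMl => // x; apply: cvgB; first exact: cvg_cst.
  exact: is_derive_continuous dphiE _.
rewrite -[RHS](mul0r (fine (lam `[- M, M]))) -Rintegral_cst//.
by apply: eq_Rintegral => x _; rewrite phiM'; ring.
Qed.

End line_identity.

(** * From L^p norms to integrals over sets of finite measure *)

Section norms.
Context d (T : measurableType d) (R : realType) (mu : {measure set T -> \bar R}).

(* Summed over a set of finite measure, this bounds the L^1 norm by the L^p norm
   for every p >= 1 at once, in place of Hoelder's inequality. *)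
Lemma norm_le_powR (p e a : R) : 1 <= p -> 0 < e -> 0 <= a ->
  a <= e + e * (e^-1 `^ p * a `^ p).
Proof.
move=> p1 e0 a0; have ei0 : 0 <= e^-1 by rewrite invr_ge0 ltW.
rewrite -powRM//; have [ae|ea] := leP a e.
  by apply: (le_trans ae); rewrite lerDl mulr_ge0 ?powR_ge0// ltW.
have h : 1 <= e^-1 * a by rewrite mulrC ler_pdivlMr// mul1r ltW.
apply: (@le_trans _ _ (e * (e^-1 * a))).
  by rewrite mulrA divff ?mul1r// gt_eqF.
rewrite -[leLHS]add0r; apply: lerD; first exact: ltW.
by rewrite ler_pM2l// le1r_powR.
Qed.

(** When e bounds the norm, the integral of (|f| / e)^p is at most 1; together with the constant e
    integrated over D this gives the factor mu D + 1. *)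
Lemma integral_norm_le_Lnorm (p e : R) (D : set T) (f : T -> R) :
  1 <= p -> 0 < e -> measurable D -> measurable_fun setT f ->
  ('N[mu]_(p%:E)[EFin \o f] <= e%:E)%E ->
  (\int[mu]_(x in D) `|f x|%:E <= e%:E * (mu D + 1))%E.
Proof.
move=> p1 e0 mD mf Nf; have p0 : p != 0 by rewrite gt_eqF// (lt_le_trans _ p1).
have e0' := ltW e0.
have ei0 : 0 <= e^-1 by rewrite invr_ge0.
have mnf : measurable_fun [set: T] (fun x => `|f x|) by exact: measurableT_comp.
have mp : measurable_fun [set: T] (fun x => `|f x| `^ p).
  by apply: (@measurableT_comp _ _ _ _ _ _ (fun x : R => x `^ p) _ (fun x => `|f x|)) =>
    //; exact: measurable_powR.
have Ip : (\int[mu]_x (`|f x| `^ p)%:E <= (e `^ p)%:E)%E.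
  have -> : (\int[mu]_x (`|f x| `^ p)%:E = 'N[mu]_(p%:E)[EFin \o f] `^ p)%E.
    by rewrite poweR_Lnorm//; apply: eq_integral => x _; rewrite /= -poweR_EFin.
  rewrite -poweR_EFin; apply: gt0_ler_poweR => //.
  - exact: le_trans ler01 p1.
  - by rewrite in_itv/= Lnorm_ge0 leey.
  - by rewrite in_itv/= lee_fin e0' leey.
apply: (@le_trans _ _ (\int[mu]_(x in D) (e%:E + (e * e^-1 `^ p)%:E * (`|f x| `^ p)%:E)))%E.
  apply: ge0_le_integral => //.
  - by apply/measurable_EFinP; exact: measurable_funTS.
  - apply/measurable_EFinP; apply: measurable_funD => //.
    by apply: measurable_funM => //; exact: measurable_funTS.
  - by move=> x _; rewrite -EFinM -EFinD lee_fin -mulrA; exact: norm_le_powR.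
rewrite ge0_integralD//; last 2 first.
- by move=> x _; rewrite -EFinM lee_fin !mulr_ge0 ?powR_ge0.
- by apply/measurable_EFinP; apply: measurable_funM => //; exact: measurable_funTS.
rewrite integral_cst// ge0_muleDr//.
apply: leeD => //.
rewrite ge0_integralZl//; last 2 first.
- by apply/measurable_EFinP; exact: measurable_funTS.
- by rewrite lee_fin mulr_ge0 ?powR_ge0.
apply: (@le_trans _ _ ((e * e^-1 `^ p)%:E * (e `^ p)%:E)%E).
  rewrite lee_pmul2l ?lte_fin ?mulr_gt0 ?powR_gt0 ?invr_gt0//.
  apply: le_trans Ip; apply: ge0_subset_integral => //.
  exact/measurable_EFinP.
rewrite -EFinM -mulrA -powRM// mulVf ?powR1 ?mulr1 ?mule1// gt_eqF//.
Qed.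

Lemma integral_normDZ (c : R) (D : set T) (f g : T -> R) : 0 <= c -> measurable D ->
  measurable_fun setT f -> measurable_fun setT g ->
  (\int[mu]_(x in D) (`|f x|%:E + c%:E * `|g x|%:E) =
   \int[mu]_(x in D) `|f x|%:E + c%:E * \int[mu]_(x in D) `|g x|%:E)%E.
Proof.
move=> c0 mD mf mg.
have mnf : measurable_fun D (fun x => `|f x|).
  by apply: measurable_funTS; exact: measurableT_comp.
have mng : measurable_fun D (fun x => `|g x|).
  by apply: measurable_funTS; exact: measurableT_comp.
rewrite -ge0_integralZl//; last exact/measurable_EFinP.
apply: ge0_integralD => //.
- exact/measurable_EFinP.
- by move=> x _; rewrite -EFinM lee_fin mulr_ge0.
- by apply/measurable_EFinP; exact: measurable_funM.
Qed.

End norms.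

Section interval_average.
Variable R : realType.
Local Notation lam := (@lebesgue_measure R).

(* On a line meeting the set where a test function is >= 1, the mean of
   |F| + (b - a) |F'| is at least 1: this bounds projections by capacities. *)
Lemma interval_length_le (F f : R -> R) (a b t0 : R) : a < b -> a <= t0 <= b ->
  (forall x : R, is_derive x 1 F (f x)) -> continuous f -> 1 <= F t0 ->
  b - a <= \int[lam]_(x in `[a, b]) (`|F x| + (b - a) * `|f x|).
Proof.
move=> ab /andP[at0 t0b] dF cf F1.
have cF := is_derive_continuous dF.
have cni (v : R -> R) (s t : R) : continuous v -> lam.-integrable `[s, t] (EFin \o (fun x
  => `|v x|)).
  move=> cv; apply: continuous_itv_integrable; apply: continuous_subspaceT => x.
  by apply: cvg_norm; exact: cv.
have ci (v : R -> R) (s t : R) : continuous v -> lam.-integrable `[s, t] (EFin \o v).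
  by move=> cv; apply: continuous_itv_integrable; exact: continuous_subspaceT.
set I := \int[lam]_(x in `[a, b]) `|f x|.
have sub s t : a <= s -> s <= t -> t <= b -> F t - F s <= I /\ F s - F t <= I.
  move=> as_ st tb.
  have H : `|F t - F s| <= I.
    rewrite -(Rintegral_derive st dF cf).
    apply: (le_trans (le_normr_Rintegral _ (ci f s t cf))) => //.
    rewrite /I (Rintegral_split (cni f a b cf) as_ (le_trans st tb)).
    have h1 : 0 <= \int[lam]_(x in `[a, s]) `|f x| by apply: Rintegral_ge0.
    rewrite (Rintegral_split (cni f s b cf) st tb).
    have h2 : 0 <= \int[lam]_(x in `[t, b]) `|f x| by apply: Rintegral_ge0.
    by rewrite addrCA lerDl addr_ge0.
  by move: H; rewrite ler_norml; lra.
(* The variation of [F] between s and t0 is at most [I]; averaging this pointwise bound over s gives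
   the claim. *)
have key s : a <= s <= b -> 1 <= `|F s| + I.
  move=> /andP[as_ sb]; have := ler_norm (F s).
  have [st|ts] := leP s t0.
    by have [] := sub s t0 as_ st t0b; lra.
  by have [] := sub t0 s at0 (ltW ts) sb; lra.
have lab : fine (lam `[a, b]) = b - a.
  by rewrite lebesgue_measure_itv/= lte_fin ab.
rewrite RintegralD//; [|exact: cni|by apply: integrable_itvZl; exact: cni].
rewrite RintegralZl//; last exact: cni.
have -> : (b - a) * I = \int[lam]_(x in `[a, b]) I by rewrite Rintegral_cst// lab mulrC.
have cI : lam.-integrable `[a, b] (EFin \o (fun _ : R => I)) by apply: ci => x;
  exact: cvg_cst.
rewrite -RintegralD//; last exact: cni.
rewrite -{1}lab -[leLHS]mul1r -Rintegral_cst//; apply: le_Rintegral => //.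
- by apply: ci => x; exact: cvg_cst.
- by apply: (@integrableD _ _ _ lam _ _ _ _ (cni F a b cF) cI).
Qed.

End interval_average.

(** * Capacity and projections *)

Section test_functions.
Variables (R : realType) (n : nat).
Local Notation N := n.+1.
Local Notation lam := (@lebesgue_measure R).
Implicit Types (phi : 'rV[R]_N -> R) (i : 'I_N).

Lemma smooth_continuous phi : smooth phi -> continuous phi.
Proof. by move=> /(_ [::])[]. Qed.

Lemma smooth_continuous_partial phi i : smooth phi -> continuous (partial i phi).
Proof. by move=> /(_ [:: i])[]. Qed.

Lemma sliceD i (y : 'rV[R]_n) h t : slice i y (h + t) = h *: delta_mx 0 i + slice i y t.
Proof. by rewrite !sliceE scalerDl addrCA. Qed.

Lemma is_derive_slice phi i (y : 'rV[R]_n) (t : R) : smooth phi ->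
  is_derive t 1 (fun t => phi (slice i y t)) (partial i phi (slice i y t)).
Proof.
move=> sphi; have [_ /(_ i (slice i y t)) dphi] := sphi [::].
have E : (fun h : R => h^-1 *: (((fun t => phi (slice i y t)) \o shift t) (h *: 1) - phi
  (slice i y t))) =
  (fun h : R => h^-1 *: ((phi \o shift (slice i y t)) (h *: delta_mx 0 i) - phi (slice i y
    t))).
  by apply/funext => h; rewrite /= [h *: 1]mulr1 sliceD.
apply: DeriveDef; first by rewrite /derivable E.
by rewrite /derive E.
Qed.

Definition support phi := closure [set x | phi x != 0].

Lemma out_support phi x : ~ support phi x -> phi x = 0.
Proof.
move=> nx; apply/eqP; apply: contrapT => /negP px; apply: nx; exact: subset_closure.
Qed.

Lemma out_support_partial phi i x : ~ support phi x -> partial i phi x = 0.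
Proof.
move=> nx; rewrite /partial.
have : nbhs x (~` support phi).
  apply: open_nbhs_nbhs; split => //; apply: closed_openC; exact: closed_closure.
move=> H; rewrite (@near_eq_derive _ _ _ phi (cst 0)); first by rewrite derive_cst.
by apply: filterS H => z; exact: out_support.
Qed.

Lemma compact_cbox_bound (A : set 'rV[R]_N) : compact A -> exists M : nat,
  forall x, A x -> forall j, `|x 0 j| < M%:R.
Proof.
move=> /compact_bounded[M [Mr HM]].
exists (Num.truncn (`|M| + 1)).+1 => x Ax j.
have : `|x| <= `|M| + 1 by apply: HM => //; rewrite (le_lt_trans (ler_norm M))// ltrDl.
move=> xM; apply: le_lt_trans (truncnS_gt _); apply: le_trans xM.
rewrite [leRHS]/Num.norm/= mx_normrE.
by apply/bigmax_geP; right => /=; exists (0, j).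
Qed.

End test_functions.

Section capacity.
Variables (R : realType) (n : nat) (i : 'I_n.+1).
Local Notation N := n.+1.
Local Notation lam := (@lebesgue_measure R).
Implicit Types (F omega : set 'rV[R]_N).

Definition proj F : set 'rV[R]_n := [set y | exists t, F (slice i y t)].

Definition cube m (M : R) : set 'rV[R]_m := cbox (const_mx (- M), const_mx M).

Lemma measurable_cube m M : measurable (@cube m M : set (bor R m)).
Proof. by apply: measurable_closed_bor; exact: closed_cbox. Qed.

Lemma cube_lty m M : (bleb R m (@cube m M) < +oo)%E.
Proof.
apply: (@le_lt_trans _ _ (bleb R m (box (const_mx (- M - 1), const_mx M)))); last first.
  by rewrite bleb_box ltry.
apply: le_measure; rewrite ?inE; [exact: measurable_cube|exact: measurable_bor_box|].
move=> x xM j; have := xM j; rewrite !mxE => /andP[h1 ->]; rewrite andbT; lra.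
Qed.

Lemma slice_cube (M : R) y t : cube M (slice i y t) <-> (- M <= t <= M) /\ cube M y.
Proof.
split => [h|[h1 h2] k].
  split; first by have := h i; rewrite slice_eq !mxE.
  by move=> j; have := h (lift i j); rewrite slice_lift !mxE.
by case: (unliftP i k) => [j ->|->]; rewrite ?slice_eq ?slice_lift ?mxE//; have := h2 j;
  rewrite !mxE.
Qed.

Lemma compact_proj F : compact F -> compact (proj F).
Proof.
move=> cF; rewrite (_ : proj F = (fun x => col' i x) @` F).
  apply: continuous_compact => //; apply: continuous_subspaceT => x.
  move=> A /nbhs_ballP[e /= e0 eA]; apply/nbhs_ballP; exists e => //= z [_ xz].
  by apply: eA; split => // k l; rewrite !mxE; exact: xz.
apply/seteqP; split => y /=.
  move=> [t Ft]; exists (slice i y t) => //; apply/rowP => j.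
  by rewrite mxE slice_lift.
by move=> [x Fx <-]; exists (x 0 i); rewrite -slice_surj.
Qed.

(** For an admissible phi, every line over the projection contributes at least 2 * M to the integral
    over the cube of |phi| + 2 * M * |dphi|. Fubini's theorem sums these contributions, and the L^p
    norms of phi and dphi, both below e, bound the total. *)
Lemma proj_bound p F (M e : R) : 1 <= p -> 0 < e -> 0 < M -> compact F -> F `<=` cube M ->
  (capacity_compact p F < e%:E)%E ->
  ((2 * M)%:E * bleb R n (proj F) <= e%:E * ((1 + 2 * M)%:E * (bleb R N (cube M) + 1)))%E.
Proof.
move=> p1 e0 M0 cF FM /ereal_inf_lt[_ [phi [[sphi _ _] phiF] <-] Ne].
have cphi := smooth_continuous sphi.
have cdphi := smooth_continuous_partial (i:=i) sphi.
set dphi := partial i phi in cdphi.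
have mproj : measurable (proj F : set (bor R n)).
  by apply: measurable_closed_bor; apply: compact_closed_rV; exact: compact_proj.
have mcube : measurable (cube M : set (lebesgue_space R N)).
  by apply: measurable_bor_leb; exact: measurable_cube.
have mphi : measurable_fun [set: lebesgue_space R N] phi.
  by apply: (measurableT_comp (continuous_bor cphi)); exact: measurable_rV_id.
have mdphi : measurable_fun [set: lebesgue_space R N] dphi.
  by apply: (measurableT_comp (continuous_bor cdphi)); exact: measurable_rV_id.
have LpT u : Lp_norm p setT u = ('N[leb R N]_(p%:E)[EFin \o u])%E.
  by rewrite /Lp_norm patch_setT.
have Lp_ge0 u : (0 <= Lp_norm p setT u)%E by exact: Lnorm_ge0.
have Nphi : ('N[leb R N]_(p%:E)[EFin \o phi] <= e%:E)%E.
  rewrite -LpT; apply: le_trans (ltW Ne); rewrite leeDl//.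
  by apply: sume_ge0 => j _.
have Ndphi : ('N[leb R N]_(p%:E)[EFin \o dphi] <= e%:E)%E.
  rewrite -LpT; apply: le_trans (ltW Ne); rewrite /sobolev_norm (bigD1 i)//=.
  rewrite addeA addeAC -[leLHS]add0e; apply: leeD => //.
  by rewrite adde_ge0//; apply: sume_ge0 => j _.
have Iphi := integral_norm_le_Lnorm p1 e0 mcube mphi Nphi.
have Idphi := integral_norm_le_Lnorm p1 e0 mcube mdphi Ndphi.
(* The weight 2 * M is the length of [-M, M], as in [interval_length_le]; the indicator cuts each
   line down to that segment. *)
pose h (x : bor R N) : \bar R := ((`|phi x| + 2 * M * `|dphi x|) * \1_(cube M) x)%:E.
have mh0 : measurable_fun [set: bor R N] (fun x : bor R N => `|phi x| + 2 * M * `|dphi x|).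
  apply: measurable_funD; first by apply: measurableT_comp => //; exact: continuous_bor.
  by apply: measurable_funM => //; apply: measurableT_comp => //; exact: continuous_bor.
have mh : measurable_fun [set: bor R N] h.
  apply/measurable_EFinP; apply: measurable_funM => //.
  by apply: measurable_indic; exact: measurable_cube.
have h0 x : (0 <= h x)%E.
  by rewrite lee_fin mulr_ge0// addr_ge0// mulr_ge0// mulr_ge0// ltW.
have L : ((2 * M)%:E * bleb R n (proj F) <= \int[bleb R N]_x h x)%E.
  rewrite (ge0_slice_integral i)//.
  rewrite -[X in bleb R n X]setIT -integral_indic//.
  rewrite -ge0_integralZl//; last 2 first.
  - by apply/measurable_EFinP; exact: measurable_indic.
  - by rewrite lee_fin mulr_ge0// ltW.
  apply: ge0_le_integral => //.
  - by move=> y _; rewrite -EFinM lee_fin !mulr_ge0// ltW.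
  - apply/measurable_EFinP; apply: measurable_funM => //; exact: measurable_indic.
  - apply: (@measurable_fun_fubini_tonelli_F _ _ _ _ _ lam (h \o @slicef R n i)) => //.
      by apply: measurableT_comp => //; exact: measurable_slicef.
    by move=> z; exact: h0.
  move=> y _; rewrite indicE; have [[t0 Ft0]|nF] := pselect (proj F y); last first.
    by rewrite memNset// mule0; apply: integral_ge0.
  rewrite mem_set; last by exists t0.
  rewrite mule1.
  have /slice_cube[t0M yM] := FM _ Ft0.
  have MM : - M < M by lra.
  have cdphiy : continuous (fun t => dphi (slice i y t)).
    by move=> t; apply: continuous_comp; [exact: slice_continuous|exact: cdphi].
  have := interval_length_le MM t0M (fun t => is_derive_slice i y t sphi) cdphiy (phiF _
    Ft0).
  have -> : M - - M = 2 * M by ring.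
  rewrite -lee_fin => /le_trans; apply.
  rewrite -EFin_Rintegral//; last first.
    apply: continuous_itv_integrable; apply: continuous_subspaceT => t.
    apply: cvgD; first by apply: cvg_norm;
      exact: (is_derive_continuous (fun t => is_derive_slice i y t sphi)).
    by apply: cvgMr; apply: cvg_norm; exact: cdphiy.
  rewrite integral_mkcond; apply: ge0_le_integral => //.
  - by move=> t _; rewrite patchE; case: ifP => // _;
    rewrite lee_fin addr_ge0// !mulr_ge0// ltW.
  - apply/(measurable_restrictT _ _).1 => //; apply/measurable_EFinP.
    apply: measurable_funTS; apply: (measurableT_comp mh0); exact: measurable_slice.
  - by apply: (measurableT_comp mh); exact: measurable_slice.
  - move=> t _; rewrite patchE; case: ifPn => [|_]; last exact: h0.
    by rewrite inE/= in_itv/= => tM; rewrite /h indicE mem_set ?mulr1//; apply/slice_cube.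
apply: (le_trans L).
rewrite -ge0_leb_integral//.
have -> : (\int[leb R N]_x h x =
    \int[leb R N]_(x in cube M) ((`|phi x|)%:E + (2 * M)%:E * `|dphi x|%:E))%E.
  rewrite [RHS]integral_mkcond; apply: eq_integral => x _.
  by rewrite /h patchE indicE; case: ifP => _; rewrite ?mulr1 ?mulr0.
have b0 : (0 <= leb R N (cube M))%E by exact: measure_ge0.
have boo : leb R N (cube M) \is a fin_num by rewrite ge0_fin_numE//; exact: cube_lty.
change (bleb R N (cube M)) with (leb R N (cube M)).
have [b b0' bE] : exists2 b : R, 0 <= b & leb R N (cube M) = b%:E.
  by exists (fine (leb R N (cube M))); [exact: fine_ge0|rewrite fineK].
have {}Iphi : (\int[leb R N]_(x in cube M) `|phi x|%:E <= (e * (b + 1))%:E)%E.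
  by rewrite EFinM EFinD -bE; exact: Iphi.
have {}Idphi : (\int[leb R N]_(x in cube M) `|dphi x|%:E <= (e * (b + 1))%:E)%E.
  by rewrite EFinM EFinD -bE; exact: Idphi.
rewrite bE -EFinD -!EFinM.
have M20 : 0 <= 2 * M by rewrite mulr_ge0// ltW.
rewrite (integral_normDZ (leb R N) M20 mcube mphi mdphi).
apply: (@le_trans _ _ ((e * (b + 1))%:E + (2 * M)%:E * (e * (b + 1))%:E)%E).
  by apply: leeD => //; apply: lee_wpmul2l => //.
by rewrite -EFinM -EFinD lee_fin le_eqVlt; apply/orP; left; apply/eqP; ring.
Qed.

Lemma proj_bigcup (F : nat -> set 'rV[R]_N) : proj (\bigcup_k F k) = \bigcup_k proj (F k).
Proof.
apply/seteqP; split => y; first by move=> [t [k _ Ft]]; exists k => //; exists t.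
by move=> [k _ [t Ft]]; exists t, k.
Qed.

(** The factor of e left when the inequality of [proj_bound] is divided by 2 * M. It depends on the
    cube but not on e, so projections become small with the capacity. *)
Definition cap_constant (M : R) : R :=
  (1 + 2 * M) * (fine (bleb R N (cube M)) + 1) / (2 * M).

(** The open set is exhausted by compact sets, whose projections are compact. This yields the
    measurability of the projection as well as the bound, by continuity of the measure from
    below. *)
Lemma proj_open_bound p omega (M e : R) : 1 <= p -> 0 < e -> 0 < M -> open omega ->
  (capacity_open p omega < e%:E)%E ->
  measurable (proj (omega `&` cube M) : set (bor R n)) /\
  (bleb R n (proj (omega `&` cube M)) <= (e * cap_constant M)%:E)%E.
Proof.
move=> p1 e0 M0 oo capo.
have [G [omegaE PG]] := @countable_bigcupE _ _ [set ab | cbox (rat_box R ab) `<=` omega]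
  (fun ab => cbox (rat_box R ab)) (@countableP _ _).
have {}omegaE : omega = \bigcup_k G k.
  rewrite -omegaE; apply/seteqP; split => x; last by move=> [ab /= abo]; exact: abo.
  move=> /(open_rat_box oo)[ab [abo xab]]; exists ab => // j.
  by have /andP[/ltW -> /ltW ->] := xab j.
have cG k : compact (G k).
  have [->|[ab _ ->]] := PG k; [exact: compact0|exact: compact_cbox].
(* Partial unions keep the sequence increasing. Each is a compact part of omega, so the supremum
   defining [capacity_open] bounds its capacity directly. *)
pose F k := (\big[setU/set0]_(j < k.+1) G j) `&` cube M.
have cF k : compact (F k).
  apply: compact_closedI; last exact: closed_cbox.
  by apply: (@big_ind _ (@compact _)) => [|A B|j _];
    [exact: compact0|exact: compactU|exact: cG].
have FE : omega `&` cube M = \bigcup_k F k.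
  by rewrite /F -setI_bigcupl bigcup_bigsetU_bigcup -omegaE.
have Fomega k : F k `<=` omega.
  by move=> x []; rewrite omegaE -bigcup_mkord => -[j _ Gx] _; exists j.
have mF k : measurable (proj (F k) : set (bor R n)).
  by apply: measurable_closed_bor; apply: compact_closed_rV; exact: compact_proj.
have mU : measurable (\bigcup_k proj (F k) : set (bor R n)) by exact: bigcupT_measurable.
rewrite FE proj_bigcup; split => //.
have ndF : nondecreasing_seq (fun k => proj (F k) : set (bor R n)).
  move=> k l kl; apply/subsetPset => y [t [GFt cMt]]; exists t; split => //.
  exact: (@subset_bigsetU _ G k.+1 l.+1 kl _ GFt).
have := nondecreasing_cvg_mu (mu := bleb R n) mF mU ndF => /cvg_lim <-//.
apply: lime_le; first by apply: ereal_nondecreasing_is_cvgn => k l kl; apply: le_measure;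
  rewrite ?inE//; exact/subsetPset/ndF.
apply: nearW => k /=.
have capF : (capacity_compact p (F k) < e%:E)%E.
  apply: le_lt_trans capo; apply: ereal_sup_ubound; exists (F k) => //.
have FM : F k `<=` cube M by apply: subIsetr.
have boo : bleb R N (cube M) \is a fin_num by rewrite ge0_fin_numE//; exact: cube_lty.
have := proj_bound p1 e0 M0 (cF k) FM capF.
rewrite -(fineK boo) -EFinD -!EFinM -lee_pdivlMl ?mulr_gt0// => /le_trans; apply.
by rewrite -EFinM lee_fin /cap_constant le_eqVlt; apply/orP; left; apply/eqP; field; lra.
Qed.

(** Almost every line has the following property: for each cube, some [omega m] misses the part of
    the line in that cube. Near any given parameter the line then runs in a set on which [u] is
    continuous. *)
Lemma quasicontinuous_ae_line p u : 1 <= p -> quasicontinuous p u ->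
  \forall y \ae bleb R n, continuous (fun t => u (slice i y t)).
Proof.
move=> p1 [_ qu].
have /choice[omega omegaP] (m : nat) : exists omega : set 'rV[R]_N, [/\ open omega,
    (capacity_open p omega < (m.+1%:R^-1)%:E)%E & {within ~` omega, continuous u}].
  by apply: qu; rewrite invr_gt0.
(* The index m may depend on M: a line is exceptional for a cube only if it meets every [omega m]
   there, and the projections, of measure at most a constant over m+1, have a null intersection. *)
have H (M : nat) : \forall y \ae bleb R n, exists m, forall t, ~ (omega m `&` cube M.+1%:R)
  (slice i y t).
  exists (\bigcap_m proj (omega m `&` cube M.+1%:R)).
  have mP m : measurable (proj (omega m `&` cube M.+1%:R) : set (bor R n)).
    have [oo capo _] := omegaP m.
    by have [] := @proj_open_bound p (omega m) M.+1%:R m.+1%:R^-1 p1 _ _ oo capo;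
      rewrite ?invr_gt0.
  split.
  - exact: bigcapT_measurable.
  - apply/eqP; rewrite -measure_le0; apply/lee_addgt0Pr => e e0; rewrite add0e.
    pose C := cap_constant M.+1%:R.
    have C0 : 0 < `|C| + 1 by rewrite ltr_pwDr.
    have [m me] : exists m : nat, m.+1%:R^-1 < e / (`|C| + 1).
      exists (Num.truncn (e / (`|C| + 1))^-1); rewrite invf_plt ?posrE ?divr_gt0//;
        exact: truncnS_gt.
    have [oo capo _] := omegaP m.
    have m0 : 0 < m.+1%:R^-1 :> R by rewrite invr_gt0.
    have [_ le1] := @proj_open_bound p (omega m) M.+1%:R m.+1%:R^-1 p1 m0 (ltr0Sn _ _) oo
      capo.
    apply: (@le_trans _ _ (bleb R n (proj (omega m `&` cube M.+1%:R)))).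
      by apply: le_measure; rewrite ?inE//; [exact: bigcapT_measurable|move=> y; apply].
    apply: (le_trans le1); rewrite lee_fin -/C.
    apply: (@le_trans _ _ (m.+1%:R^-1 * (`|C| + 1))).
      by rewrite ler_wpM2l ?(ltW m0)// (le_trans (ler_norm _))// lerDl.
    by rewrite -ler_pdivlMr// ltW.
  - move=> y /= ny m _; apply: contrapT => nP; apply: ny; exists m => t omt.
    by apply: nP; exists t.
have := ae_foralln H; apply: filterS => y Hy.
suff key (t : R) (A : set R) : nbhs (u (slice i y t)) A -> nbhs t [set s | A (u (slice i y
  s))].
  by move=> t A; exact: key.
have [M yM] : exists M : nat, - M.+1%:R < t < M.+1%:R /\ cube M.+1%:R y.
  have [M0 hM0] : exists M : nat, forall j, `|slice i y t 0 j| < M%:R.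
    have [M hM] := @compact_cbox_bound R n [set slice i y t] (@compact_set1 _ _).
    by exists M; exact: hM.
  have h j : `|slice i y t 0 j| < M0.+1%:R by rewrite (lt_trans (hM0 j))// ltr_nat.
  exists M0; split; first by have := h i; rewrite slice_eq ltr_norml.
  move=> j; have := h (lift i j); rewrite slice_lift ltr_norml !mxE.
  by move=> /andP[/ltW -> /ltW ->].
move: yM => [tM yM]; have [m hm] := Hy M; have [oo _ /subspace_continuousP cu] := omegaP m.
have nomega s : - M.+1%:R < s < M.+1%:R -> (~` omega m) (slice i y s).
  by move=> /andP[/ltW s1 /ltW s2] os; apply: (hm s); split => //; apply/slice_cube;
    rewrite s1 s2.
(* [cu] gives continuity only within the complement of [omega m]; an open segment around t lies in
   that complement, which turns it into continuity along the line. *)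
have nbt : nbhs t [set s | - M.+1%:R < s < M.+1%:R].
  have : nbhs t `]-M.+1%:R, M.+1%:R[%classic.
    by apply: open_nbhs_nbhs; split; [exact: interval_open|rewrite /= in_itv].
  by apply: filterS => s; rewrite /= in_itv.
move=> /(cu _ (nomega _ tM)) h0.
have h : nbhs t [set s | ~ omega m (slice i y s) -> A (u (slice i y s))] :=
  @slice_continuous R n i y t _ h0.
move: h => /nbhs_ballP[d /= d0 dA]; move: nbt => /nbhs_ballP[d' /= d'0 d'M].
apply/nbhs_ballP; exists (Num.min d d') => /= [|s ts]; first by rewrite lt_min d0.
by apply: dA; [|apply: nomega; apply: d'M]; apply: le_ball ts; rewrite ge_min lexx ?orbT.
Qed.

End capacity.

(** * Weak derivatives on almost every line *)

Section tensor.
Variables (R : realType) (n : nat).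
Local Notation N := n.+1.
Implicit Types (phi : 'rV[R]_N -> R) (i : 'I_N) (beta : 'I_N -> R -> R).

Lemma is_derive_coord phi i (x : 'rV[R]_N) (d : R) :
  is_derive (x 0 i) 1 (fun t => phi (slice i (col' i x) t)) d ->
  is_derive x (delta_mx 0 i) phi d.
Proof.
have E : (fun h : R => h^-1 *: (((fun t => phi (slice i (col' i x) t)) \o shift (x 0 i)) (h
  *: 1) -
    phi (slice i (col' i x) (x 0 i)))) =
  (fun h : R => h^-1 *: ((phi \o shift x) (h *: delta_mx 0 i) - phi x)).
  by apply/funext => h; rewrite /= [h *: 1]mulr1 sliceD -slice_surj.
move=> [d1 d2]; apply: DeriveDef; first by rewrite /derivable -E.
by rewrite /derive -E.
Qed.

(** Products of one-variable bumps supply all the explicit test functions that are used on the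
    space. *)
Definition tensor beta (x : 'rV[R]_N) : R := \prod_j beta j (x 0 j).

Lemma tensor_slice beta i (y : 'rV[R]_n) t : tensor beta (slice i y t) =
  beta i t * \prod_j beta (lift i j) (y 0 j).
Proof.
rewrite /tensor (bigD1_ord i)//= slice_eq; congr (_ * _).
by apply: eq_bigr => j _; rewrite slice_lift.
Qed.

Lemma is_derive_tensor beta i (b' : R -> R) (x : 'rV[R]_N) :
  (forall t : R, is_derive t 1 (beta i) (b' t)) ->
  is_derive x (delta_mx 0 i) (tensor beta)
    (tensor (fun j => if j == i then b' else beta j) x).
Proof.
move=> db; apply: is_derive_coord.
rewrite [X in tensor _ X](slice_surj i x) tensor_slice eqxx.
set c := \prod_j _.
have -> : (fun t => tensor beta (slice i (col' i x) t)) = (fun t => c * beta i t).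
  apply/funext => t; rewrite tensor_slice mulrC; congr (_ * _).
  by apply: eq_bigr => j _; rewrite eq_sym (negPf (neq_lift _ _)).
by rewrite mulrC; exact: is_deriveZ.
Qed.

Lemma continuous_tensor beta : (forall j, continuous (beta j)) -> continuous (tensor beta).
Proof.
move=> cb; rewrite /tensor.
suff H (r : seq 'I_N) : continuous (fun x : 'rV[R]_N => \prod_(j <- r) beta j (x 0 j)) by
  exact: H.
elim: r => [|j r IH] x.
  rewrite (_ : (fun _ => _) = cst 1); first exact: cst_continuous.
  by apply/funext => z; rewrite big_nil.
rewrite (_ : (fun _ => _) = (fun z : 'rV[R]_N => beta j (z 0 j) * \prod_(k <- r) beta k (z
  0 k))); last first.
  by apply/funext => z; rewrite big_cons.
have h1 : {for x, continuous (fun z : 'rV[R]_N => beta j (z 0 j))}.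
  by apply: continuous_comp; [exact: coord_continuous|exact: cb].
exact: (continuousM h1 (IH x)).
Qed.

(** A partial derivative only replaces one factor by its derivative, which is again [bumpy]; hence
    every iterated partial derivative is a tensor of the same kind. *)
Lemma smooth_tensor beta : (forall j, bumpy (beta j)) -> smooth (tensor beta).
Proof.
move=> bb s.
have [beta' bb' ->] : exists2 beta', (forall j, bumpy (beta' j)) &
    foldr (@partial R n) (tensor beta) s = tensor beta'.
  elim: s => [|i s [b' bb' /= ->]]; first by exists beta.
  have [f' bf' df'] := bumpy_derive (bb' i).
  exists (fun j => if j == i then f' else b' j); first by move=> j; case: ifP.
  by apply/funext => x; have [_ <-] := is_derive_tensor x df'.
split; first by apply: continuous_tensor => j; exact: continuous_bumpy.
move=> i x; have [f' _ df'] := bumpy_derive (bb' i).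
by have [] := is_derive_tensor x df'.
Qed.

Lemma test_function_tensor (Omega : set 'rV[R]_N) beta (a b : 'rV[R]_N) :
  (forall j, bumpy (beta j)) ->
  (forall j t, ~~ (a 0 j < t < b 0 j) -> beta j t = 0) ->
  cbox (a, b) `<=` Omega -> test_function Omega (tensor beta).
Proof.
move=> bb b0 abO.
have sub : closure [set x | tensor beta x != 0] `<=` cbox (a, b).
  rewrite [X in _ `<=` X](closure_id _).1; last exact: closed_cbox.
  apply: closure_subset => x /= tx j /=.
  have [/andP[/ltW -> /ltW ->]//|nj] := boolP (a 0 j < x 0 j < b 0 j).
  by move: tx; rewrite /tensor (bigD1 j)//= b0// mul0r eqxx.
split; first exact: smooth_tensor.
- by apply: subclosed_compact sub; [exact: closed_closure|exact: compact_cbox].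
- exact: subset_trans abO.
Qed.

End tensor.

Section integrable_products.
Variables (R : realType) (n : nat).

Lemma integrable_mul_bounded (u psi : bor R n -> R) (D : set (bor R n)) (C : R) :
  measurable D -> (bleb R n).-integrable D (EFin \o u) ->
  measurable_fun setT psi -> (forall x, `|psi x| <= C) -> (forall x, ~ D x -> psi x = 0) ->
  (bleb R n).-integrable setT (EFin \o (fun x => u x * psi x)).
Proof.
move=> mD ui mpsi psiC psi0.
have : (bleb R n).-integrable D (EFin \o (fun x => u x * psi x)).
  apply: (@integrableMl _ _ _ (bleb R n) D mD (EFin \o u) psi ui).
    exact: measurable_funTS.
  exists C; split; first exact: num_real.
  by move=> x Cx y _; apply: le_trans (ltW Cx); exact: psiC.
rewrite (integrable_mkcond _ mD); congr (integrable _ _ _).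
apply/funext => x; rewrite patchE; case: ifPn => // /negP xD.
by rewrite /= psi0 ?mulr0// => Dx; apply: xD; exact/mem_set.
Qed.

End integrable_products.

Section vanishing.
Variables (R : realType) (n : nat).

(** The sets over which [h] integrates to 0 form a Dynkin system; it contains the pi-system of
    boxes, hence all Borel sets. *)
Lemma ae_eq0_boxes (h : bor R n -> \bar R) (ab : 'rV[R]_n * 'rV[R]_n) :
  (bleb R n).-integrable setT h -> (forall y, ~ box ab y -> h y = 0%E) ->
  (forall cd, (\int[bleb R n]_(y in box cd) h y = 0)%E) ->
  \forall y \ae bleb R n, h y = 0%E.
Proof.
move=> hi h0 hb.
have hS (E : set (bor R n)) : measurable E -> (bleb R n).-integrable E h.
  by move=> mE; apply: integrableS hi.
(* Stability under complements needs the total integral to vanish; it equals the integral over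
   [box ab], outside of which [h] is 0. *)
have HT : (\int[bleb R n]_(y in setT) h y = 0)%E.
  rewrite -[RHS](hb ab) [RHS]integral_mkcond; apply: eq_integral => y _.
  by rewrite patchE; case: ifPn => // /negP yab; rewrite h0// => ?; apply: yab;
    exact/mem_set.
have H (E : set (bor R n)) : measurable E -> (\int[bleb R n]_(y in E) h y = 0)%E.
  apply: (@dynkin_induction _ (bor R n) (range (@box R n)) (fun E => \int[bleb R n]_(y in
    E) h y = 0)%E) => //.
  - exact: setI_closed_box.
  - by move=> _ [cd _ <-]; exact: hb.
  - move=> S mS HS; have := HT; rewrite -(setUv S) integral_setU//; last 3 first.
    - exact: measurableC.
    - by rewrite setUv; exact: measurable_int hi.
    - by rewrite /disj_set setICr.
    by rewrite HS add0e.
  - move=> F mF tF HF; rewrite integral_bigcup//; last first.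
      by apply: hS; exact: bigcupT_measurable.
    by rewrite eseries0.
have := @integral_ae_eq _ _ _ (bleb R n) setT measurableT (cst 0%E) h hi.
move=> /(_ (measurable_cst _)) ae.
have {}ae := ae _; apply: filterS (ae _) => [y /(_ Logic.I)//|E _ mE].
by rewrite H// integral0.
Qed.

End vanishing.

Lemma cvg_prod (R : realType) (I : finType) (f : nat -> I -> R) (l : I -> R) :
  (forall j, f m j @[m --> \oo] --> l j) -> \prod_j f m j @[m --> \oo] --> \prod_j l j.
Proof.
move=> fl; suff H (r : seq I) : \prod_(j <- r) f m j @[m --> \oo] --> \prod_(j <- r) l j by
  exact: H.
elim: r => [|j r IH].
  by rewrite (_ : (fun m => _) = cst 1) ?big_nil; [exact: cvg_cst|apply/funext => m;
    rewrite big_nil].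
rewrite (_ : (fun m => _) = (fun m => f m j * \prod_(k <- r) f m k)) ?big_cons;
  first exact: cvgM.
by apply/funext => m; rewrite big_cons.
Qed.

Section weak_derivative_on_lines.
Variables (R : realType) (n : nat) (i : 'I_n.+1).
Local Notation N := n.+1.
Local Notation lam := (@lebesgue_measure R).

Lemma measurable_col' : measurable_fun [set: bor R N] (col' i : bor R N -> bor R n).
Proof.
apply: (@measurability _ _ _ (bor R n) _ _ (range (@box R n))) => //.
move=> _ [_ [[a b] _ <-] <-]; rewrite setTI.
rewrite (_ : _ @^-1` _ = \bigcup_k box (slice i a (- k%:R), slice i b k%:R)).
  by apply: bigcupT_measurable => k; exact: measurable_bor_box.
have colE c (y : 'rV[R]_n) : col' i (slice i y c) = y.
  by apply/rowP => j; rewrite mxE slice_lift.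
apply/seteqP; split => x /=.
  move=> xab; exists (Num.truncn `|x 0 i|).+1 => //.
  rewrite [X in box _ X](slice_surj i x); apply/slice_box; rewrite !slice_eq !colE;
    split => //.
  have := truncnS_gt `|x 0 i|; rewrite ltr_norml => /andP[-> /ltW].
  by [].
by move=> [k _]; rewrite [X in box _ X](slice_surj i x) => /slice_box[_]; rewrite !colE.
Qed.

Variables (K : set 'rV[R]_N) (u g : bor R N -> R).
Hypotheses (cK : compact K)
  (ui : forall M : R, (bleb R N).-integrable (cube M) (EFin \o u))
  (gi : forall M : R, (bleb R N).-integrable (cube M) (EFin \o g))
  (weak : forall phi, test_function (~` K) phi ->
    \int[bleb R N]_x (u x * partial i phi x + g x * phi x) = 0).

(** The integrand of the weak derivative identity for a bump in the i-th coordinate alone. As that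
    bump has no compact support in the space, cutoffs in the other coordinates are needed to test
    with it. *)
Definition bump_pairing (c a b : R) (x : bor R N) : R :=
  u x * dbump c a b (x 0 i) + g x * bump c a b (x 0 i).

(** Multiplying the bump by sharpening bumps in the other coordinates gives test functions off [K].
    In the limit, by dominated convergence, the line integral of the pairing integrates to 0 over
    every box of base points, so it vanishes almost everywhere. *)
Lemma bump_pairing_ae (k : nat) (a b : R) (ab : 'rV[R]_n * 'rV[R]_n) :
  cbox (slice i ab.1 a, slice i ab.2 b) `<=` ~` K ->
  \forall y \ae bleb R n, box ab y ->
    \int[lam]_(t in `[a, b]) bump_pairing k.+1%:R^-1 a b (slice i y t) = 0.
Proof.
move=> abK; set c := k.+1%:R^-1.
have c0 : 0 < c by rewrite invr_gt0.
pose Q := cbox (slice i ab.1 a, slice i ab.2 b).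
have [M QM] : exists M : nat, Q `<=` cube M%:R.
  have [M hM] := compact_cbox_bound (@compact_cbox R N (slice i ab.1 a, slice i ab.2 b)).
  by exists M => x /hM xM j; rewrite !mxE; have := xM j;
    rewrite ltr_norml => /andP[/ltW -> /ltW ->].
have mM : measurable (cube M%:R : set (bor R N)) by exact: measurable_cube.
have cd : continuous (dbump c a b) by exact: continuous_dbump.
have cb : continuous (bump c a b) by apply: continuous_bumpy; exact: bumpy_bump.
have [Cd Cd0 dC] := within_bounded (continuous_subspaceT cd : {within `[a, b], continuous
  (dbump c a b)}).
have dbnd t : `|dbump c a b t| <= Cd.
  have [tab|tab] := boolP (a < t < b); last by rewrite dbump_out// normr0.
  by apply: dC; move: tab => /andP[/ltW -> /ltW ->].
have bbnd t : `|bump c a b t| <= 1 by rewrite ger0_norm ?bump_ge0 ?bump_le1.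
have prodI (chi : bor R n -> R) : measurable_fun setT chi ->
    (forall y, `|chi y| <= 1) -> (forall y, ~ cbox ab y -> chi y = 0) ->
    (bleb R N).-integrable setT (EFin \o (fun x => bump_pairing c a b x * chi (col' i x))).
  move=> mchi chi1 chi0.
  have mchi' : measurable_fun [set: bor R N] (fun x : bor R N => chi (col' i x)).
    exact: (measurableT_comp mchi measurable_col').
  have out (x : bor R N) (f : R -> R) : (forall t, ~~ (a < t < b) -> f t = 0) ->
      ~ cube M%:R x -> f (x 0 i) * chi (col' i x) = 0.
    move=> f0 xM; have [xab|/f0->] := boolP (a < x 0 i < b); last by rewrite mul0r.
    have [xc|/chi0->] := pselect (cbox ab (col' i x)); last by rewrite mulr0.
    exfalso; apply: xM; apply: QM => j /=.
    case: (unliftP i j) => [l ->|->]; rewrite ?slice_eq ?slice_lift.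
      by have := xc l; rewrite mxE.
    by move: xab => /andP[/ltW -> /ltW ->].
  have I1 := @integrable_mul_bounded R N u (fun x => dbump c a b (x 0 i) * chi (col' i x))
    (cube M%:R) Cd mM (ui _).
  have I2 := @integrable_mul_bounded R N g (fun x => bump c a b (x 0 i) * chi (col' i x))
    (cube M%:R) 1 mM (gi _).
  have mxi f : continuous f -> measurable_fun [set: bor R N] (fun x : bor R N => f (x 0 i)
    : R).
    by move=> cf; apply: continuous_bor => x; apply: continuous_comp;
      [exact: coord_continuous|exact: cf].
  have {}I1 : (bleb R N).-integrable setT (EFin \o (fun x => u x * (dbump c a b (x 0 i) *
    chi (col' i x)))).
    apply: I1.
    - by apply: measurable_funM => //; exact: mxi.
    - by move=> x; rewrite normrM -[leRHS]mulr1 ler_pM.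
    - by move=> x; apply: out; exact: dbump_out.
  have {}I2 : (bleb R N).-integrable setT (EFin \o (fun x => g x * (bump c a b (x 0 i) *
    chi (col' i x)))).
    apply: I2.
    - by apply: measurable_funM => //; exact: mxi.
    - by move=> x; rewrite normrM -[leRHS]mulr1 ler_pM.
    - by move=> x; apply: out; exact: bump_out.
  have := integrableD measurableT I1 I2; congr (integrable _ _ _).
  by apply/funext => x; rewrite /= -EFinD /bump_pairing mulrDl !mulrA.
pose chi ab' : bor R n -> R := \1_(box ab').
have mchi ab' : measurable_fun [set: bor R n] (chi ab').
  by apply: measurable_indic; exact: measurable_bor_box.
have chi1 ab' y : `|chi ab' y| <= 1.
  by rewrite /chi indicE; case: (_ \in _); rewrite ?normr0 ?normr1.
have chi0 ab' : box ab' `<=` cbox ab -> forall y, ~ cbox ab y -> chi ab' y = 0.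
  by move=> sub y ny; rewrite /chi indicE memNset// => /sub.
have box_cbox (ab' : 'rV[R]_n * 'rV[R]_n) : box ab' `<=` cbox ab'.
  by move=> y yab j; have /andP[/ltW -> ->] := yab j.
(* [ae_eq0_boxes] asks for all boxes, but only those inside [cbox ab] carry test functions supported
   off [K]. Intersecting with [box ab] loses nothing, the integrand being cut off there. *)
have sub_box cd' : exists2 ef, box cd' `&` box ab = box ef & cbox ef `<=` cbox ab.
  move: ab cd' {abK Q QM prodI chi chi1 chi0 mchi} => [a1 b1] [c1 d1].
  rewrite box_setI; eexists; first reflexivity.
  move=> y yef j; have := yef j; rewrite /= !mxE ge_max le_min.
  by move=> /andP[/andP[_ ->] /andP[_ ->]].
have key ef : cbox ef `<=` cbox ab ->
    (\int[bleb R N]_x (bump_pairing c a b x * chi ef (col' i x))%:E = 0)%E.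
  move=> efab; move: ef efab => [e f] efab.
  (* The bump in direction i keeps its parameter c; only the bumps in the other coordinates sharpen
     as m grows. *)
  pose beta (m : nat) (j : 'I_N) : R -> R :=
    if unlift i j is Some l then bump m.+1%:R^-1 (e 0 l) (f 0 l) else bump c a b.
  pose P (m : nat) (y : 'rV[R]_n) := \prod_l bump m.+1%:R^-1 (e 0 l) (f 0 l) (y 0 l).
  have bbeta m j : bumpy (beta m j).
    by rewrite /beta; case: unliftP => [l _|_]; apply: bumpy_bump => //; rewrite invr_gt0.
  have tE m x : tensor (beta m) x = bump c a b (x 0 i) * P m (col' i x).
    rewrite [X in tensor _ X](slice_surj i x) tensor_slice /beta unlift_none; congr (_ * _).
    by apply: eq_bigr => l _; rewrite liftK.
  have pE m x : partial i (tensor (beta m)) x = dbump c a b (x 0 i) * P m (col' i x).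
    have db (t : R) : is_derive t 1 (beta m i) (dbump c a b t).
      by rewrite /beta unlift_none; exact: is_derive_bump.
    have [_ dE] := is_derive_tensor x db; rewrite /partial dE.
    rewrite [X in tensor _ X](slice_surj i x) tensor_slice eqxx; congr (_ * _).
    apply: eq_bigr => l _; rewrite eq_sym (negPf (neq_lift _ _)) /beta liftK.
    by rewrite mxE.
  have P01 m y : 0 <= P m y <= 1.
    rewrite /P prodr_ge0 ?prodr_ile1//= => l _; rewrite ?bump_ge0//.
    by rewrite bump_le1// invr_gt0.
  have Pout m y : ~ cbox ab y -> P m y = 0.
    move=> ny; have [l nl] : exists l, ~~ (e 0 l < y 0 l < f 0 l).
      apply: contrapT => nl; apply/ny/efab => l.
      have [/andP[/ltW -> /ltW ->]//|h] := boolP (e 0 l < y 0 l < f 0 l).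
      by exfalso; apply: nl; exists l.
    by rewrite /P (bigD1 l)//= bump_out// mul0r.
  have test m : test_function (~` K) (tensor (beta m)).
    apply: (@test_function_tensor _ _ _ _ (slice i e a) (slice i f b)) => //.
    - move=> j t; rewrite /beta; case: unliftP => [l ->|->]; rewrite ?slice_eq ?slice_lift;
      exact: bump_out.
    - apply: subset_trans abK => x xef.
      have : cbox ab (col' i x).
        by apply: efab => l; have := xef (lift i l); rewrite /= !slice_lift mxE.
      move=> xab j; case: (unliftP i j) => [l ->|->]; rewrite /= ?slice_eq ?slice_lift.
        by have := xab l; rewrite mxE.
      by have := xef i; rewrite /= !slice_eq.
  have mP m : measurable_fun [set: bor R n] (P m : bor R n -> R).
    have -> : P m = (fun y => \prod_l bump m.+1%:R^-1 (e 0 l) (f 0 l) (y 0 l)) by [].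
    apply: measurable_prod => l _.
    apply: continuous_bor => y; apply: continuous_comp; first exact: coord_continuous.
    by apply: continuous_bumpy; apply: bumpy_bump; rewrite invr_gt0.
  have Pn1 m y : `|P m y| <= 1 by have /andP[P0 P1] := P01 m y; rewrite ger0_norm.
  have I0 m : (\int[bleb R N]_x (bump_pairing c a b x * P m (col' i x))%:E = 0)%E.
    have := weak (test m); rewrite /Rintegral.
    have -> : (fun x => (u x * partial i (tensor (beta m)) x + g x * tensor (beta m) x)%:E)
      =
        (fun x => (bump_pairing c a b x * P m (col' i x))%:E).
      by apply/funext => x; rewrite tE pE /bump_pairing; congr EFin; ring.
    move=> h0; rewrite -[LHS]fineK; first by rewrite h0.
    by apply: integrable_fin_num => //; apply: prodI => //; exact: Pout.
  (* The bumps tend to 0 on the upper faces, which belong to the half-open box; these faces lie in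
     null hyperplanes. *)
  have nullH l : \forall x \ae bleb R N, (x : bor R N) 0 (lift i l) != f 0 l.
    exists [set x : bor R N | x 0 (lift i l) = f 0 l]; split.
    - have := @measurable_bor_coord R N (lift i l) measurableT [set f 0 l] (measurable_set1
      _).
      by rewrite setTI.
    - exact: hyperplane_null.
    - by move=> x /= /negP; rewrite negbK => /eqP.
  have mcb : measurable (cbox ab : set (bor R n)) by apply: measurable_closed_bor;
    exact: closed_cbox.
  have dom : (bleb R N).-integrable setT
      (EFin \o (fun x => bump_pairing c a b x * \1_(cbox ab) (col' i x))).
    apply: prodI; first exact: measurable_indic.
    - by move=> y; rewrite indicE; case: (_ \in _); rewrite ?normr0 ?normr1.
    - by move=> y ny; rewrite indicE memNset.
  have [] := @dominated_convergence _ _ _ (bleb R N) setT measurableT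
     (fun m x => (bump_pairing c a b x * P m (col' i x))%:E)
     (fun x => (bump_pairing c a b x * chi (e, f) (col' i x))%:E)
     (fun x => `|(bump_pairing c a b x * \1_(cbox ab) (col' i x))%:E|%E).
  - by move=> m; apply: measurable_int (prodI _ (mP m) (Pn1 m) (Pout m)).
  - apply: measurable_int (prodI _ (mchi (e, f)) (chi1 (e, f)) (chi0 _ _)).
    exact: subset_trans (box_cbox _) efab.
  - have := @ae_forall_countable _ _ _ (bleb R N) _ setT _ (@countableP _ setT) (fun l _ =>
    nullH l).
    apply: filterS => x xf _; apply: cvg_EFin; first exact: nearW.
    rewrite /=; apply: cvgM; first exact: cvg_cst.
    have -> : chi (e, f) (col' i x) = \prod_l (\1_`]e 0 l, f 0 l[%classic (col' i x 0 l) :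
      R).
      rewrite /chi indicE; have [xef|xef] := pselect (box (e, f) (col' i x)).
        rewrite mem_set// big1// => l _; rewrite indicE mem_set//= in_itv/=.
        have /= /andP[-> h] := xef l; rewrite lt_neqAle h andbT.
        by rewrite mxE; exact: xf.
      have [l nl] : exists l, ~~ (e 0 l < col' i x 0 l <= f 0 l).
        apply: contrapT => nl; apply: xef => l; apply/negPn/negP => h.
        by apply: nl; exists l.
      rewrite memNset// (bigD1 l)//= indicE memNset ?mul0r//= in_itv/=.
      by apply/negP; apply: contra nl => /andP[-> /ltW ->].
    apply: cvg_prod => l; exact: bump_cvg.
  - exact: integrable_abse dom.
  - apply: aeW => x m _; rewrite lee_fin !normrM ler_wpM2l//.
    have [xab|xab] := pselect (cbox ab (col' i x)); last by rewrite Pout// normr0.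
    by rewrite indicE mem_set// normr1.
  move=> _ _; rewrite (_ : (fun m => _) = cst 0%E); last by apply/funext => m; exact: I0.
  move=> /(cvg_unique _ (cvg_cst _)) h; apply/esym/h; exact: ereal_hausdorff.
pose F (x : bor R N) : \bar R := (bump_pairing c a b x * chi ab (col' i x))%:E.
have FI : (bleb R N).-integrable setT F.
  by apply: prodI => //; apply: chi0; exact: box_cbox.
have colE t y : col' i (slice i y t) = y.
  by apply/rowP => j; rewrite mxE slice_lift.
pose h (y : bor R n) : \bar R := (\int[lam]_t F (slice i y t))%E.
have hI : (bleb R n).-integrable setT h := integrable_fubini_F (slice_integrable i FI).
have hout y : ~ box ab y -> h y = 0%E.
  move=> ny; rewrite /h; apply: integral0_eq => t _.
  by rewrite /F colE /chi indicE memNset// mulr0.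
have hbox cd' : (\int[bleb R n]_(y in box cd') h y = 0)%E.
  have [ef efE efab] := sub_box cd'.
  rewrite -[RHS](key ef efab) (slice_integral i); last first.
    apply: prodI => //; apply: chi0; exact: subset_trans (box_cbox _) efab.
  rewrite [LHS]integral_mkcond; apply: eq_integral => y _.
  rewrite patchE /h; case: ifPn => [/set_mem ycd|/negP ycd].
    apply: eq_integral => t _; rewrite /F !colE /chi !indicE -efE in_setI.
    by rewrite (mem_set ycd).
  rewrite integral0_eq// => t _; rewrite colE /chi indicE -efE in_setI.
  by rewrite (negbTE (introN idP ycd)) mulr0.
have := ae_eq0_boxes hI hout hbox; apply: filterS => y hy yab.
rewrite /Rintegral -[RHS]/(fine 0%E) -hy /h [in LHS]integral_mkcond; congr fine.
apply: eq_integral => t _; rewrite /F colE /chi indicE mem_set// mulr1 patchE.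
case: ifPn => // /negP tab;
  rewrite /bump_pairing slice_eq dbump_out ?bump_out ?mulr0 ?addr0//.
  by apply/negP => /andP[/ltW at_ /ltW tb]; apply: tab; rewrite inE/= in_itv/= at_.
by apply/negP => /andP[/ltW at_ /ltW tb]; apply: tab; rewrite inE/= in_itv/= at_.
Qed.

(** [bump_pairing_ae] is applied for all rational intervals, all k and all rational boxes of base
    points: countably many null sets. Whether a segment avoids [K] depends on y, and the boxes make
    this condition locally uniform in y. *)
Lemma ae_line_weak_derivative : \forall y \ae bleb R n, forall q r : rat,
  (forall t, ratr q <= t <= ratr r -> ~ K (slice i y t)) -> forall k,
  \int[lam]_(t in `[ratr q, ratr r]) bump_pairing k.+1%:R^-1 (ratr q) (ratr r) (slice i y
    t) = 0.
Proof.
have H := @ae_forall_countable _ _ _ (bleb R n) _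
  [set z : (rat * rat) * nat * ('rV[rat]_n * 'rV[rat]_n) |
    cbox (slice i (rat_box R z.2).1 (ratr z.1.1.1), slice i (rat_box R z.2).2 (ratr
      z.1.1.2)) `<=` ~` K]
  (fun z y => box (rat_box R z.2) y ->
    \int[lam]_(t in `[ratr z.1.1.1, ratr z.1.1.2])
      bump_pairing z.1.2.+1%:R^-1 (ratr z.1.1.1) (ratr z.1.1.2) (slice i y t) = 0)
  (@countableP _ _).
have {}H := H _; apply: filterS (H _) => [y Hy q r qrK k|z zK]; last exact: bump_pairing_ae.
pose S := [set x : 'rV[R]_N | ratr q <= x 0 i <= ratr r].
have cS : closed S.
  have -> : S = (fun x : 'rV[R]_N => x 0 i) @^-1` `[ratr q, ratr r]%classic.
    by apply/seteqP; split => x; rewrite /S /= in_itv.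
  by apply: closed_comp => [x _|]; [exact: coord_continuous|exact: interval_closed].
(* Base points whose segment over [q, r] meets [K] form a compact set, so a rational box around y
   stays clear of it. *)
have cP : closed (proj i (K `&` S)).
  by apply: compact_closed_rV; apply: compact_proj; exact: compact_closedI.
have ny : (~` proj i (K `&` S)) y.
  by move=> [t [Kt St]]; apply: (qrK t) => //; move: St; rewrite /S /= slice_eq.
have [ab [abK yab]] := open_rat_box (closed_openC cP) ny.
apply: (Hy ((q, r), k, ab)) => /=.
  move=> x xab Kx; apply: (abK (col' i x)).
    by move=> l; have := xab (lift i l); rewrite /= !slice_lift [col' i x 0 l]mxE.
  exists (x 0 i); rewrite -slice_surj; split => //.
  by have := xab i; rewrite /= !slice_eq.
by move=> l; have /andP[-> /ltW ->] := yab l.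
Qed.

End weak_derivative_on_lines.

(** * Reduction to lines *)

Section off_null_sets.
Context d (T : measurableType d) (R : realType) (mu : {measure set T -> \bar R}).

Lemma ae_off_null (Z : set T) (P : T -> Prop) : measurable Z -> mu Z = 0%E ->
  (forall x, ~ Z x -> P x) -> \forall x \ae mu, P x.
Proof.
by move=> mZ Z0 ZP; exists Z; split => // x /= nP; apply: contrapT => /ZP.
Qed.

Lemma Lnorm_le_off_null (p : R) (f g : T -> R) (Z : set T) : 1 <= p ->
  measurable_fun setT f -> measurable_fun setT g -> measurable Z -> mu Z = 0%E ->
  (forall x, ~ Z x -> `|f x| <= `|g x|) ->
  ('N[mu]_(p%:E)[EFin \o f] <= 'N[mu]_(p%:E)[EFin \o g])%E.
Proof.
move=> p1 mf mg mZ Z0 fg; have p0 : 0 <= p by exact: le_trans ler01 p1.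
have mp (h : T -> R) : measurable_fun setT h ->
    measurable_fun [set: T] (fun x => (`|(h x)%:E| `^ p)%E).
  move=> mh; rewrite (_ : (fun _ => _) = EFin \o (fun x => `|h x| `^ p)).
    apply/measurable_EFinP.
    apply: (@measurableT_comp _ _ _ _ _ _ (fun x : R => x `^ p) _ (fun x => `|h x|)) => //.
    by apply: measurableT_comp.
  by apply/funext => x; rewrite /= -poweR_EFin.
rewrite unlock /Lnorm; apply: gt0_ler_poweR.
- by rewrite invr_ge0.
- by rewrite in_itv/= leey andbT; apply: integral_ge0 => x _; rewrite lee_fin powR_ge0.
- by rewrite in_itv/= leey andbT; apply: integral_ge0 => x _; rewrite lee_fin powR_ge0.
apply: ae_ge0_le_integral => //.
- by move=> x _; exact: poweR_ge0.
- exact: (mp _ mf).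
- by move=> x _; exact: poweR_ge0.
- exact: (mp _ mg).
apply: (ae_off_null mZ Z0) => x Zx _ /=.
by rewrite -!poweR_EFin lee_fin ge0_ler_powR// fg.
Qed.

Lemma measure_nonzero_of_integral (h : T -> \bar R) : measurable_fun setT h ->
  (\int[mu]_x h x <> 0)%E ->
  measurable [set x | h x <> 0%E] /\ mu [set x | h x <> 0%E] <> 0%E.
Proof.
move=> mh hn0; have mS : measurable [set x | h x <> 0%E].
  have := mh measurableT (~` [set 0%E]) (measurableC (emeasurable_set1 0%E)).
  by rewrite setTI.
split=> // S0; apply: hn0.
rewrite (ae_eq_integral (cst 0%E)) ?integral0//.
by apply: (ae_off_null mS S0) => x /= hx _; apply: contrapT.
Qed.

End off_null_sets.

Section reduction_to_borel.
Variables (R : realType) (n : nat).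
Local Notation space := (lebesgue_space R n).

Lemma measurable_fun_bor_leb (f : bor R n -> R) : measurable_fun [set: bor R n] f ->
  measurable_fun [set: space] (f : space -> R).
Proof. by move=> mf; exact: (measurableT_comp mf (@measurable_rV_id R n)). Qed.

Lemma integrable_bor_leb (f : bor R n -> R) : measurable_fun [set: bor R n] f ->
  (bleb R n).-integrable setT (EFin \o f) ->
  (leb R n).-integrable [set: space] (EFin \o f).
Proof.
move=> mf /integrableP[_ fi]; apply/integrableP; split.
  by apply/measurable_EFinP; exact: measurable_fun_bor_leb.
rewrite (@ge0_leb_integral R n (fun x => `|(f x)%:E|%E))//.
by apply/measurable_EFinP; exact: measurableT_comp.
Qed.

Lemma integrable_cube (p M : R) (f : bor R n -> R) : 1 <= p ->
  measurable_fun [set: bor R n] f -> ('N[leb R n]_(p%:E)[EFin \o f] < +oo)%E ->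
  (bleb R n).-integrable (cube M) (EFin \o f).
Proof.
(* Adding 1 keeps e positive when the norm is 0. *)
move=> p1 mf Nf; set e := fine ('N[leb R n]_(p%:E)[EFin \o f])%E + 1.
have N0 := Lnorm_ge0 (leb R n) p%:E (EFin \o f).
have e0 : 0 < e by rewrite ltr_wpDl// fine_ge0.
have Ne : ('N[leb R n]_(p%:E)[EFin \o f] <= e%:E)%E.
  by rewrite EFinD fineK ?ge0_fin_numE// leeDl.
have mC := @measurable_cube R n M.
have I := integral_norm_le_Lnorm p1 e0 (measurable_bor_leb mC) (measurable_fun_bor_leb mf)
  Ne.
apply/integrableP; split.
  by apply/measurable_EFinP; exact: measurable_funTS.
apply: (@le_lt_trans _ _ (e%:E * (bleb R n (cube M) + 1))%E); last first.
  by rewrite lte_mul_pinfty ?lee_fin ?ltW// lte_add_pinfty ?ltry ?cube_lty.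
apply: le_trans I; rewrite le_eqVlt; apply/orP; left; apply/eqP.
rewrite [LHS]integral_mkcond [RHS]integral_mkcond.
rewrite -(@ge0_leb_integral R n ((fun x => `|f x|%:E) \_ (cube M)))//.
  apply/(measurable_restrictT _ _).1 => //; apply/measurable_EFinP.
  by apply: measurable_funTS; exact: measurableT_comp.
by move=> x; rewrite patchE; case: ifP.
Qed.

Lemma integrable_mul_cube (f psi : bor R n -> R) (M : R) :
  (bleb R n).-integrable (cube M) (EFin \o f) ->
  continuous (psi : 'rV[R]_n -> R) -> (forall x, ~ cube M x -> psi x = 0) ->
  (bleb R n).-integrable setT (EFin \o (fun x => f x * psi x)).
Proof.
move=> fi cpsi psi0.
have [C psiC] : exists C, forall x, cube M x -> `|psi x| <= C.
  have : compact (psi @` (cube M : set 'rV[R]_n)).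
    apply: continuous_compact; first exact: continuous_subspaceT.
    exact: compact_cbox.
  move=> /compact_bounded[C [_ /(_ (C + 1))]]; rewrite ltrDl ltr01 => /(_ isT) H.
  by exists (C + 1) => x Mx; apply: H; exists x.
apply: (@integrable_mul_bounded _ _ _ _ (cube M) (Num.max 0 C)) => //.
- exact: measurable_cube.
- exact: continuous_bor.
- move=> x; have [Mx|nMx] := pselect (cube M x).
    by rewrite le_max psiC ?orbT.
  by rewrite psi0// normr0 le_max lexx.
Qed.

(** Taken with D the complement of [K] and with D the whole space, this brings the weak identities
    on both domains to one and the same Borel integral. *)
Lemma leb_integral_modification (D Z : set (bor R n)) (v v' psi : 'rV[R]_n -> R) :
  measurable (D : set space) -> measurable Z -> bleb R n Z = 0%E -> ~` D `<=` Z ->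
  measurable_fun (D : set space) v -> measurable_fun [set: bor R n] (v' : bor R n -> R) ->
  (forall x, ~ Z x -> v' x = v x) -> continuous psi ->
  (bleb R n).-integrable setT (EFin \o (fun x => v' x * psi x)) ->
  (\int[leb R n]_(x in (D : set space)) (v x * psi x)%:E =
   \int[bleb R n]_x (v' x * psi x)%:E)%E.
Proof.
move=> mD mZ Z0 DZ mv mv' vv' cpsi vi.
have mpsi : measurable_fun [set: space] psi.
  by apply: measurable_fun_bor_leb; exact: continuous_bor.
have mvp : measurable_fun [set: bor R n] (fun x => v' x * psi x).
  by apply: measurable_funM => //; exact: continuous_bor.
rewrite -(@leb_integral R n (fun x => (v' x * psi x)%:E)); last 2 first.
- exact/measurable_EFinP.
- exact: integrable_bor_leb.
rewrite integral_mkcond; apply: ae_eq_integral => //.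
- apply/(measurable_restrictT _ _).1 => //; apply/measurable_EFinP.
  by apply: measurable_funM => //; exact: measurable_funTS.
- by apply/measurable_EFinP; exact: measurable_fun_bor_leb.
apply: (@ae_off_null _ _ _ (leb R n) Z) => //; first exact: measurable_bor_leb.
move=> x nZx _; rewrite patchE ifT ?vv'//.
by rewrite in_setE; apply: contrapT => nDx; exact/nZx/DZ.
Qed.

End reduction_to_borel.

Section lines.
Variables (R : realType) (n : nat) (i : 'I_n.+1) (K : set 'rV[R]_n.+1).
Local Notation N := n.+1.
Local Notation lam := (@lebesgue_measure R).

Definition many_lines := exists (d : 'rV[R]_N) (B : 'M[R]_(n, N)) (L : set (set 'rV[R]_N)),
  [/\ perpendicular_frame d B, parallel_to d L, measurable (hyperplane_trace d B L),
      leb R n (hyperplane_trace d B L) <> 0%E & forall l, L l -> ~ countable (l `&` K)].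

(** Every chosen line, not almost every one, must meet [K] in an uncountable set, so the exceptional
    null set [Z] is removed from [S]. Distinct base points give distinct lines, hence the trace is
    exactly the remaining set. *)
Lemma many_lines_slices (S : set (bor R n)) : measurable S -> bleb R n S <> 0%E ->
  (\forall y \ae bleb R n, S y -> ~ countable [set t | K (slice i y t)]) -> many_lines.
Proof.
move=> mS S0 [Z [mZ Z0 SZ]].
exists (delta_mx 0 i), (coord_frame R i),
  [set line (y *m coord_frame R i) (delta_mx 0 i) | y in S `\` Z].
have -> : hyperplane_trace (delta_mx 0 i) (coord_frame R i)
    [set line (y *m coord_frame R i) (delta_mx 0 i) | y in S `\` Z] = S `\` Z.
  apply/seteqP; split => [y [y' Sy' /line_coord_inj <-]//|y Sy].
  by exists y.
have mSZ : measurable (S `\` Z) by exact: measurableD.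
split.
- exact: coord_frame_perp.
- by move=> _ [y _ <-]; exists (y *m coord_frame R i).
- exact: measurable_bor_leb.
- move=> SZ0; apply: S0; apply: measure_negligible => //.
  apply: (@negligibleS _ _ _ _ ((S `\` Z) `|` Z)).
    by move=> y Sy; have [Zy|nZy] := pselect (Z y); [right|left].
  by apply: negligibleU; apply/negligibleP.
- move=> _ [y [Sy nZ] <-] cl; apply: nZ; apply: SZ => /= /(_ Sy); apply.
  (* The i-th coordinate is the parameter along the line, so the set of parameters is an image of
     the intersection with [K]. *)
  rewrite (_ : [set t | _] = (fun x => x 0 i) @`
    (line (y *m coord_frame R i) (delta_mx 0 i) `&` K)).
    exact: card_le_trans (card_image_le _ _) cl.
  rewrite line_coord; apply/seteqP; split => t /=.
    by move=> Kt; exists (slice i y t); rewrite ?slice_eq//; split => //; exists t.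
  by move=> [_ [[s _ <-] Ks] <-]; rewrite slice_eq.
Qed.

Lemma many_lines_positive_measure : compact K -> leb R N K <> 0%E -> many_lines.
Proof.
move=> cK K0.
have mK : measurable (K : set (bor R N)).
  by apply: measurable_closed_bor; exact: compact_closed_rV.
pose f (x : bor R N) : \bar R := (\1_K x)%:E.
have mf : measurable_fun [set: bor R N] f.
  by apply/measurable_EFinP; exact: measurable_indic.
have f0 x : (0 <= f x)%E by rewrite lee_fin.
pose h (y : bor R n) : \bar R := (\int[lam]_t f (slice i y t))%E.
have mh : measurable_fun setT h.
  have := @measurable_fun_fubini_tonelli_F _ _ _ _ _ lam (f \o @slicef R n i).
  move=> H; apply: H => [|z]; last exact: f0.
  exact: (measurableT_comp mf (@measurable_slicef R n i)).
have hE y : h y = lam [set t | K (slice i y t)].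
  rewrite /h /f -[RHS]mul1e -integral_cst//; last first.
    have := @measurable_slice R n i y measurableT K mK.
    by rewrite setTI.
  rewrite [RHS]integral_mkcond; apply: eq_integral => t _.
  rewrite patchE indicE (_ : (slice i y t \in K) = (t \in [set s | K (slice i y s)])).
    by case: ifP.
  by apply/idP/idP; rewrite !inE.
have hn0 : (\int[bleb R n]_y h y <> 0)%E.
  by rewrite /h -(ge0_slice_integral i mf f0) integral_indic// setIT.
have [mS S0] := measure_nonzero_of_integral mh hn0.
apply: (many_lines_slices mS S0); apply: aeW => y /= + cK'; apply.
by rewrite hE countable_lebesgue_measure0.
Qed.

End lines.

Lemma Rintegral_off_null d (T : measurableType d) (R : realType)
    (mu : {measure set T -> \bar R}) (D Z : set T) (f f' : T -> R) :
  measurable D -> measurable Z -> mu Z = 0%E ->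
  measurable_fun setT f -> measurable_fun setT f' -> (forall x, ~ Z x -> f x = f' x) ->
  \int[mu]_(x in D) f x = \int[mu]_(x in D) f' x.
Proof.
move=> mD mZ Z0 mf mf' ff'; rewrite /Rintegral; congr fine.
apply: ae_eq_integral => //.
- by apply/measurable_EFinP; exact: measurable_funTS.
- by apply/measurable_EFinP; exact: measurable_funTS.
- by apply: (ae_off_null mZ Z0) => x nZx _; rewrite ff'.
Qed.

Lemma ae_mp d (T : measurableType d) (R : realType) (mu : {measure set T -> \bar R})
    (P Q : T -> Prop) : (\forall x \ae mu, P x) -> (\forall x \ae mu, P x -> Q x) ->
  \forall x \ae mu, Q x.
Proof. by apply: filterS2 => x Px; apply. Qed.

Section null_case.
Variables (R : realType) (n : nat) (i : 'I_n.+1) (K : set 'rV[R]_n.+1).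
Local Notation N := n.+1.
Local Notation lam := (@lebesgue_measure R).

(** [u'] is the Borel version to which Fubini's theorem applies, [u] the one that is continuous on
    lines. The lines sought lie over the points where the line integral [h] of the pairing is
    nonzero. *)
Lemma many_lines_of_pairing (p : R) (u : 'rV[R]_N -> R) (u' g : bor R N -> R)
    (Z : set (bor R N)) (phi : 'rV[R]_N -> R) :
  1 <= p -> compact K -> quasicontinuous p u ->
  measurable Z -> bleb R N Z = 0%E -> (forall x, ~ Z x -> u' x = u x) ->
  measurable_fun [set: bor R N] u' -> measurable_fun [set: bor R N] g ->
  (forall M : R, (bleb R N).-integrable (cube M) (EFin \o u')) ->
  (forall M : R, (bleb R N).-integrable (cube M) (EFin \o g)) ->
  (forall psi, test_function (~` K) psi ->
    \int[bleb R N]_x (u' x * partial i psi x + g x * psi x) = 0) ->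
  test_function setT phi ->
  \int[bleb R N]_x (u' x * partial i phi x + g x * phi x) <> 0 ->
  many_lines K.
Proof.
move=> p1 cK qu mZ Z0 u'u mu' mg ui gi weak [sphi cphi _] phin0.
have [M0 hM0] := compact_cbox_bound cphi.
(* The successor makes M positive; the support lies strictly inside the cube, so phi vanishes at
   both ends of [-M, M] on every line. *)
pose M : R := M0.+1%:R.
have M_gt0 : 0 < M by rewrite ltr0n.
have hM (x : 'rV[R]_N) j : support phi x -> `|x 0 j| < M.
  by move=> /hM0 /(_ j) /lt_le_trans; apply; rewrite ler_nat.
have out (x : 'rV[R]_N) j : ~~ (`|x 0 j| < M) -> phi x = 0 /\ partial i phi x = 0.
  move=> xM; have nx : ~ support phi x by move=> /(hM _ j); exact/negP.
  by split; [exact: out_support|exact: out_support_partial].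
have outc (x : 'rV[R]_N) : ~ cube M x -> phi x = 0 /\ partial i phi x = 0.
  move=> xM; have nx : ~ support phi x.
    move=> xs; apply: xM => j; rewrite !mxE.
    by have := hM _ j xs; rewrite ltr_norml => /andP[/ltW -> /ltW ->].
  by split; [exact: out_support|exact: out_support_partial].
pose F (x : bor R N) := u' x * partial i phi x + g x * phi x.
have cphi0 := smooth_continuous sphi.
have cdphi := smooth_continuous_partial (i := i) sphi.
have FI : (bleb R N).-integrable setT (EFin \o F).
  have I1 := integrable_mul_cube (ui M) cdphi (fun x xM => (outc x xM).2).
  have I2 := integrable_mul_cube (gi M) cphi0 (fun x xM => (outc x xM).1).
  exact: (integrableD measurableT I1 I2).
pose h (y : bor R n) : \bar R := (\int[lam]_t (F (slice i y t))%:E)%E.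
have hI : (bleb R n).-integrable setT h := integrable_fubini_F (slice_integrable i FI).
have hn0 : (\int[bleb R n]_y h y <> 0)%E.
  move=> h0; apply: phin0; rewrite /Rintegral -[RHS]/(fine 0%E) -h0.
  by rewrite (slice_integral i FI).
have [mS S0] := measure_nonzero_of_integral (measurable_int _ hI) hn0.
apply: (many_lines_slices (i := i) mS S0).
have mcM : measurable (cube M : set (bor R N)) by exact: measurable_cube.
have GI : (bleb R N).-integrable setT ((EFin \o g) \_ (cube M)).
  exact: (integrable_mkcond _ mcM).1 (gi M).
have A1 := quasicontinuous_ae_line i p1 qu.
have A2 := ae_line_weak_derivative cK ui gi weak.
have A3 := ae_section i mZ Z0.
have A4 := ae_integrable1 (slice_integrable i FI).
have A5 := ae_integrable1 (slice_integrable i GI).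
apply: (ae_mp A1); apply: (ae_mp A2); apply: (ae_mp A3); apply: (ae_mp A4);
  apply: (ae_mp A5).
(* A countable section must force h y = 0. On this line [u] is continuous ([y1]), the rational bump
   tests hold for [u'] ([y2]), [Z] has a null section ([y3]), and [F] and the truncated [g] are
   integrable ([y4], [y5]). *)
apply: aeW => y y5 y4 y3 y2 y1 Sy cKy; apply: Sy.
have My_or : cube M y \/ h y = 0%E.
  have [My|nMy] := pselect (cube M y); [by left|right].
  apply: integral0_eq => t _; have [|p0 d0] := outc (slice i y t).
    by move=> /slice_cube[].
  by rewrite /F p0 d0 !mulr0 addr0.
case: My_or => [My|//].
have gI : lam.-integrable `[- M, M] (EFin \o (fun t => g (slice i y t))).
  have : lam.-integrable `[- M, M] (fun t => ((EFin \o g) \_ (cube M)) (slice i y t)).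
    by apply: integrableS y5 => //; exact: measurable_itv.
  apply: eq_integrable => // t; rewrite inE /= in_itv /= => tM.
  by rewrite /= patchE ifT// inE; apply/slice_cube.
have mslice := @measurable_slice R n i y.
have mline (f : bor R N -> R) : measurable_fun [set: bor R N] f ->
    measurable_fun [set: measurableTypeR R] (fun t => f (slice i y t)).
  by move=> mf; exact: (measurableT_comp mf mslice).
have mZy : measurable (slice i y @^-1` Z : set (measurableTypeR R)).
  by have := mslice measurableT Z mZ; rewrite setTI.
have mphi := mline _ (continuous_bor cphi0).
have mdphi := mline _ (continuous_bor cdphi).
have mu_y : measurable_fun [set: measurableTypeR R] (fun t => u (slice i y t)).
  exact: continuous_measurable_fun.
(* The null section [y3] transfers the tests from [u'] to the continuous [u]. *)
have W : \int[lam]_(t in `[- M, M]) (u (slice i y t) * partial i phi (slice i y t) +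
    g (slice i y t) * phi (slice i y t)) = 0.
  apply: (line_weak_identity M_gt0 _ cKy y1 gI) => //.
  - have cl : closed K by exact: compact_closed_rV.
    by apply: closed_comp cl => t _; exact: slice_continuous.
  - by move=> t; exact: is_derive_slice.
  - by move=> t; apply: continuous_comp; [exact: slice_continuous|exact: cdphi].
  - by apply: (out _ i _).1; rewrite slice_eq normrN ger0_norm ?ltxx// ltW.
  - by apply: (out _ i _).1; rewrite slice_eq ger0_norm ?ltxx// ltW.
  move=> q r _ _ _ qrK k; rewrite -[RHS](y2 q r qrK k) /bump_pairing.
  have mb : measurable_fun [set: measurableTypeR R] (bump k.+1%:R^-1 (ratr q) (ratr r) : R
    -> R).
    by apply: continuous_measurable_fun; apply: continuous_bumpy; apply: bumpy_bump;
      rewrite invr_gt0.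
  have mdb : measurable_fun [set: measurableTypeR R] (dbump k.+1%:R^-1 (ratr q) (ratr r) :
    R -> R).
    by apply: continuous_measurable_fun; apply: continuous_dbump; rewrite invr_gt0.
  apply: (Rintegral_off_null _ mZy y3) => //.
  - by apply: measurable_funD; apply: measurable_funM => //; apply: mline.
  - apply: measurable_funD; apply: measurable_funM; do ?exact: mline.
    + by apply: eq_measurable_fun mdb => t _ /=; rewrite slice_eq.
    + by apply: eq_measurable_fun mb => t _ /=; rewrite slice_eq.
  - by move=> t /u'u ->; rewrite slice_eq.
have hE : h y = (\int[lam]_(t in `[(- M)%R, M]) (F (slice i y t))%:E)%E.
  rewrite [RHS]integral_mkcond; apply: eq_integral => t _; rewrite patchE.
  case: ifPn => // /negP tM; have [|p0 d0] := outc (slice i y t).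
    by move=> /slice_cube[tM' _]; apply: tM; rewrite inE /= in_itv.
  by rewrite /F p0 d0 !mulr0 addr0.
rewrite hE -[LHS]fineK; last first.
  apply: integrable_fin_num => //.
  by apply: integrableS y4 => //; exact: measurable_itv.
congr EFin; rewrite -[RHS]W -/(Rintegral _ _ _) /F.
apply: (Rintegral_off_null _ mZy y3) => //.
- by apply: measurable_funD; apply: measurable_funM => //; exact: mline.
- by apply: measurable_funD; apply: measurable_funM => //; exact: mline.
- by move=> t /u'u ->.
Qed.

End null_case.

Lemma restrict_in (T : Type) (V : pointedType) (f : T -> V) (A : set T) x :
  A x -> (f \_ A) x = f x.
Proof. by move=> Ax; rewrite patchE mem_set. Qed.

Lemma restrict_out (T : Type) (V : pointedType) (f : T -> V) (A : set T) x :
  ~ A x -> (f \_ A) x = point.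
Proof. by move=> Ax; rewrite patchE memNset. Qed.

Section sobolev_on_complement.
Variables (R : realType) (n : nat).
Local Notation N := n.+1.
Local Notation space := (lebesgue_space R N).
Implicit Types (K : set 'rV[R]_N) (u phi : 'rV[R]_N -> R).

Lemma test_function_cube (Omega : set 'rV[R]_N) phi : test_function Omega phi ->
  exists2 M : R, 0 < M & forall (x : 'rV[R]_N) j, M <= `|x 0 j| ->
    phi x = 0 /\ forall i, partial i phi x = 0.
Proof.
move=> [_ /compact_cbox_bound[M hM] _]; exists M.+1%:R => // x j xM.
have nx : ~ support phi x.
  move=> /hM/(_ j); apply/negP; rewrite -leNgt; apply: le_trans xM.
  by rewrite ler_nat.
by split=> [|i]; [exact: out_support|exact: out_support_partial].
Qed.

Lemma cubeN (M : R) (x : 'rV[R]_N) : ~ cube M x -> exists j, M <= `|x 0 j|.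
Proof.
move=> xM; apply: contrapT => H; apply: xM => j; rewrite !mxE -ler_norml.
by rewrite leNgt; apply/negP => /ltW Mx; apply: H; exists j.
Qed.

Lemma measurable_closed_leb K : closed K -> measurable (K : set space).
Proof. by move=> cK; apply: measurable_bor_leb; exact: measurable_closed_bor. Qed.

Lemma Lp_norm_le (p : R) (D D' Z : set space) (u v : 'rV[R]_N -> R) : 1 <= p ->
  measurable D -> measurable D' -> measurable Z -> leb R N Z = 0%E ->
  measurable_fun D u -> measurable_fun D' v ->
  (forall x, ~ Z x -> D x -> D' x /\ u x = v x) ->
  (Lp_norm p D u <= Lp_norm p D' v)%E.
Proof.
move=> p1 mD mD' mZ Z0 mu mv uv; apply: (Lnorm_le_off_null p1 _ _ mZ Z0).
- exact/(measurable_restrictT _ mD).1.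
- exact/(measurable_restrictT _ mD').1.
- move=> x nZx; rewrite !patchE; case: ifPn => [/set_mem Dx|_]; last by rewrite normr0.
  by have [D'x ->] := uv _ nZx Dx; rewrite mem_set.
Qed.

(** A test function supported off [K] is one on the whole space, and it vanishes on [K] together
    with its partial derivatives. Failure of the J_p-property thus lies in the other inclusion. *)
Lemma W1p_setT_sub (p : R) K : 1 <= p -> closed K -> W1p p setT `<=` W1p p (~` K).
Proof.
move=> p1 cK u [mu [g [mg wg Ng]]].
have mKc : measurable (~` K : set space) by apply: measurableC;
  exact: measurable_closed_leb.
have Lle v : measurable_fun [set: space] v -> (Lp_norm p (~` K) v <= Lp_norm p setT v)%E.
  move=> mv; apply: (Lp_norm_le (Z := set0) p1 mKc measurableT) => //.
  exact: measurable_funTS.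
split; first exact: measurable_funTS.
exists g; split.
- by move=> i; exact: measurable_funTS.
- move=> i phi tphi; have [sphi cphi phiK] := tphi.
  have E (v psi : 'rV[R]_N -> R) : (forall x, K x -> psi x = 0) ->
      (\int[leb R N]_(x in ~` K) (v x * psi x)%:E = \int[leb R N]_x (v x * psi x)%:E)%E.
    move=> psi0; rewrite integral_mkcond; apply: eq_integral => x _; rewrite patchE.
    by case: ifPn => // /negP; rewrite in_setC => /negP/negPn/set_mem/psi0 ->;
      rewrite mulr0.
  have nK x : K x -> ~ support phi x by move=> Kx /phiK.
  rewrite !E; last 2 first.
  - by move=> x /nK; exact: out_support.
  - by move=> x /nK; exact: out_support_partial.
  by apply: wg; split.
- apply: le_lt_trans Ng; apply: leeD; first exact: Lle.
  by apply: lee_sum => i _; exact: Lle.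
Qed.

Lemma many_lines_null_set (p : R) K u : 1 <= p -> compact K -> leb R N K = 0%E ->
  quasicontinuous p u -> W1p p (~` K) u -> ~ W1p p setT u -> many_lines K.
Proof.
move=> p1 cK K0 qu [_ [g [mg wg Ng]]] nW.
have mu : measurable_fun [set: space] u by case: qu.
have clK := compact_closed_rV cK.
have mK := measurable_closed_leb clK.
have mKc : measurable (~` K : set space) by exact: measurableC.
pose gt i := g i \_ (~` K).
have mgt i : measurable_fun [set: space] (gt i) by exact/(measurable_restrictT _ mKc).1.
have gtE i x : ~ K x -> gt i x = g i x by move=> nKx; rewrite /gt patchE mem_set.
(* Since [K] is null, the extended functions have the same norms; if all of them were weak
   derivatives on the whole space, [u] would belong to W^{1,p} there. *)
have /existsNP[i /existsNP[phi /not_implyP[tphi phin]]] : ~ forall i, weak_partial setT i u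
  (gt i).
  move=> wgt; apply: nW; split=> //; exists gt; split => //.
  apply: le_lt_trans Ng; apply: leeD.
    by apply: (Lp_norm_le p1 measurableT mKc mK K0) => //; exact: measurable_funTS.
  apply: lee_sum => i _.
  by apply: (Lp_norm_le p1 measurableT mKc mK K0) => // x nKx _; rewrite gtE.
have [Z1 [mZ1 Z10 mu1]] := borel_fun_approx mu.
have [Z2 [mZ2 Z20 mg2]] := borel_fun_approx (mgt i).
have mKb : measurable (K : set (bor R N)) by exact: measurable_closed_bor.
(* Including [K] makes [g'] agree off [Z] both with [g i] and with its extension by 0. *)
pose Z : set (bor R N) := Z1 `|` Z2 `|` K.
have mZ : measurable Z by do 2!apply: measurableU => //.
have Z0 : bleb R N Z = 0%E.
  by apply: measure_negligible => //; do 2?apply: negligibleU; apply/negligibleP.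
have mZC : measurable (~` Z) by exact: measurableC.
pose u' : bor R N -> R := u \_ (~` Z).
pose g' : bor R N -> R := g i \_ (~` Z).
have u'E x : ~ Z x -> u' x = u x by move=> nZx; rewrite /u' patchE mem_set.
have g'E x : ~ Z x -> g' x = g i x by move=> nZx; rewrite /g' patchE mem_set.
have mu' : measurable_fun [set: bor R N] u'.
  have -> : u' = (u \_ (~` Z1)) \_ (~` Z).
    apply/funext => x; have [Zx|nZx] := pselect (Z x).
      by rewrite [LHS]restrict_out ?[RHS]restrict_out//; apply.
    rewrite [RHS]restrict_in// restrict_in ?u'E// => Z1x.
    by apply: nZx; left; left.
  exact: ((measurable_restrictT _ mZC).1 (measurable_funTS mu1)).
have mg' : measurable_fun [set: bor R N] g'.
  have -> : g' = (gt i \_ (~` Z2)) \_ (~` Z).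
    apply/funext => x; have [Zx|nZx] := pselect (Z x).
      by rewrite [LHS]restrict_out ?[RHS]restrict_out//; apply.
    rewrite [RHS]restrict_in// restrict_in ?g'E ?gtE// => [Kx|Z2x]; apply: nZx.
      by right.
    by left; right.
  exact: ((measurable_restrictT _ mZC).1 (measurable_funTS mg2)).
have fin v v' : measurable_fun (~` K : set space) v -> (Lp_norm p (~` K) v < +oo)%E ->
    measurable_fun [set: bor R N] (v' : bor R N -> R) -> v' = v \_ (~` Z) ->
    forall M : R, (bleb R N).-integrable (cube M) (EFin \o v').
  move=> mv Nv mv' v'E M; apply: (@integrable_cube R N p M v' p1 mv').
  have := @Lp_norm_le p (~` Z) (~` K) set0 v v p1 (measurable_bor_leb mZC) mKc measurable0
    _ _ mv.
  rewrite /Lp_norm -v'E => H; apply: le_lt_trans Nv; apply: H => //.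
    by apply: measurable_funS mv => // x nZx Kx; apply: nZx; right.
  by move=> x _ nZx; split=> // Kx; apply: nZx; right.
have N0 v : (0 <= Lp_norm p (~` K) v)%E by exact: Lnorm_ge0.
have ui := fin u u' _ _ mu' erefl.
have {}ui : forall M : R, (bleb R N).-integrable (cube M) (EFin \o u').
  apply: ui; first exact: measurable_funTS.
  by apply: le_lt_trans Ng; rewrite /sobolev_norm leeDl// sume_ge0.
have gi : forall M : R, (bleb R N).-integrable (cube M) (EFin \o g').
  apply: (fin (g i) g' (mg i) _ mg' erefl).
  apply: le_lt_trans Ng; rewrite /sobolev_norm (bigD1 i)//= addeCA leeDl//.
  by rewrite adde_ge0// sume_ge0.
(* Used forwards on the complement of [K], to obtain the vanishing pairings, and backwards on the
   whole space, where the identity fails. Both integrals are finite, so moving one across the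
   equality is legitimate in the extended reals. *)
have pair (D Omega : set 'rV[R]_N) v psi : measurable (D : set space) -> ~` D `<=` K ->
    measurable_fun (D : set space) v -> (forall x, ~ K x -> v x = g i x) ->
    test_function Omega psi ->
    (\int[leb R N]_(x in D) (u x * partial i psi x)%:E = - \int[leb R N]_(x in D) (v x *
      psi x)%:E)%E <->
    \int[bleb R N]_x (u' x * partial i psi x + g' x * psi x) = 0.
  move=> mD DK mv vE tpsi; have [M M0 hM] := test_function_cube tpsi.
  have [spsi _ _] := tpsi.
  have DZ : ~` D `<=` Z by move=> x /DK; right.
  have cpsi := smooth_continuous spsi.
  have cdpsi := smooth_continuous_partial (i := i) spsi.
  have I1 : (bleb R N).-integrable setT (EFin \o (fun x => u' x * partial i psi x)).
    by apply: (integrable_mul_cube (ui M) cdpsi) => x /cubeN[j /hM[_ ->]].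
  have I2 : (bleb R N).-integrable setT (EFin \o (fun x => g' x * psi x)).
    by apply: (integrable_mul_cube (gi M) cpsi) => x /cubeN[j /hM[->]].
  rewrite (leb_integral_modification mD mZ Z0 DZ _ mu' u'E cdpsi I1);
    last exact: measurable_funTS.
  rewrite (leb_integral_modification mD mZ Z0 DZ mv mg' _ cpsi I2); last first.
    by move=> x nZx; rewrite g'E// vE// => Kx; apply: nZx; right.
  rewrite RintegralD// -[X in X = _]fineK ?integrable_fin_num//.
  rewrite -[X in (- X)%E]fineK ?integrable_fin_num// -EFinN /Rintegral.
  split; first by move=> [->]; rewrite addNr.
  by move=> /eqP; rewrite addr_eq0 => /eqP ->.
apply: (many_lines_of_pairing p1 cK qu mZ Z0 u'E mu' mg' ui gi _ tphi).
- move=> psi tpsi; apply: ((pair (~` K) (~` K) (g i) psi _ _ _ _ tpsi).1 (wg i _ tpsi)) =>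
  //.
  by rewrite setCK.
- move=> H; apply: phin; apply: ((pair setT setT (gt i) phi _ _ _ _ tphi).2 H) => //.
    by rewrite setCT.
  exact: gtE.
Qed.

End sobolev_on_complement.

Theorem corollary1p8 (R : realType) (n : nat) (p : R) (K : set 'rV[R]_n.+1)
  (hp : 1 <= p) (hK : compact K) (hJ : ~ J_property p K) :
  exists (d : 'rV[R]_n.+1) (B : 'M[R]_(n, n.+1)) (L : set (set 'rV[R]_n.+1)),
    [/\ perpendicular_frame d B,
        parallel_to d L,
        measurable (hyperplane_trace d B L),
        leb R n (hyperplane_trace d B L) <> 0%E
      & forall l, L l -> ~ countable (l `&` K)].
Proof.
have [K0|K0] := pselect (leb R n.+1 K = 0%E);
  last exact: (many_lines_positive_measure ord0).
have [u [[qu uK] nu]] : exists u : 'rV[R]_n.+1 -> R,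
    (quasicontinuous p `&` W1p p (~` K)) u /\ ~ W1p p setT u.
  apply: contrapT => H; apply: hJ; apply/seteqP; split => u [qu Wu]; split => //.
    by apply: contrapT => nu; apply: H; exists u.
  by apply: (W1p_setT_sub hp) => //; exact: compact_closed_rV.
exact: (many_lines_null_set hp hK K0 qu uK nu).
Qed.
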